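(* Let $d\ge 2$ and let $\mu$ be a stationary $\mathbb{Z}^d$ Gibbs measure whose specification satisfies strong spatial mixing. Let $(K_n)_{n\in\mathbb{N}}$ be a sequence of sets satisfying $K_n\subset B_n\setminus\{\mathbf{0}\}$ and $|K_n|=O(n^{d-1})$. Then there is an algorithm which, on input $n$, computes upper and lower bounds to $H_\mu(\{\mathbf{0}\}\mid K_n)$ in time $e^{O(n^{(d-1)^2})}$ to within tolerance $e^{-n^{d-1}}$ (i.e. it outputs numbers $H_n^-\le H_\mu(\{\mathbf{0}\}\mid K_n)\le H_n^+$ with $H_n^+-H_n^-\le e^{-n^{d-1}}$).
   Context: $\mathbb{Z}^d$ is viewed as the graph in which $u,v$ are adjacent iff $\sum_{i=1}^d|u_i-v_i|=1$; $\partial S$ is the set of $v\in\mathbb{Z}^d\setminus S$ adjacent to some element of $S$; $\mathbf{0}$ is the origin; $B_n=[-n,n]^d\cap\mathbb{Z}^d$; $e_1,\dots,e_d$ are the standard basis vectors. An alphabet $\mathcal{A}$ is a finite set with at least two elements. Elements of $\mathcal{A}^S$ are configurations with shape $S$; juxtaposition is concatenation of configurations on disjoint shapes; $w|_T$ is restriction. For a Borel probability measure $\mu$ on $\mathcal{A}^{\mathbb{Z}^d}$ ($\mathbb{Z}^d$-measure) and a configuration $w$ on finite $S$, $\mu(w)$ is the measure of the cylinder $\{x:x|_S=w\}$. Stationary means translation-invariant. $\mu$ is a $\mathbb{Z}^d$ Markov random field (MRF) if for any finite $S$, $\eta\in\mathcal{A}^S$, finite $T$ with $\partial S\subseteq T\subseteq\mathbb{Z}^d\setminus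 S$, and $\delta\in\mathcal{A}^T$ with $\mu(\delta)>0$, $\mu(\eta\mid\delta|_{\partial S})=\mu(\eta\mid\delta)$. Gibbs specification: let $\gamma:\mathcal{A}\to(0,\infty)$ and $\beta_i:\mathcal{A}\times\mathcal{A}\to[0,\infty)$, $i=1,\dots,d$ (the local interactions). For finite $V\subset\mathbb{Z}^d$ and $w\in\mathcal{A}^V$, $I(w)=\big(\prod_{v\in V}\gamma(w_v)\big)\prod_{i=1}^d\prod_{\{v\in V:\,v+e_i\in V\}}\beta_i(w_v,w_{v+e_i})$. A configuration $\delta\in\mathcal{A}^{\partial V}$ is $V$-admissible if some $w\in\mathcal{A}^V$ has $I(w\delta)>0$. For finite $V$, $V$-admissible $\delta$, and $w\in\mathcal{A}^V$, let $\Lambda^\delta(w)=I(w\delta)/\sum_{x\in\mathcal{A}^V}I(x\delta)$. The collection $\Lambda=\{\Lambda^\delta\}_{V,\delta}$ is a stationary $\mathbb{Z}^d$ Gibbs specification. $\Lambda^\delta$ is a probability measure on $\mathcal{A}^V$, with marginals on $\mathcal{A}^U$, $U\subset V$, also denoted $\Lambda^\delta$; it is also regarded as a probability measure on configurations on $V\cup\partial V$ agreeing with $\delta$ on $\partial V$. A stationary $\mathbb{Z}^d$ Gibbs measure for the specification is a stationary $\mathbb{Z}^d$ MRF $\mu$ such that for any finite $V$ and $\delta\in\mathcal{A}^{\partial V}$ with $\mu(\delta)>0$, $\delta$ is $V$-admissible and $\mu(x\mid\delta)=\Lambda^\delta(x)$ for all $x\in\mathcal{A}^V$. The specification satisfies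 strong spatial mixing (SSM) if there exist $C,\alpha>0$ such that for all finite $V$, $u\in V$, $\partial V\subseteq T\subset V\cup\partial V$, $x\in\mathcal{A}^{\{u\}}$, and $y,z\in\mathcal{A}^T$ such that $\delta=y|_{\partial V}$ and $\eta=z|_{\partial V}$ are $V$-admissible and $\Lambda^\delta(y),\Lambda^\eta(z)>0$, one has $|\Lambda^\delta(x\mid y)-\Lambda^\eta(x\mid z)|\le Ce^{-\alpha d(\{u\},D(y,z))}$, where $D(y,z)=\{v:y_v\ne z_v\}$ and $d$ is $L^1$ distance (infinite if $D(y,z)=\varnothing$). For disjoint finite $S,T$, $H_\mu(S\mid T)=\sum_{w\in\mathcal{A}^{S\cup T},\,\mu(w|_T)>0}-\mu(w)\log\frac{\mu(w)}{\mu(w|_T)}$ (terms with $\mu(w)=0$ omitted). $f=O(g)$ means $|f(n)|\le c\,g(n)$ for some constant $c>0$ and all large $n$. Running time convention: computation of the parameters $\gamma,\beta_i$ is not counted; approximations to $\gamma$ and $\beta_i$ with arbitrarily good precision are assumed given before any computation. The sequence $(K_n)$ is regarded as available to the algorithm. The algorithm does not depend on knowledge of the specific values of $C$ and $\alpha$. *)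

(* Defs.v *)
From HB Require Import structures.
From mathcomp Require Import all_boot all_order all_algebra finmap.
From mathcomp Require Import all_classical all_reals all_analysis.
From mathcomp Require Import zify.

Set Implicit Arguments.
Unset Strict Implicit.
Unset Printing Implicit Defensive.

Import Order.TTheory GRing.Theory Num.Theory.

Local Open Scope classical_set_scope.
Local Open Scope fset_scope.
Local Open Scope ring_scope.

(* Measurable types are pointed in MathComp-Analysis, so alphabets carry a
   distinguished letter; it plays no other role. *)
#[short(type="alphabetType")]
HB.structure Definition Alphabet := {A of Finite A & isPointed A}.

Definition bigOh (R : realType) (f g : nat -> R) : Prop :=
  exists2 c : R, 0 < c &
  exists N : nat, forall n, (N <= n)%N -> `|f n| <= c * g n.

Section Lattice.
Variable d : nat.

Definition l1dist (u v : 'rV[int]_d) : nat :=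
  (\sum_(i < d) `|u ord0 i - v ord0 i|)%N.

Definition adjacent (u v : 'rV[int]_d) : bool := l1dist u v == 1%N.

(* fset_set is only meaningful on finite sets: see in_boundary below. *)
Definition boundary (S : {fset 'rV[int]_d}) : {fset 'rV[int]_d} :=
  fset_set [set v | v \notin S /\ exists2 u, u \in S & adjacent u v].

Definition unit_vec (i : 'I_d) : 'rV[int]_d := delta_mx ord0 i.

Definition in_box (n : nat) (v : 'rV[int]_d) : bool :=
  [forall i, `|v ord0 i|%N <= n]%N.

Lemma finite_box n : finite_set [set v | in_box n v].
Proof.
pose g (f : {ffun 'I_d -> 'I_(n.*2.+1)}) : 'rV[int]_d :=
  \row_i ((f i)%:Z - n%:Z).
apply: (@sub_finite_set _ _ (g @` setT)); last first.
  exact/finite_image/finite_finset.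
move=> v /= /forallP vn.
have h i : (`|(v ord0 i + n%:Z)%R|%N < n.*2.+1)%N.
  have := vn i; case: (v ord0 i) => m /=; rewrite ?NegzE; lia.
exists [ffun i => Ordinal (h i)] => //.
apply/rowP => i; rewrite !mxE ffunE /=.
have := vn i; case: (v ord0 i) => m /=; rewrite ?NegzE; lia.
Qed.

Lemma in_boundary (S : {fset 'rV[int]_d}) v :
  (v \in boundary S) = (v \notin S) && [exists u : S, adjacent (val u) v].
Proof.
have fin : finite_set [set v | v \notin S /\ exists2 u, u \in S & adjacent u v].
  apply: (@sub_finite_set _ _
    (\bigcup_(u in [set` S]) [set v | in_box (l1dist u 0).+1 v])).
    move=> w [_ [u uS /eqP uw]]; exists u => //=; apply/forallP => i.
    have : (`|(u ord0 i - w ord0 i)%R|%N <= l1dist u w)%N.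
      by rewrite /l1dist (bigD1 i)//= leq_addr.
    have : (`|(u ord0 i - (0 : 'rV[int]_d) ord0 i)%R|%N <= l1dist u 0)%N.
      by rewrite /l1dist (bigD1 i)//= leq_addr.
    rewrite uw mxE; lia.
  by apply: bigcup_finite => // u _; exact: finite_box.
rewrite in_fset_set//; apply/idP/andP.
  rewrite inE => -[vS [u uS uv]]; split => //.
  by apply/existsP; exists [` uS].
move=> [vS /existsP[u uv]]; rewrite inE; split => //.
by exists (val u) => //; exact: fsvalP.
Qed.

End Lattice.

Section Configurations.
Variables (d : nat) (A : alphabetType).

Definition cfg (S : {fset 'rV[int]_d}) : Type := {ffun S -> A}.
HB.instance Definition _ S := Finite.on (cfg S).

Definition restr (S T : {fset 'rV[int]_d}) (TS : T `<=` S) (w : cfg S) :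
  cfg T := [ffun t => w (fincl TS t)].

(* Concatenation; on overlapping shapes w would take precedence, but it is only
   used on disjoint ones. *)
Definition concat (S T : {fset 'rV[int]_d}) (w : cfg S) (x : cfg T) :
    cfg (S `|` T) :=
  [ffun u => match fsetULVR (fsvalP u) with
             | inl uS => w [` uS]
             | inr uT => x [` uT]
             end].

(* For T a subset of S, this says that the restriction of w to T is x. *)
Definition agree (S T : {fset 'rV[int]_d}) (w : cfg S) (x : cfg T) : bool :=
  [forall s : S, forall t : T, (val s == val t) ==> (w s == x t)].

Definition diff_set (T : {fset 'rV[int]_d}) (y z : cfg T) :
  set 'rV[int]_d := [set v | exists2 t : T, val t = v & y t != z t].

Definition fullshift : Type := {ptws 'rV[int]_d -> discrete_topology A}.
HB.instance Definition _ := Topological.on fullshift.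
HB.instance Definition _ := isPointed.Build fullshift (fun=> point).

Definition borel_fullshift : Type := g_sigma_algebraType (@open fullshift).
HB.instance Definition _ := Measurable.on borel_fullshift.

Definition cylinder (S : {fset 'rV[int]_d}) (w : cfg S) :
  set borel_fullshift := [set x | forall s : S, x (val s) = w s].

Lemma measurable_cylinder (S : {fset 'rV[int]_d}) (w : cfg S) :
  measurable (cylinder w).
Proof.
have -> : cylinder w =
    \big[setI/setT]_(s <- index_enum S) [set x | x (val s) = w s].
  rewrite -bigcap_seq; apply/seteqP; split=> [x wx s _|x wx s]; first exact: wx.
  by apply: wx => /=; rewrite mem_index_enum.
elim/big_ind: _ => [|E F mE mF|s _]; first exact: measurableT.
  exact: measurableI.
apply: sub_sigma_algebra.
have /(_ [set w s] (discrete_open _)) := (continuousP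
  (@proj _ _ (val s) : fullshift -> discrete_topology A)).1
  (@proj_continuous _ (fun=> discrete_topology A) (val s)).
exact.
Qed.

Definition shift (v : 'rV[int]_d) (x : borel_fullshift) : borel_fullshift :=
  fun u => x (u + v).

End Configurations.

Section Measures.
Variables (R : realType) (d : nat) (A : alphabetType).
Variable mu : probability (borel_fullshift d A) R.

Definition stationary : Prop :=
  forall (v : 'rV[int]_d) (E : set (borel_fullshift d A)),
    measurable E -> mu (shift v @^-1` E) = mu E.

Definition pr (S : {fset 'rV[int]_d}) (w : cfg A S) : R :=
  fine (mu (cylinder w)).

Definition cond_pr (S T : {fset 'rV[int]_d}) (x : cfg A S) (y : cfg A T) : R :=
  fine (mu (cylinder x `&` cylinder y)%classic) / fine (mu (cylinder y)).

Definition markov_random_field : Prop :=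
  forall (S : {fset 'rV[int]_d}) (eta : cfg A S) (T : {fset 'rV[int]_d})
         (ST : boundary S `<=` T) (delta : cfg A T),
    [disjoint T & S]%fset -> 0 < pr delta ->
    cond_pr eta (restr ST delta) = cond_pr eta delta.

Definition cond_entropy (S T : {fset 'rV[int]_d}) : R :=
  \sum_(w : cfg A (S `|` T)
         | (0 < pr (restr (fsubsetUr S T) w)) && (0 < pr w))
    - (pr w * ln (pr w / pr (restr (fsubsetUr S T) w))).

End Measures.

Section Specification.
Variables (R : realType) (d : nat) (A : alphabetType).
Variables (gamma : A -> R) (beta : 'I_d -> A -> A -> R).

Definition interaction (V : {fset 'rV[int]_d}) (w : cfg A V) : R :=
  (\prod_(v : V) gamma (w v)) *
  \prod_(i < d) \prod_(p : V * V | val p.2 == val p.1 + unit_vec i)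
    beta i (w p.1) (w p.2).

Definition admissible (V : {fset 'rV[int]_d}) (delta : cfg A (boundary V)) :
  Prop := exists w : cfg A V, 0 < interaction (concat w delta).

Definition spec (V : {fset 'rV[int]_d}) (delta : cfg A (boundary V))
    (w : cfg A V) : R :=
  interaction (concat w delta) / \sum_(x : cfg A V) interaction (concat x delta).

(* Probability of an event under the specification, viewed as a measure on the
   configurations on V `|` boundary V that agree with delta on the boundary. *)
Definition spec_event (V : {fset 'rV[int]_d}) (delta : cfg A (boundary V))
    (E : pred (cfg A (V `|` boundary V))) : R :=
  \sum_(w : cfg A V | E (concat w delta)) spec delta w.

Definition spec_pr (V : {fset 'rV[int]_d}) (delta : cfg A (boundary V))
    (T : {fset 'rV[int]_d}) (y : cfg A T) : R :=
  spec_event delta (fun w => agree w y).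

Definition spec_cond_pr (V : {fset 'rV[int]_d}) (delta : cfg A (boundary V))
    (S T : {fset 'rV[int]_d}) (x : cfg A S) (y : cfg A T) : R :=
  spec_event delta (fun w => agree w x && agree w y) / spec_pr delta y.

Definition gibbs_measure (mu : probability (borel_fullshift d A) R) : Prop :=
  [/\ stationary mu,
      markov_random_field mu &
      forall (V : {fset 'rV[int]_d}) (delta : cfg A (boundary V)),
        0 < pr mu delta ->
        admissible delta /\ forall x : cfg A V, cond_pr mu x delta = spec delta x].

Definition set_dist (u : 'rV[int]_d) (D : set 'rV[int]_d) : \bar R :=
  ereal_inf [set ((l1dist u v)%:R)%:E | v in D].

(* When D(y,z) is empty the distance is +oo, so that the bound is 0. *)
Definition strong_spatial_mixing : Prop :=
  exists C alpha : R, [/\ 0 < C, 0 < alpha &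
  forall (V : {fset 'rV[int]_d}) (u : 'rV[int]_d) (T : {fset 'rV[int]_d})
         (VT : boundary V `<=` T) (x : cfg A [fset u]) (y z : cfg A T),
    u \in V -> T `<=` V `|` boundary V ->
    let delta := restr VT y in
    let eta := restr VT z in
    admissible delta -> admissible eta ->
    0 < spec_pr delta y -> 0 < spec_pr eta z ->
    (`|spec_cond_pr delta x y - spec_cond_pr eta x z|%:E <=
      C%:E * expeR (- (alpha%:E * set_dist u (diff_set y z))))%E].

End Specification.

(* Model of computation: structured programs for a random access machine whose
   memory cells are indexed by, and contain, unbounded integers.  Running time
   is measured by the logarithmic cost criterion: every operation is charged
   the total length in bits of the integers it handles (as in Aho, Hopcroft and
   Ullman), which is polynomially related to Turing machine time.  The oracle
   stands for the data available to the algorithm: dyadic approximations of the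
   local interactions, and the sets K_n. *)
Section Computation.
Variables (d : nat) (A : alphabetType).

Record oracle := Oracle {
  gamma_approx : A -> nat -> int;
  beta_approx : 'I_d -> A -> A -> nat -> int;
  oracle_set : nat -> {fset 'rV[int]_d} }.

Inductive binop := Add | Sub | Mul | Div | Mod | Leq | Eq.

Definition eval_binop (o : binop) (x y : int) : int :=
  match o with
  | Add => x + y
  | Sub => x - y
  | Mul => x * y
  | Div => (x %/ y)%Z
  | Mod => (x %% y)%Z
  | Leq => (nat_of_bool (x <= y)%R)%:Z
  | Eq => (nat_of_bool (x == y))%:Z
  end.

Inductive expr :=
  | Const of int
  | Read of expr
  | Bin of binop & expr & expr
  | AskGamma of A & expr
  | AskBeta of 'I_d & A & A & expr
  | AskSet of expr & ('I_d -> expr).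

Inductive cmd :=
  | Skip
  | Store of expr & expr
  | Seq of cmd & cmd
  | If of expr & cmd & cmd
  | While of expr & cmd.

Definition memory := int -> int.

Definition update (s : memory) (a x : int) : memory :=
  fun b => if b == a then x else s b.

Definition bits (x : int) : nat := (trunc_log 2 `|x|).+1.

Variable O : oracle.

Fixpoint eval (s : memory) (e : expr) : int :=
  match e with
  | Const x => x
  | Read e => s (eval s e)
  | Bin o e1 e2 => eval_binop o (eval s e1) (eval s e2)
  | AskGamma a e => gamma_approx O a `|eval s e|%N
  | AskBeta i a b e => beta_approx O i a b `|eval s e|%N
  | AskSet e f =>
      (nat_of_bool (\row_i eval s (f i) \in oracle_set O `|eval s e|%N))%:Z
  end.

(* The last summand is the length of the value that is read, computed or
   returned by the oracle. *)
Fixpoint eval_cost (s : memory) (e : expr) : nat :=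
  (match e with
   | Const _ => 0
   | Read e => eval_cost s e + bits (eval s e)
   | Bin _ e1 e2 =>
       eval_cost s e1 + eval_cost s e2 + bits (eval s e1) + bits (eval s e2)
   | AskGamma _ e => eval_cost s e + bits (eval s e)
   | AskBeta _ _ _ e => eval_cost s e + bits (eval s e)
   | AskSet e f => eval_cost s e + bits (eval s e) +
       \sum_(i < d) (eval_cost s (f i) + bits (eval s (f i)))
   end + bits (eval s e))%N.

(* exec s c t s' : started in memory s, program c halts after time t in
   memory s'. *)
Inductive exec : memory -> cmd -> nat -> memory -> Prop :=
  | exec_skip s : exec s Skip 1 s
  | exec_store s e1 e2 :
      exec s (Store e1 e2)
        (eval_cost s e1 + eval_cost s e2 + bits (eval s e1) + bits (eval s e2))
        (update s (eval s e1) (eval s e2))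
  | exec_seq s c1 t1 s1 c2 t2 s2 :
      exec s c1 t1 s1 -> exec s1 c2 t2 s2 ->
      exec s (Seq c1 c2) (t1 + t2) s2
  | exec_if s e c1 c2 t s' :
      exec s (if eval s e != 0 then c1 else c2) t s' ->
      exec s (If e c1 c2) (eval_cost s e + t) s'
  | exec_while_false s e c :
      eval s e = 0 -> exec s (While e c) (eval_cost s e) s
  | exec_while_true s e c t1 s1 t2 s2 :
      eval s e != 0 -> exec s c t1 s1 -> exec s1 (While e c) t2 s2 ->
      exec s (While e c) (eval_cost s e + t1 + t2) s2.

Lemma exec_det s c t1 s1 t2 s2 :
  exec s c t1 s1 -> exec s c t2 s2 -> t1 = t2 /\ s1 = s2.
Proof.
move=> E; elim: E t2 s2 => {s c t1 s1}.
- by move=> s t2 s2 E; inversion E.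
- by move=> s e1 e2 t2 s2 E; inversion E.
- move=> s c1 t1 s1 c2 t2 s2 _ IH1 _ IH2 t3 s3 E; inversion E; subst.
  match goal with h : exec s c1 _ _ |- _ => case: (IH1 _ _ h) => ? ?; subst end.
  by match goal with h : exec _ c2 _ _ |- _ => case: (IH2 _ _ h) => -> -> end.
- move=> s e c1 c2 t s' _ IH t3 s3 E; inversion E; subst.
  by match goal with h : exec s _ _ s3 |- _ => case: (IH _ _ h) => -> -> end.
- move=> s e c e0 t3 s3 E; inversion E; subst => //.
  by match goal with h : is_true (_ != 0) |- _ => rewrite e0 eqxx in h end.
- move=> s e c t1 s1 t2 s2 e0 _ IH1 _ IH2 t3 s3 E; inversion E; subst.
    by match goal with h : eval _ _ = 0 |- _ => rewrite h eqxx in e0 end.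
  match goal with h : exec s c _ _ |- _ => case: (IH1 _ _ h) => ? ?; subst end.
  by match goal with h : exec _ (While e c) _ _ |- _ =>
    case: (IH2 _ _ h) => -> -> end.
Qed.

(* The input is in cell 0, all other cells contain 0. *)
Definition input (n : nat) : memory := update (fun=> 0) 0 n%:Z.

End Computation.

(* The output is a pair of rational numbers with a common denominator: the
   numerators are in cells 0 and 1, the denominator in cell 2. *)
Definition output_low (R : realType) (s : memory) : R :=
  (s 0)%:~R / (s 2)%:~R.
Definition output_high (R : realType) (s : memory) : R :=
  (s 1)%:~R / (s 2)%:~R.

Definition approximates (R : realType) (q : nat -> int) (x : R) : Prop :=
  forall k : nat, `|x - (q k)%:~R / 2 ^+ k| <= 2 ^- k.

(* Main.v *)
(** For a box V of side 2c - 1 around K_n, the number μ(w) of a word w on the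
    union of {0} and K_n is a convex combination of the numbers Λ^δ(w), where δ
    runs over the admissible configurations on the boundary of V. The program
    computes all of them with a transfer matrix, from integer approximations of
    the weights, hence certified bounds on μ(w); it enlarges c until, for every
    w, the upper and lower bound differ by at most one unit of 1/N, where N is
    exponential in n^(d-1). Strong spatial mixing, applied one site of w at a
    time, shows that this happens for some c = O(n^(d-1)), so that the number
    of matrix states is exp(O(n^((d-1)^2))); C and α only enter the analysis of
    the running time. Finally, x ln x has modulus of continuity O(√ε), and the
    logarithms in the entropy appear only as differences ln s - ln l of
    logarithms of integers, which are replaced by differences of truncated
    harmonic sums. *)

Require Import Defs.
From HB Require Import structures.
From mathcomp Require Import all_boot all_order all_algebra finmap.
From mathcomp Require Import all_classical all_reals all_analysis.
From mathcomp Require Import ring lra zify.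

Set Implicit Arguments.
Unset Strict Implicit.
Unset Printing Implicit Defensive.

Import Order.TTheory GRing.Theory Num.Theory.
Local Open Scope fset_scope.
Local Open Scope ring_scope.

(** * Running times *)

(** The obstacle is that neither the mixing rate nor the set of δ with μ(δ) > 0 is known. So nothing
    is taken on trust: all admissible δ are enumerated, and a small spread is itself the
    certificate. This is affordable because the rim has O(c^(d-1)) sites, up to a constant as many
    as a matrix state has letters. Approximations cannot tell a zero interaction from a tiny one;
    [supp] settles this, so that admissibility is decided exactly and nonzero weights get a small
    relative error. The scaling of the weights by 2^(2c+1) cancels in the quotients Λ^δ(w). The size
    of N: an error 1/N in a mass costs about 1/√N in the entropy, for each of the q^|K| words on K,
    so √N must exceed q^|K| e^(n^(d-1)) up to a constant; here |K| = O(n^(d-1)) enters. The weights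
    are queried to 2c + 1 binary places, so a larger c improves accuracy as well as mixing, and one
    search serves both. In the time analysis all cells have at most b bits, b fixed for the run, and
    the cost is b times a count of loop passes. *)

Lemma bits_le (x : int) (k : nat) : (`|x| < 2 ^ k)%N -> (0 < k)%N ->
  (bits x <= k)%N.
Proof.
move=> xk k0; rewrite /bits; have [->|x0] := eqVneq (`|x|%N) 0%N.
  by rewrite trunc_log0.
rewrite -(ltn_exp2l _ _ (isT : 1 < 2)%N); apply: leq_ltn_trans xk.
by apply: trunc_logP => //; rewrite lt0n.
Qed.

Lemma ltn_bits (x : int) : (`|x| < 2 ^ bits x)%N.
Proof. exact: trunc_log_ltn. Qed.

(** Multiplication is the extreme case; sums fit because [2 ^ k + 2 ^ l <= 2 ^ (k + l)] once [k] and
    [l] are positive. *)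
Lemma eval_binop_bound (o : binop) (x y : int) (k l : nat) :
  (0 < k)%N -> (0 < l)%N -> (`|x| < 2 ^ k)%N -> (`|y| < 2 ^ l)%N ->
  (`|eval_binop o x y| < 2 ^ (k + l))%N.
Proof.
move=> k0 l0 xk yl.
have D : (2 ^ k + 2 ^ l <= 2 ^ (k + l))%N.
  have k2 : (2 ^ 1 <= 2 ^ k)%N by rewrite leq_exp2l.
  have l2 : (2 ^ 1 <= 2 ^ l)%N by rewrite leq_exp2l.
  by rewrite expnD; nia.
have B1 : (`|(1%N : int)| < 2 ^ (k + l))%N.
  by rewrite -{1}(expn0 2) ltn_exp2l // addn_gt0 k0.
case: o => /=.
- by lia.
- by lia.
- by rewrite abszM expnD ltn_mul.
- have := lez_div x y; rewrite expnD; nia.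
- have [->|y0] := eqVneq y 0; first by rewrite modz0; lia.
  by have := ltz_mod x y0; have := modz_ge0 x y0; lia.
- by case: (x <= y) => //; rewrite expn_gt0.
- by case: (x == y) => //; rewrite expn_gt0.
Qed.

Section Machine.
Variables (d : nat) (A : alphabetType) (O : oracle d A).
Implicit Types (e : expr d A) (c : cmd d A) (s : memory) (b k : nat).

Definition bounded b s := forall a, (`|s a| < 2 ^ b)%N.

(** Answers about weights are the only values whose size is not controlled by the memory and the
    expression; answers about sets are 0 or 1. *)
Fixpoint ask_bounded b s e : Prop :=
  match e with
  | Const _ => True
  | Read e => ask_bounded b s e
  | Bin _ e1 e2 => ask_bounded b s e1 /\ ask_bounded b s e2
  | AskGamma a e1 => ask_bounded b s e1 /\ (`|Defs.eval O s e| < 2 ^ b)%N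
  | AskBeta i x y e1 => ask_bounded b s e1 /\ (`|Defs.eval O s e| < 2 ^ b)%N
  | AskSet e f => ask_bounded b s e /\ forall i, ask_bounded b s (f i)
  end.

(** Bounds the bit length of the value in units of [b]: cells and oracle answers count 1, and an
    operation at most adds lengths. *)
Fixpoint deg e : nat :=
  match e with
  | Const x => bits x
  | Bin _ e1 e2 => deg e1 + deg e2
  | _ => 1
  end.

(** The cost in units of [b]: every bit length in [eval_cost] is replaced by its bound [deg]. *)
Fixpoint esize e : nat :=
  (match e with
   | Const _ => 0
   | Read e => esize e + deg e
   | Bin _ e1 e2 => esize e1 + esize e2 + deg e1 + deg e2
   | AskGamma _ e => esize e + deg e
   | AskBeta _ _ _ e => esize e + deg e
   | AskSet e f => esize e + deg e + \sum_(i < d) (esize (f i) + deg (f i))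
   end + deg e)%N.

Fixpoint csize c : nat :=
  (match c with
   | Skip => 1
   | Store e1 e2 => esize e1 + esize e2 + deg e1 + deg e2
   | Seq c1 c2 => csize c1 + csize c2
   | If e c1 c2 => esize e + (csize c1 + csize c2)
   | While e c => esize e + csize c
   end)%N.

Lemma deg_gt0 e : (0 < deg e)%N.
Proof. by elim: e => //= o e1 h1 e2 h2; rewrite addn_gt0 h1. Qed.

Lemma eval_bound b s e : (0 < b)%N -> bounded b s -> ask_bounded b s e ->
  (`|Defs.eval O s e| < 2 ^ (b * deg e))%N.
Proof.
move=> b0 bs; elim: e => //=.
- move=> x _; apply: leq_trans (ltn_bits x) _.
  by rewrite leq_exp2l // leq_pmull.
- by move=> e _ _; rewrite muln1.
- move=> o e1 h1 e2 h2 [k1 k2]; rewrite mulnDr.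
  apply: eval_binop_bound; rewrite ?muln_gt0 ?b0 ?deg_gt0 //.
    exact: h1.
  exact: h2.
- by move=> a e _ [_]; rewrite muln1.
- by move=> i a a' e _ [_]; rewrite muln1.
- move=> e _ f _ _; rewrite muln1.
  have h : (2 ^ 1 <= 2 ^ b)%N by rewrite leq_exp2l.
  by case: (_ \in _); lia.
Qed.

Lemma bits_eval b s e : (0 < b)%N -> bounded b s -> ask_bounded b s e ->
  (bits (Defs.eval O s e) <= b * deg e)%N.
Proof.
move=> b0 bs be; apply: bits_le; first exact: eval_bound.
by rewrite muln_gt0 b0 deg_gt0.
Qed.

Lemma eval_cost_le b s e : (0 < b)%N -> bounded b s -> ask_bounded b s e ->
  (eval_cost O s e <= b * esize e)%N.
Proof.
move=> b0 bs; elim: e.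
- move=> x be; have := bits_eval b0 bs be; rewrite /=; lia.
- move=> e he be; have := bits_eval b0 bs be; have := he be.
  have := @bits_eval b s e b0 bs be; rewrite /= !mulnDr; lia.
- move=> o e1 h1 e2 h2 be; have := bits_eval b0 bs be; case: be => be1 be2.
  have := h1 be1; have := h2 be2.
  have := bits_eval b0 bs be1; have := bits_eval b0 bs be2.
  rewrite /= !mulnDr; lia.
- move=> a e he be; have := bits_eval b0 bs be; case: be => be _.
  have := he be; have := bits_eval b0 bs be; rewrite /= !mulnDr; lia.
- move=> i a a' e he be; have := bits_eval b0 bs be; case: be => be _.
  have := he be; have := bits_eval b0 bs be; rewrite /= !mulnDr; lia.
- move=> e he f hf be; have := bits_eval b0 bs be; case: be => be bf.
  have : (\sum_(i < d) (eval_cost O s (f i) + bits (Defs.eval O s (f i))) <=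
      b * \sum_(i < d) (esize (f i) + deg (f i)))%N.
    rewrite big_distrr /=; apply: leq_sum => i _.
    by rewrite mulnDr; apply: leq_add;
      [exact: hf i (bf i)|exact: bits_eval (bf i)].
  have := he be; have := bits_eval b0 bs be; rewrite /= !mulnDr; lia.
Qed.

(* Up to the factor k, the time is linear in b: iterating a loop only
   multiplies k. *)
Definition runs b s c k (Q : memory -> Prop) : Prop :=
  exists t s', [/\ exec O s c t s', (t <= k * (b * csize c))%N,
                   bounded b s' & Q s'].

Lemma runs_mono b s c k k' (Q Q' : memory -> Prop) :
  runs b s c k Q -> (k <= k')%N ->
  (forall s', bounded b s' -> Q s' -> Q' s') -> runs b s c k' Q'.
Proof.
move=> [t [s' [E T B q]]] kk' QQ'; exists t, s'; split => //.
  by apply: leq_trans T _; rewrite leq_mul2r kk' orbT.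
exact: QQ'.
Qed.

Lemma bounded_update b s a x : bounded b s -> (`|x| < 2 ^ b)%N ->
  bounded b (update s a x).
Proof. by move=> bs bx a'; rewrite /update; case: ifP. Qed.

Lemma runs_store b s e1 e2 k (Q : memory -> Prop) : (0 < b)%N -> (0 < k)%N ->
  bounded b s -> ask_bounded b s e1 -> ask_bounded b s e2 ->
  (`|Defs.eval O s e2| < 2 ^ b)%N ->
  (bounded b (update s (Defs.eval O s e1) (Defs.eval O s e2)) ->
   Q (update s (Defs.eval O s e1) (Defs.eval O s e2))) ->
  runs b s (Store e1 e2) k Q.
Proof.
move=> b0 k0 bs be1 be2 v Qs.
have bs' := bounded_update (Defs.eval O s e1) bs v.
eexists _, _; split; [exact: exec_store | | exact: bs' | exact: Qs].
apply: (@leq_trans (b * csize (Store e1 e2))); last exact: leq_pmull.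
rewrite /= !mulnDr.
have := eval_cost_le b0 bs be1; have := eval_cost_le b0 bs be2.
have := bits_eval b0 bs be1; have := bits_eval b0 bs be2; lia.
Qed.

Lemma runs_seq b s c1 c2 k (Q1 Q : memory -> Prop) :
  runs b s c1 k Q1 ->
  (forall s1, bounded b s1 -> Q1 s1 -> runs b s1 c2 k Q) ->
  runs b s (Seq c1 c2) k Q.
Proof.
move=> [t1 [s1 [E1 T1 B1 q1]]] /(_ s1 B1 q1) [t2 [s2 [E2 T2 B2 q2]]].
exists (t1 + t2)%N, s2; split => //; first exact: exec_seq E1 E2.
by rewrite /= !mulnDr leq_add.
Qed.

(** The index of [I] counts completed passes; as the guard can hold only while [i < N], it also
    yields termination. The guard is evaluated once more than the body, whence [N.+1]. The final
    index stays existential because the search for the half-side may stop early. *)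
Lemma runs_while b s e c k N (I : nat -> memory -> Prop) :
  (0 < b)%N -> (0 < k)%N -> bounded b s -> I 0%N s ->
  (forall i s1, bounded b s1 -> I i s1 -> ask_bounded b s1 e /\
     (Defs.eval O s1 e != 0 -> (i < N)%N /\ runs b s1 c k (I i.+1))) ->
  runs b s (While e c) (k * N.+1)
    (fun s' => Defs.eval O s' e = 0 /\ exists i, I i s').
Proof.
move=> b0 k0 bs I0 step.
suff H n i s1 : (N - i <= n)%N -> bounded b s1 -> I i s1 ->
    runs b s1 (While e c) (k * (N - i).+1)
      (fun s' => Defs.eval O s' e = 0 /\ exists i, I i s').
  by have := H N 0%N s; rewrite subn0; apply.
elim: n i s1 => [|n IH] i s1 Nin bs1 Ii.
  have [be st] := step _ _ bs1 Ii.
  have [e0|e0] := eqVneq (Defs.eval O s1 e) 0; last by have [] := st e0; lia.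
  eexists _, _; split; [exact: exec_while_false|..] => //; last first.
    by split => //; exists i.
  have := eval_cost_le b0 bs1 be; rewrite /= !mulnDr; nia.
have [be st] := step _ _ bs1 Ii.
have C := eval_cost_le b0 bs1 be.
have [e0|e0] := eqVneq (Defs.eval O s1 e) 0.
  eexists _, _; split; [exact: exec_while_false|..] => //; last first.
    by split => //; exists i.
  rewrite /= !mulnDr; nia.
have [iN [t1 [s2 [E1 T1 B1 I1]]]] := st e0.
have [|t2 [s3 [E2 T2 B2 I2]]] := IH i.+1 s2 _ B1 I1; first by lia.
eexists _, _; split; [exact: (exec_while_true e0 E1 E2)|..] => //.
have -> : (N - i = (N - i.+1).+1)%N by lia.
apply: leq_trans (leq_add (leq_add C T1) T2) _.
set M := (N - i.+1).+1; rewrite (mulnS k M) (mulnDl k) leq_add2r /= !mulnDr.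
rewrite leq_add2r.
by apply: leq_trans (leq_pmull _ k0) _; rewrite leq_mul2l leq_mul2r leqnn !orbT.
Qed.

(** [x < e] is written [x + 1 <= e], and [e] is evaluated anew at each pass, so an invariant must
    fix its value. *)
Definition For (x : int) (e : expr d A) (c : cmd d A) : cmd d A :=
  Seq (Store (Const _ _ x) (Const _ _ 0))
   (While (Bin Leq (Bin Add (Read (Const _ _ x)) (Const _ _ 1)) e)
     (Seq c (Store (Const _ _ x) (Bin Add (Read (Const _ _ x)) (Const _ _ 1))))).

Lemma runs_for b s x e c k k' N (I : nat -> memory -> Prop) :
  (0 < b)%N -> (0 < k)%N -> bounded b s -> (N < 2 ^ b)%N ->
  (k * N.+1 <= k')%N ->
  (forall i s1, I i s1 ->
    [/\ s1 x = i%:Z, Defs.eval O s1 e = N%:Z & ask_bounded b s1 e]) ->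
  I 0%N (update s x 0) ->
  (forall i s1, (i < N)%N -> bounded b s1 -> I i s1 ->
     runs b s1 c k (fun s' => s' x = i%:Z /\ I i.+1 (update s' x i.+1%:Z))) ->
  runs b s (For x e c) k' (I N).
Proof.
move=> b0 k0 bs Nb kk' Inv I0 step.
have k'0 : (0 < k')%N by apply: leq_trans kk'; rewrite muln_gt0 k0.
apply: (@runs_seq _ _ _ _ _ (I 0%N)).
  by apply: runs_store => //=; rewrite expn_gt0.
move=> s0 bs0 I0'.
apply: (@runs_mono _ _ _ (k * N.+1)%N _
  (fun s' => Defs.eval O s' (Bin Leq (Bin Add (Read (Const _ _ x)) (Const _ _ 1)) e) = 0
     /\ exists i, (i <= N)%N /\ I i s')) => //; last first.
  move=> s' bs' [+ [i [iN Ii]]] /=; have [E1 E2 _] := Inv _ _ Ii. rewrite /= E1 E2.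
  case: leP => //= Ni _; have -> // : N = i by lia.
apply: (@runs_while _ _ _ _ _ _ (fun i s' => (i <= N)%N /\ I i s')) => //.
move=> i s1 bs1 [iN Ii]; have [xi eN be] := Inv _ _ Ii; split => //=.
rewrite xi eN; case: leP => //= Ni _; split; first by lia.
have {}iN : (i < N)%N by lia.
apply: runs_seq (step i s1 iN bs1 Ii) _ => s2 bs2 [xi2 I2].
apply: runs_store => //=.
  by rewrite xi2 /=; lia.
rewrite xi2; have -> : i%:Z + 1 = i.+1 :> int by lia.
by move=> _; split.
Qed.

End Machine.

(** * Digits and codes of words *)

Definition digit (b i x : nat) : nat := (x %/ b ^ i %% b)%N.

Lemma digit_lt b i x : (0 < b)%N -> (digit b i x < b)%N.
Proof. exact: ltn_pmod. Qed.

Lemma digit0E b x : digit b 0 x = (x %% b)%N.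
Proof. by rewrite /digit expn0 divn1. Qed.

Lemma digitS b i x : digit b i.+1 x = digit b i (x %/ b)%N.
Proof. by rewrite /digit expnS divnMA. Qed.

Lemma digit_inj b k x y : (x < b ^ k)%N -> (y < b ^ k)%N ->
  (forall i, (i < k)%N -> digit b i x = digit b i y) -> x = y.
Proof.
elim: k x y => [|k IH] x y; first by rewrite !expn0; lia.
have [->|b0] := posnP b; first by rewrite exp0n.
rewrite expnSr => xk yk xy; rewrite (divn_eq x b) (divn_eq y b).
have /= := xy 0%N isT; rewrite !digit0E => ->; congr (_ * _ + _)%N.
apply: IH; rewrite ?ltn_divLR // => i ik.
by rewrite -!digitS xy.
Qed.

Lemma digit_exists b k (t : nat -> nat) : (forall i, (i < k)%N -> (t i < b)%N) ->
  exists2 x, (x < b ^ k)%N & forall i, (i < k)%N -> digit b i x = t i.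
Proof.
elim: k t => [|k IH] t tb; first by exists 0%N.
have [//|x xk xt] := IH (fun i => t i.+1); first by move=> i ik; exact: tb.
have b0 : (0 < b)%N by apply: leq_ltn_trans (tb 0%N isT).
have t0 := tb 0%N isT.
exists (x * b + t 0)%N; first by rewrite expnSr; nia.
case=> [|i] ik; first by rewrite digit0E modnMDl modn_small.
by rewrite digitS divnMDl // divn_small // addn0 xt.
Qed.

Lemma digit_mod b R i x : (i < R)%N -> digit b i (x %% b ^ R) = digit b i x.
Proof.
move=> iR; have [->|b0] := posnP b; first by rewrite /digit !modn0; case: R iR => // R _; rewrite exp0n // modn0.
rewrite {2}(divn_eq x (b ^ R)) /digit.
have -> : (b ^ R = b ^ (R - i.+1) * b * b ^ i)%N.
  by rewrite -expnSr -expnD; congr (_ ^ _)%N; lia.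
by rewrite [in RHS]mulnA divnMDl ?expn_gt0 ?b0 // mulnA modnMDl.
Qed.

(** The states of the transfer matrix are queues of [R] letters: multiplication by [b] makes room at
    digit 0, and reduction modulo [b ^ R] drops the oldest letter. *)
Lemma digit_push b R a s : (a < b)%N -> (0 < R)%N ->
  digit b 0 ((s * b + a) %% b ^ R) = a /\
  forall r, (r.+1 < R)%N -> digit b r.+1 ((s * b + a) %% b ^ R) = digit b r s.
Proof.
move=> ab R0; split=> [|r rR].
  by rewrite digit_mod // digit0E modnMDl modn_small.
by rewrite digit_mod // digitS divnMDl ?divn_small ?addn0 //; apply: leq_ltn_trans ab.
Qed.

Definition cnt (P : pred nat) (i : nat) : nat := count P (iota 0 i).

Lemma cntS P i : cnt P i.+1 = (cnt P i + P i)%N.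
Proof. by rewrite /cnt -addn1 iotaD count_cat /= addn0 add0n. Qed.

Lemma cnt_le P i : (cnt P i <= i)%N.
Proof. by rewrite -{2}(size_iota 0 i) count_size. Qed.

(** Letters are prescribed at scattered sites [i] in [P] but stored without gaps, at the rank
    [cnt P i] of [i] in [P]. *)
Lemma code_exists (P : pred nat) b n (t : nat -> nat) : (0 < b)%N ->
  (forall i, (i < n)%N -> P i -> (t i < b)%N) ->
  exists2 D, (D < b ^ cnt P n)%N &
    forall i, (i < n)%N -> P i -> digit b (cnt P i) D = t i.
Proof.
move=> b0 tb; suff [t' ht'] : exists t' : nat -> nat, forall i, (i < n)%N -> P i ->
    t' (cnt P i) = t i /\ (cnt P i < cnt P n)%N.
  have [k _|D Dn DE] := @digit_exists b (cnt P n) (fun k => t' k %% b)%N.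
    exact: ltn_pmod.
  exists D => // i iN Pi; have [ti ci] := ht' i iN Pi.
  by rewrite DE // ti modn_small // tb.
elim: n tb => [|n IH] tb; first by exists t.
have [|t' ht'] := IH; first by move=> i iN; apply/tb/ltnW.
(* Earlier sites of [P] have ranks below [cnt P n], so redefining [t'] there does not disturb
   them. *)
exists (fun k => if k == cnt P n then t n else t' k) => i iN Pi.
have [ni|ni] := eqVneq i n.
  by rewrite ni in Pi *; rewrite eqxx cntS Pi; split=> //; lia.
have [|ti ci] := ht' i _ Pi; first by lia.
by rewrite ltn_eqF // ti cntS; split => //; lia.
Qed.

Section Letters.
Variable A : alphabetType.

Definition letter (k : nat) : A := nth point (enum A) k.
Definition rank (a : A) : nat := index a (enum A).

Lemma rankK : cancel rank letter.
Proof. by move=> a; rewrite /letter nth_index // mem_enum. Qed.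

Lemma rank_lt a : (rank a < #|A|)%N.
Proof. by rewrite cardE index_mem mem_enum. Qed.

Lemma letterK k : (k < #|A|)%N -> rank (letter k) = k.
Proof. by rewrite cardE => kA; rewrite /rank index_uniq ?enum_uniq. Qed.

Lemma card_gt0 : (0 < #|A|)%N.
Proof. by apply/card_gt0P; exists point. Qed.

Lemma sum_letter (T : nmodType) (F : A -> T) :
  \sum_(k < #|A|) F (letter k) = \sum_a F a.
Proof.
rewrite -[RHS]big_enum /= (big_nth point) big_mkord -cardE.
by apply: eq_bigr.
Qed.

End Letters.
Arguments letter {A}.

(** * Transfer matrices *)

Section TransferMatrix.
Variables (A : alphabetType) (NS R : nat).
Variable lw : nat -> A -> (nat -> A) -> nat.
Hypothesis R0 : (0 < R)%N.
(* lw p a f is the factor of site p with letter a when f r is the letter of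
   site p - r. *)
Hypothesis lw_local : forall p a (f g : nat -> A), (p < NS)%N ->
  (forall r, (0 < r <= R)%N -> (r <= p)%N -> f r = g r) -> lw p a f = lw p a g.

Notation q := #|A|.

(** [i] is the number of sites still to be filled; digit [r.-1] of [s] is the letter [r] places
    back. *)
Fixpoint dp (i s : nat) : nat :=
  (if i is j.+1 then
    \sum_a lw (NS - i) a (fun r => letter (digit q r.-1 s)) *
           dp j ((s * q + rank a) %% q ^ R)
  else 1)%N.

Definition at_site (y : {ffun 'I_NS -> A}) (p : nat) : A :=
  oapp y point (insub p).

Lemma at_siteE y (p : 'I_NS) : at_site y p = y p.
Proof. by rewrite /at_site valK. Qed.

Lemma at_site_lt y p (h : (p < NS)%N) : at_site y p = y (Ordinal h).
Proof. exact: (at_siteE y (Ordinal h)). Qed.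

(** The letters already fixed are carried by a full word [x], so that the sums at all stages range
    over one type. The induction splits the sum by the letter of the first open site, and [lw_local]
    lets the state stand for the whole past. *)
Lemma dp_suffix i (x : {ffun 'I_NS -> A}) s : (i <= NS)%N ->
  (forall r, (0 < r <= R)%N -> (r <= NS - i)%N ->
     letter (digit q r.-1 s) = at_site x (NS - i - r)) ->
  dp i s =
  (\sum_(y : {ffun 'I_NS -> A} | [forall p : 'I_NS, (p < NS - i) ==> (y p == x p)])
    \prod_(p < NS | NS - i <= p) lw p (y p) (fun r => at_site y (p - r)))%N.
Proof.
elim: i s x => [|i IH] s x iN hs /=.
  rewrite subn0 (bigD1 x) /=; last by apply/forallP => p; rewrite eqxx implybT.
  rewrite [X in _ = (_ + X)%N]big_pred0 => [|y].
    by rewrite addn0 big_pred0 // => p; rewrite leqNgt ltn_ord.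
  apply/negP => /andP[/forallP h /eqP]; apply; apply/ffunP => p.
  by have := h p; rewrite ltn_ord => /eqP.
have pN : (NS - i.+1 < NS)%N by lia.
set P := (NS - i.+1)%N in hs *; pose p0 := Ordinal pN.
rewrite [RHS](partition_big (fun y : {ffun 'I_NS -> A} => y p0) predT) //=.
apply: eq_bigr => a _.
pose xa : {ffun 'I_NS -> A} := [ffun p => if p == p0 then a else x p].
have xa_lt p : (p < P)%N -> at_site xa p = at_site x p.
  move=> pP; have pNS : (p < NS)%N by lia.
  rewrite !(at_site_lt _ pNS) ffunE -val_eqE /=.
  by case: eqP => // ?; lia.
rewrite (IH _ xa) //; first last.
- move=> r /andP[r0 rR] rP.
  have [h0 hS] := digit_push s (rank_lt a) R0.
  have PE : (NS - i = P.+1)%N by rewrite /P; lia.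
  case: r r0 rR rP => // -[|r] _ rR rP.
    rewrite h0 rankK PE subSS subn0 (at_site_lt _ pN) ffunE.
    by rewrite -/p0 eqxx.
  rewrite /= hS // PE subSS xa_lt; last by lia.
  by rewrite -(hs r.+1) //; lia.
- exact: ltnW.
have PE : (NS - i = P.+1)%N by rewrite /P; lia.
rewrite PE big_distrr /=; apply: eq_big => [y|y /forallP hy].
  apply/forallP/andP => [h|[/forallP h /eqP ya] p].
    split.
      apply/forallP => p; apply/implyP => pP.
      have := h p; rewrite ffunE -val_eqE /= ltnW ?ltnS //=.
      by rewrite ltn_eqF.
    by have := h p0; rewrite /= ltnSn ffunE eqxx.
  apply/implyP; rewrite ltnS leq_eqVlt ffunE => /orP[/eqP pP|pP].
    have -> : p = p0 by apply/val_inj.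
    by rewrite eqxx ya.
  have := h p; rewrite pP -val_eqE /= ltn_eqF //.
rewrite [RHS](bigD1 p0) //=; congr (_ * _)%N; last first.
  apply: eq_bigl => p; rewrite -val_eqE /= ltn_neqAle andbC; congr (_ && _).
  by rewrite eq_sym.
have yp0 : y p0 = a.
  by have := hy p0; rewrite /= ltnSn ffunE eqxx => /eqP.
rewrite yp0; apply: lw_local => // r rR rP.
rewrite hs // -xa_lt; last by move: rR rP; rewrite /P; lia.
have rN : (P - r < NS)%N by lia.
rewrite !(at_site_lt _ rN); have := hy (Ordinal rN).
by rewrite /= ltnS leq_subr /= => /eqP.
Qed.

Lemma dp_total : dp NS 0 =
  (\sum_(y : {ffun 'I_NS -> A})
    \prod_(p < NS) lw p (y p) (fun r => at_site y (p - r)))%N.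
Proof.
(* With no site filled the conditions on state and prefix are void, so state 0 and an arbitrary word
   will do. *)
rewrite (@dp_suffix _ [ffun=> point]) ?subnn //; last by case=> [|r]; lia.
apply: eq_bigl => y; apply/forallP => p; by rewrite ltn0.
Qed.

End TransferMatrix.

(** * Registers and arrays *)

Section Expressions.
Variables (d : nat) (A : alphabetType).
Notation expr := (expr d A).
Notation cmd := (cmd d A).

Definition C (z : int) : expr := Const d A z.
Definition V (k : nat) : expr := Read (C k%:Z).
Definition Set_ (k : nat) (e : expr) : cmd := Store (C k%:Z) e.

(* Three arrays, interleaved in the cells of negative address: powers of #|A|,
   layers of the transfer matrix, and truncated harmonic sums. *)
Definition arr (t i : nat) : int := - t.+1%:Z - (3 * i)%N%:Z.
Definition Earr (t : nat) (e : expr) : expr :=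
  Bin Defs.Sub (C (- t.+1%:Z)) (Bin Mul (C 3) e).
Definition VA (t : nat) (e : expr) : expr := Read (Earr t e).
Definition SetA (t : nat) (e1 e2 : expr) : cmd := Store (Earr t e1) e2.

(** Expressions cannot branch: both alternatives are evaluated, and the unwanted one, possibly
    meaningless, is multiplied by 0. *)
Definition Econd (c e1 e2 : expr) : expr :=
  Bin Add (Bin Mul c e1) (Bin Mul (Bin Defs.Sub (C 1) c) e2).
Definition Esum (I : Type) (l : seq I) (f : I -> expr) : expr :=
  foldr (fun a e => Bin Add (f a) e) (C 0) l.
Definition Eprod (I : Type) (l : seq I) (f : I -> expr) : expr :=
  foldr (fun a e => Bin Mul (f a) e) (C 1) l.
(** The exponent is fixed with the program, so the expression has constant length; variable powers
    of [#|A|] are read from a table instead. *)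
Definition Epow (e : expr) (k : nat) : expr := iter k (Bin Mul e) (C 1).

Lemma upd_VV s k l v : update s k%:Z v l%:Z = if l == k then v else s l%:Z.
Proof. by rewrite /update eqz_nat. Qed.

Lemma upd_AV s t i l v : update s (arr t i) v l%:Z = s l%:Z.
Proof. by rewrite /update /arr; case: eqP => //; lia. Qed.

Lemma upd_VA s k t i v : update s k%:Z v (arr t i) = s (arr t i).
Proof. by rewrite /update /arr; case: eqP => //; lia. Qed.

Lemma upd_AA s t i t' i' v : (t < 3)%N -> (t' < 3)%N ->
  update s (arr t i) v (arr t' i') =
  if (t' == t) && (i' == i) then v else s (arr t' i').
Proof.
move=> t3 t3'; rewrite /update /arr.
have -> : (- t'.+1%:Z - (3 * i')%N%:Z == - t.+1%:Z - (3 * i)%N%:Z) =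
          (t' == t) && (i' == i) by lia.
by [].
Qed.

Lemma upd_V0 s k v : update s k%:Z v 0 = if 0%N == k then v else s 0.
Proof. exact: upd_VV. Qed.

Lemma upd_A0 s t i v : update s (arr t i) v 0 = s 0.
Proof. exact: upd_AV. Qed.

Definition updE := (upd_VV, upd_AV, upd_VA, upd_V0, upd_A0).

Definition frame (vs ts : seq nat) (s s' : memory) : Prop :=
  (forall k, k \notin vs -> s' k%:Z = s k%:Z) /\
  (forall t i, (t < 3)%N -> t \notin ts -> s' (arr t i) = s (arr t i)).

Lemma frame_refl vs ts s : frame vs ts s s. Proof. by []. Qed.

Lemma frame_trans vs ts s1 s2 s3 :
  frame vs ts s1 s2 -> frame vs ts s2 s3 -> frame vs ts s1 s3.
Proof.
move=> [h1 h2] [h3 h4]; split=> [k kv|t i t3 tt].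
  by rewrite h3 ?h1.
by rewrite h4 ?h2.
Qed.

Lemma frame_sub vs ts vs' ts' s s' : frame vs ts s s' ->
  all (mem vs') vs -> all (mem ts') ts -> frame vs' ts' s s'.
Proof.
move=> [h1 h2] /allP v /allP t; split=> [k kv|t' i t3 tt].
  by rewrite h1 //; apply: contra kv => /v.
by rewrite h2 //; apply: contra tt => /t.
Qed.

Lemma frame_V vs ts s s' k v : frame vs ts s s' -> k \in vs ->
  frame vs ts s (update s' k%:Z v).
Proof.
move=> [h1 h2] kv; split=> [l lv|t i t3 tt]; last by rewrite upd_VA h2.
by rewrite upd_VV; case: eqP => [lk|_]; [rewrite lk kv in lv|exact: h1].
Qed.

Lemma frame_A vs ts s s' t i v : frame vs ts s s' -> t \in ts -> (t < 3)%N ->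
  frame vs ts s (update s' (arr t i) v).
Proof.
move=> [h1 h2] tt t3; split=> [l lv|t' i' t3' tt'].
  by rewrite upd_AV h1.
rewrite upd_AA //; case: eqP => [e|_] /=; last exact: h2.
by rewrite e tt in tt'.
Qed.

Variables (O : oracle d A) (b : nat).

Section Eval.
Variable s : memory.
Notation ev e x := (Defs.eval O s e = x%:Z).

Lemma ev_V k (x : nat) : s k%:Z = x%:Z -> ev (V k) x. Proof. by []. Qed.

Lemma ev_Add e1 e2 x y : ev e1 x -> ev e2 y -> ev (Bin Add e1 e2) (x + y)%N.
Proof. by move=> /= -> ->. Qed.

Lemma ev_Sub e1 e2 x y : ev e1 x -> ev e2 y -> (y <= x)%N ->
  ev (Bin Defs.Sub e1 e2) (x - y)%N.
Proof. by move=> /= -> -> yx; rewrite subzn. Qed.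

Lemma ev_Mul e1 e2 x y : ev e1 x -> ev e2 y -> ev (Bin Mul e1 e2) (x * y)%N.
Proof. by move=> /= -> ->. Qed.

Lemma ev_Div e1 e2 x y : ev e1 x -> ev e2 y -> ev (Bin Div e1 e2) (x %/ y)%N.
Proof. by move=> /= -> ->; rewrite divz_nat. Qed.

Lemma ev_Mod e1 e2 x y : ev e1 x -> ev e2 y -> ev (Bin Mod e1 e2) (x %% y)%N.
Proof. by move=> /= -> ->; rewrite modz_nat. Qed.

Lemma ev_Leq e1 e2 x y : ev e1 x -> ev e2 y -> ev (Bin Leq e1 e2) (x <= y)%N.
Proof. by move=> /= -> ->; rewrite lez_nat. Qed.

Lemma ev_Eq e1 e2 x y : ev e1 x -> ev e2 y -> ev (Bin Eq e1 e2) (x == y).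
Proof. by move=> /= -> ->; rewrite eqz_nat. Qed.

Lemma ev_cond c e1 e2 (t : bool) (x : nat) : ev c t -> (t -> ev e1 x) ->
  (~~ t -> ev e2 x) -> ev (Econd c e1 e2) x.
Proof.
move=> /= ->; case: t => [/(_ isT) -> _|_ /(_ isT) ->] /=.
  by rewrite subrr mul0r mul1r addr0.
by rewrite mul0r subr0 mul1r add0r.
Qed.

Lemma ev_sum (I : finType) (f : I -> expr) (g : I -> nat) :
  (forall a, ev (f a) (g a)) -> ev (Esum (enum I) f) (\sum_a g a)%N.
Proof.
move=> h; rewrite -[in RHS]big_enum /=.
elim: (enum I) => [|a l IH]; first by rewrite big_nil.
by rewrite big_cons /= h IH.
Qed.

Lemma ev_prod (I : finType) (f : I -> expr) (g : I -> nat) :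
  (forall a, ev (f a) (g a)) -> ev (Eprod (enum I) f) (\prod_a g a)%N.
Proof.
move=> h; rewrite -[in RHS]big_enum /=.
elim: (enum I) => [|a l IH]; first by rewrite big_nil.
by rewrite big_cons /= h IH.
Qed.

Lemma ev_pow e x k : ev e x -> ev (Epow e k) (x ^ k)%N.
Proof.
move=> h; elim: k => [|k IH] //=.
by rewrite /Epow /= in IH *; rewrite h IH expnS.
Qed.

Lemma ev_VA t e i (x : nat) : ev e i -> s (arr t i) = x%:Z -> ev (VA t e) x.
Proof. by move=> /= -> <-; congr (s _); rewrite /arr PoszM. Qed.

Lemma ask_sum (I : finType) (f : I -> expr) :
  (forall a, ask_bounded O b s (f a)) -> ask_bounded O b s (Esum (enum I) f).
Proof. by move=> h; elim: (enum I) => //= a l IH; split. Qed.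

Lemma ask_prod (I : finType) (f : I -> expr) :
  (forall a, ask_bounded O b s (f a)) -> ask_bounded O b s (Eprod (enum I) f).
Proof. by move=> h; elim: (enum I) => //= a l IH; split. Qed.

Lemma ask_pow e k : ask_bounded O b s e -> ask_bounded O b s (Epow e k).
Proof. by move=> h; elim: k => //= k IH; split. Qed.

Lemma ask_Bin o e1 e2 : ask_bounded O b s e1 -> ask_bounded O b s e2 ->
  ask_bounded O b s (Bin o e1 e2).
Proof. by []. Qed.

Lemma ask_C z : ask_bounded O b s (C z). Proof. by []. Qed.
Lemma ask_V k : ask_bounded O b s (V k). Proof. by []. Qed.

Lemma ask_VA t e : ask_bounded O b s e -> ask_bounded O b s (VA t e).
Proof. by do ?split. Qed.

End Eval.

Lemma runs_set s k e (v : nat) z (Q : memory -> Prop) : (0 < b)%N -> (0 < k)%N ->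
  bounded b s -> Defs.eval O s e = v%:Z -> ask_bounded O b s e ->
  (v < 2 ^ b)%N -> Q (update s z%:Z v%:Z) -> runs O b s (Set_ z e) k Q.
Proof. by move=> b0 k0 bs ve be vb Qs; apply: runs_store; rewrite //= ve. Qed.

Lemma runs_setA s k t ei i e (v : nat) (Q : memory -> Prop) : (0 < b)%N ->
  (0 < k)%N -> bounded b s -> Defs.eval O s ei = i%:Z ->
  ask_bounded O b s ei -> Defs.eval O s e = v%:Z -> ask_bounded O b s e ->
  (v < 2 ^ b)%N -> Q (update s (arr t i) v%:Z) -> runs O b s (SetA t ei e) k Q.
Proof.
move=> b0 k0 bs vi bi ve be vb Qs.
have E : Defs.eval O s (Earr t ei) = arr t i by rewrite /= vi /arr PoszM.
by apply: runs_store; rewrite // ?E ?ve.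
Qed.

End Expressions.

(** * The weights on a cube *)

Section Geometry.
Variables (d c : nat).
Notation m := c.*2.+1.

(* The sites of the cube [-c, c]^d are numbered lexicographically by p < m ^ d,
   so that the lower neighbours of p are the p - m ^ i with i < d: the last
   m ^ d.-1 letters determine the next weight. *)
Definition vtx (p : nat) : 'rV[int]_d := \row_i ((digit m i p)%:Z - c%:Z).

(* The number of coordinates equal to -c or c. The sites with none form the
   box V, those with one its boundary (the rim); the others are ignored. *)
Definition extremes (p : nat) : nat :=
  (\sum_(i < d) ((digit m i p == 0) + (digit m i p == m.-1)))%N.

Definition reg (p : nat) : bool := (extremes p <= 1)%N.
Definition rim (p : nat) : bool := extremes p == 1%N.
Definition ctr (p : nat) : bool := [forall i : 'I_d, digit m i p == c].

(* Codes are read from the last site to the first: the letter at the site p in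
   P is the digit of index later P p. *)
Definition later (P : pred nat) (p : nat) : nat :=
  cnt (fun k => P (m ^ d - k.+1)%N) (m ^ d - p.+1)%N.
Definition total (P : pred nat) : nat :=
  cnt (fun k => P (m ^ d - k.+1)%N) (m ^ d).

End Geometry.

Section Weights.
Variables (d : nat) (A : alphabetType) (supp : 'I_d -> rel A).
Variables (O : oracle d A) (n c : nat).
Notation m := c.*2.+1.
Notation q := #|A|.

Definition isK (p : nat) : bool := vtx d c p \in oracle_set O n.

(* The successors make the approximate weights positive upper bounds. *)
Definition gam (x : A) : nat := `|gamma_approx O x m|.+1.
Definition bet (i : 'I_d) (y x : A) : nat :=
  if supp i y x then `|beta_approx O i y x m|.+1 else 0.

(* The code of the only letter allowed at p, or q if all are allowed. The
   letter 0 at the ignored sites makes each of them contribute a factor 1. *)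
Definition forced (D W a : nat) (free : bool) (p : nat) : nat :=
  if ~~ reg d c p then 0%N else
  if rim d c p then digit q (later d c (rim d c) p) D else
  if isK p && ~~ free then digit q (later d c isK p) W else
  if ctr d c p && ~~ free then a else q.

(** An indicator: the two tests exclude each other because [rank x < q]. *)
Definition allowed (k : nat) (x : A) : nat := ((k == q) + (k == rank x))%N.

(** Each edge is charged to its upper end. If digit [i] is 0, then [p - m ^ i] is not a neighbour:
    it lies in another row, or the subtraction is truncated. *)
Definition site_wt (p : nat) (x : A) (f : nat -> A) : nat :=
  if reg d c p then
    (gam x * \prod_(i < d)
      (if (1 <= digit m i p) && reg d c (p - m ^ i)
       then bet i (f (m ^ i)) x else 1))%N
  else 1%N.

Definition local_wt (D W a : nat) (free : bool) (p : nat) (x : A)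
    (f : nat -> A) : nat :=
  (allowed (forced D W a free p) x * site_wt p x f)%N.

Definition zdp (D W a : nat) (free : bool) : nat -> nat -> nat :=
  dp (m ^ d) (m ^ d.-1) (local_wt D W a free).

End Weights.

Section Program.
Variables (d : nat) (A : alphabetType) (supp : 'I_d -> rel A).
Notation q := #|A|.
Notation C := (@C d A).
Notation V := (@V d A).
Notation expr := (expr d A).

(* Registers: 0, n; 3, c; 4, m; 7, q ^ m ^ d.-1 (the number of states); 12, 14
   and 17, the codes W, a and D; 18, whether the word on 0 |` K is left free;
   19 and 20, what remains of D and W; 21, the layer; 22, the site; 23, its
   forced letter; 24, the state; 25, the result. *)
Definition EMD : expr := Epow (V 4) d.
Definition EMR : expr := Epow (V 4) d.-1.
Definition Edig (i : nat) (e : expr) : expr :=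
  Bin Mod (Bin Div e (Epow (V 4) i)) (V 4).
Definition Eext (e : expr) : expr :=
  Esum (enum 'I_d) (fun i => Bin Add (Bin Eq (Edig i e) (C 0))
                             (Bin Eq (Edig i e) (Bin Defs.Sub (V 4) (C 1)))).
Definition Ereg (e : expr) : expr := Bin Leq (Eext e) (C 1).
Definition Erim (e : expr) : expr := Bin Eq (Eext e) (C 1).
Definition Ectr (e : expr) : expr :=
  Eprod (enum 'I_d) (fun i => Bin Eq (Edig i e) (V 3)).
Definition EisK (e : expr) : expr :=
  AskSet (V 0) (fun i => Bin Defs.Sub (Edig i e) (V 3)).
Definition Enot (e : expr) : expr := Bin Defs.Sub (C 1) e.
Definition Egam (x : A) : expr := Bin Add (AskGamma x (V 4)) (C 1).
Definition Ebet (i : 'I_d) (y x : A) : expr :=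
  if supp i y x then Bin Add (AskBeta i y x (V 4)) (C 1) else C 0.
(** The neighbour is [m ^ i] places back, hence digit [m ^ i - 1] of the state; this exponent varies
    with the round, whence the table of powers. *)
Definition Enb (i : nat) : expr :=
  Bin Mod (Bin Div (V 24) (VA 0 (Bin Defs.Sub (Epow (V 4) i) (C 1)))) (C q%:Z).
Definition Ewt (x : A) : expr :=
  Econd (Ereg (V 22))
    (Bin Mul (Egam x) (Eprod (enum 'I_d) (fun i =>
       Econd (Bin Mul (Bin Leq (C 1) (Edig i (V 22)))
                      (Ereg (Bin Defs.Sub (V 22) (Epow (V 4) i))))
         (Esum (enum A) (fun y => Bin Mul (Bin Eq (Enb i) (C (rank y)%:Z))
                                          (Ebet i y x)))
         (C 1))))
    (C 1).
Definition Eforced : expr :=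
  Econd (Enot (Ereg (V 22))) (C 0)
  (Econd (Erim (V 22)) (Bin Mod (V 19) (C q%:Z))
  (Econd (Bin Mul (EisK (V 22)) (Enot (V 18))) (Bin Mod (V 20) (C q%:Z))
  (Econd (Bin Mul (Ectr (V 22)) (Enot (V 18))) (V 14) (C q%:Z)))).

(** Layer [i] is stored from offset [i * q ^ R] on; layer 0 is constantly 1 and is not stored. *)
Definition Elayer : expr :=
  Esum (enum A) (fun x =>
    Bin Mul (Bin Mul (Bin Add (Bin Eq (V 23) (C q%:Z))
                              (Bin Eq (V 23) (C (rank x)%:Z)))
                     (Ewt x))
      (Econd (Bin Eq (V 21) (C 0)) (C 1)
        (VA 1 (Bin Add (Bin Mul (V 21) (V 7))
           (Bin Mod (Bin Add (Bin Mul (V 24) (C q%:Z)) (C (rank x)%:Z)) (V 7)))))).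

Definition DPstep : cmd d A :=
  Seq (Set_ 22 (Bin Defs.Sub EMD (Bin Add (V 21) (C 1))))
  (Seq (Set_ 23 Eforced)
  (Seq (Set_ 19 (Econd (Erim (V 22)) (Bin Div (V 19) (C q%:Z)) (V 19)))
  (Seq (Set_ 20 (Econd (EisK (V 22)) (Bin Div (V 20) (C q%:Z)) (V 20)))
   (For 24%:Z (V 7)
     (SetA 1 (Bin Add (Bin Mul (Bin Add (V 21) (C 1)) (V 7)) (V 24)) Elayer))))).

End Program.

Lemma prod_nat_of_bool (I : finType) (P : pred I) :
  (\prod_(i : I) P i)%N = [forall i, P i] :> nat.
Proof.
case: (boolP [forall i, P i]) => [/forallP h|].
  by rewrite big1 // => i _; rewrite h.
by rewrite negb_forall => /existsP[i /negbTE Pi]; rewrite (bigD1 i) //= Pi.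
Qed.

Lemma sum_select (I : finType) (z : I) (F : I -> nat) :
  (\sum_(y : I) (y == z) * F y)%N = F z.
Proof.
rewrite (bigD1 z) //= eqxx mul1n big1 ?addn0 // => y /negbTE ->.
by rewrite mul0n.
Qed.

Lemma rank_eq (A : alphabetType) (k : nat) (y : A) : (k < #|A|)%N ->
  (k == rank y) = (y == letter k).
Proof.
by move=> kq; apply/eqP/eqP => [->|->]; rewrite ?rankK ?letterK.
Qed.

(** * Values of the expressions used by the transfer matrix program *)

Section Evaluation.
Variables (d : nat) (A : alphabetType) (supp : 'I_d -> rel A).
Variables (O : oracle d A) (b n c : nat) (s : memory).
Notation m := c.*2.+1.
Notation q := #|A|.
Notation ev e x := (Defs.eval O s e = x%:Z).
Notation C := (@C d A).
Notation V := (@V d A).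
Hypotheses (s0 : s 0 = n%:Z) (s3 : s 3%:Z = c%:Z) (s4 : s 4%:Z = m%:Z).

Lemma ev_MD : ev (EMD d A) (m ^ d)%N. Proof. exact: ev_pow. Qed.
Lemma ev_MR : ev (EMR d A) (m ^ d.-1)%N. Proof. exact: ev_pow. Qed.

Lemma ev_dig i e p : ev e p -> ev (Edig i e) (digit m i p).
Proof. by move=> h; apply: ev_Mod => //; apply: ev_Div => //; exact: ev_pow. Qed.

Lemma ev_ext e p : ev e p -> ev (Eext e) (extremes d c p).
Proof.
move=> h; apply: ev_sum => i; have hi := ev_dig i h.
apply: ev_Add; apply: ev_Eq => //.
by rewrite -subn1; apply: ev_Sub.
Qed.

Lemma ev_reg e p : ev e p -> ev (Ereg e) (reg d c p).
Proof. by move=> h; apply: ev_Leq => //; exact: ev_ext. Qed.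

Lemma ev_rim e p : ev e p -> ev (Erim e) (rim d c p).
Proof. by move=> h; apply: ev_Eq => //; exact: ev_ext. Qed.

Lemma ev_ctr e p : ev e p -> ev (Ectr e) (ctr d c p).
Proof.
move=> h; rewrite /ctr -prod_nat_of_bool; apply: ev_prod => i.
by apply: ev_Eq => //; exact: ev_dig.
Qed.

Lemma ev_isK e p : ev e p -> ev (EisK e) (isK O n c p).
Proof.
move=> h; rewrite /= s0 /isK; rewrite (_ : (\row_i _) = vtx d c p) //; apply/rowP => i; rewrite !mxE.
by have /= -> := ev_dig i h; rewrite s3.
Qed.

Lemma ev_not e (t : bool) : ev e t -> ev (Enot e) (~~ t).
Proof. by move=> /= ->; case: t. Qed.

Lemma ev_and e1 e2 (t1 t2 : bool) : ev e1 t1 -> ev e2 t2 ->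
  ev (Bin Mul e1 e2) (t1 && t2).
Proof. by move=> /= -> ->; case: t1; case: t2. Qed.

Hypothesis gam_ge0 : forall x, 0 <= gamma_approx O x m.
Hypothesis bet_ge0 : forall i y x, supp i y x -> 0 <= beta_approx O i y x m.

Lemma ev_gam x : ev (Egam d x) (gam O c x).
Proof.
rewrite /= s4 /gam /=; have := gam_ge0 x.
by case: (gamma_approx O x m) => // g _ /=; lia.
Qed.

Lemma ev_bet i y x : ev (Ebet supp i y x) (bet supp O c i y x).
Proof.
rewrite /Ebet /bet; case: ifP => // h /=; rewrite s4 /=.
have := bet_ge0 h.
by case: (beta_approx O i y x m) => // g _ /=; lia.
Qed.

Variables (p st : nat).
Hypotheses (s22 : s 22%:Z = p%:Z) (s24 : s 24%:Z = st%:Z).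
Hypothesis sPW : forall e, (e <= m ^ d.-1)%N -> s (arr 0 e) = (q ^ e)%N%:Z.

Lemma exp_le_R (i : 'I_d) : (m ^ i <= m ^ d.-1)%N.
Proof. by rewrite leq_pexp2l //; have := ltn_ord i; lia. Qed.

Lemma ev_nb (i : 'I_d) : ev (Enb d A i) (digit q (m ^ i).-1 st).
Proof.
apply: ev_Mod => //; apply: ev_Div => //; apply: (@ev_VA _ _ _ _ _ _ (m ^ i).-1).
  by rewrite -subn1; apply: ev_Sub; rewrite ?expn_gt0 //; exact: ev_pow.
by apply: sPW; apply: leq_trans (exp_le_R i); exact: leq_pred.
Qed.

Lemma ev_wt x :
  ev (Ewt supp x) (site_wt supp O c p x (fun r => letter (digit q r.-1 st))).
Proof.
rewrite /site_wt; apply: (ev_cond (t := reg d c p)).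
- exact: ev_reg.
- move=> ->; apply: ev_Mul; first exact: ev_gam.
  apply: ev_prod => i.
  have h1 : ev (Bin Leq (C 1) (Edig i (V 22))) (1 <= digit m i p)%N.
    by apply: ev_Leq => //; exact: ev_dig.
  apply: (ev_cond (t := (1 <= digit m i p)%N && reg d c (p - m ^ i))).
  (* When the digit is 0 the difference may be negative in the program and its regularity test
     arbitrary, but it is multiplied by 0. *)
  + have [h|h] := boolP (1 <= digit m i p)%N; last by move: h1; rewrite (negbTE h) /= => ->; rewrite mul0r.
    apply: (@ev_and _ _ true); first by rewrite h1 h.
    apply: ev_reg; apply: ev_Sub => //; first exact: ev_pow.
    rewrite leqNgt; apply: contraL h => pm.
    by rewrite /digit divn_small.
  + move=> ->.
    rewrite -[bet _ _ _ _ _ _](sum_select _ (fun y => bet supp O c i y x)).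
    apply: ev_sum => y; apply: ev_Mul; last exact: ev_bet.
    rewrite -rank_eq ?digit_lt ?card_gt0 //; apply: ev_Eq => //.
    exact: ev_nb.
  + by move=> /negbTE ->.
- by move=> /negbTE ->.
Qed.

End Evaluation.

(** * The transfer matrix program *)

Ltac ask_tac := repeat first
  [ exact: ask_C | exact: ask_V | assumption | apply: ask_sum => ? | apply: ask_prod => ?
  | apply: ask_pow | apply: ask_VA | apply: ask_Bin ].

Section RunDP.
Variables (d : nat) (A : alphabetType) (supp : 'I_d -> rel A).
Variables (O : oracle d A) (b n c : nat).
Notation m := c.*2.+1.
Notation q := #|A|.
Notation R := (m ^ d.-1)%N.
Notation NS := (m ^ d)%N.
Notation C := (@C d A).
Notation V := (@V d A).
Hypothesis b0 : (0 < b)%N.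
Hypothesis gam_ge0 : forall x, 0 <= gamma_approx O x m.
Hypothesis bet_ge0 : forall i y x, supp i y x -> 0 <= beta_approx O i y x m.
Hypothesis gam_bd : forall x, (`|gamma_approx O x m| < 2 ^ b)%N.
Hypothesis bet_bd : forall i y x, supp i y x ->
  (`|beta_approx O i y x m| < 2 ^ b)%N.
Hypothesis NSb : (NS < 2 ^ b)%N.
Hypothesis qb : (q < 2 ^ b)%N.
Hypothesis Qb : (q ^ R < 2 ^ b)%N.

Section Asks.
Variable s : memory.
Hypothesis s4 : s 4%:Z = m%:Z.

Lemma ask_dig i e : ask_bounded O b s e -> ask_bounded O b s (Edig i e).
Proof. by move=> h; rewrite /Edig; ask_tac. Qed.

Lemma ask_ext e : ask_bounded O b s e -> ask_bounded O b s (Eext e).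
Proof.
move=> h; apply: ask_sum => i; have hi := ask_dig i h.
by ask_tac.
Qed.

Lemma ask_isK e : ask_bounded O b s e -> ask_bounded O b s (EisK e).
Proof.
move=> h; rewrite /EisK; split; first exact: ask_V.
by move=> i; apply: ask_Bin; [exact: ask_dig|exact: ask_V].
Qed.

Lemma ask_rim e : ask_bounded O b s e -> ask_bounded O b s (Erim e).
Proof. by move=> h; have := ask_ext h; rewrite /Erim => ?; ask_tac. Qed.

Lemma ask_forced : ask_bounded O b s (Eforced d A).
Proof.
have h1 : ask_bounded O b s (Eext (V 22)) by apply: ask_ext; exact: ask_V.
have h2 : ask_bounded O b s (EisK (V 22)) by apply: ask_isK; exact: ask_V.
have h3 : ask_bounded O b s (Ectr (V 22)).
  by apply: ask_prod => i; apply: ask_Bin; [apply: ask_dig|]; exact: ask_V.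
rewrite /Eforced /Ereg /Erim /Enot; ask_tac.
Qed.

Lemma ask_gam x : ask_bounded O b s (Egam d x).
Proof.
apply: ask_Bin; last exact: ask_C.
by split; [exact: ask_V | rewrite /= s4].
Qed.

Lemma ask_bet i y x : ask_bounded O b s (Ebet supp i y x).
Proof.
rewrite /Ebet; case: ifP => h; last exact: ask_C.
apply: ask_Bin; last exact: ask_C.
by split; [exact: ask_V | rewrite /= s4; exact: bet_bd].
Qed.

Lemma ask_layer : ask_bounded O b s (Elayer supp).
Proof.
apply: ask_sum => x; rewrite /Ewt.
have hg := ask_gam x; have hb i y := ask_bet i y x.
have hr e : ask_bounded O b s e -> ask_bounded O b s (Ereg e).
  by move=> h; have := ask_ext h; rewrite /Ereg => ?; ask_tac.
have h1 := hr (V 22) (ask_V _ _ _ _).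
have h2 i : ask_bounded O b s (Ereg (Bin Defs.Sub (V 22) (Epow (V 4) i))).
  by apply: hr; ask_tac.
have h3 i : ask_bounded O b s (Edig i (V 22)) by apply: ask_dig; exact: ask_V.
have h4 i : ask_bounded O b s (Enb d A i) by rewrite /Enb; ask_tac.
by ask_tac; first [exact: h2 | exact: h3 | exact: h4 | exact: hb].
Qed.

End Asks.

Variables (D W a : nat) (free : bool).
Notation zdp := (zdp supp O n c D W a free).
Notation forced := (forced O n c D W a free).

Lemma zdpS i st : zdp i.+1 st =
  (\sum_x local_wt supp O n c D W a free (NS - i.+1) x
           (fun r => letter (digit q r.-1 st)) *
   zdp i ((st * q + rank x) %% q ^ R))%N.
Proof. by []. Qed.

Section OneState.
Variables (s : memory) (i st : nat).
Notation ev e x := (Defs.eval O s e = x%:Z).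
Hypotheses (s0 : s 0 = n%:Z) (s3 : s 3%:Z = c%:Z) (s4 : s 4%:Z = m%:Z).
Hypothesis sPW : forall e, (e <= R)%N -> s (arr 0 e) = (q ^ e)%N%:Z.
Hypotheses (s7 : s 7%:Z = (q ^ R)%N%:Z).
Hypotheses (s21 : s 21%:Z = i%:Z) (s22 : s 22%:Z = (NS - i.+1)%N%:Z).

Lemma ev_layer : s 24%:Z = st%:Z -> s 23%:Z = (forced (NS - i.+1))%:Z ->
  (forall st', (0 < i)%N -> (st' < q ^ R)%N ->
     s (arr 1 (i * q ^ R + st')) = (zdp i st')%:Z) ->
  ev (Elayer supp) (zdp i.+1 st).
Proof.
move=> s24 s23 lay; rewrite zdpS; apply: ev_sum => x; apply: ev_Mul.
  apply: ev_Mul; last by apply: ev_wt; eassumption.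
  by apply: ev_Add; apply: ev_Eq.
apply: (ev_cond (t := i == 0%N)) => [|/eqP ->|]; first exact: ev_Eq.
- by [].
- rewrite -lt0n => i0; apply: ev_VA (lay _ i0 _); last first.
    by rewrite ltn_mod expn_gt0 card_gt0.
  apply: ev_Add; first exact: ev_Mul.
  by apply: ev_Mod => //; apply: ev_Add => //; exact: ev_Mul.
Qed.

Notation cn P := (cnt (fun k => P (NS - k.+1)%N) i).

Lemma later_step P : (i < NS)%N -> later d c P (NS - i.+1) = cn P.
Proof. by move=> iN; rewrite /later; congr (cnt _ _); lia. Qed.

Lemma ev_forced : (i < NS)%N -> s 14%:Z = a%:Z -> s 18%:Z = (free : nat)%:Z ->
  s 19%:Z = (D %/ q ^ cn (rim d c))%N%:Z ->
  s 20%:Z = (W %/ q ^ cn (isK O n c))%N%:Z ->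
  ev (Eforced d A) (forced (NS - i.+1)).
Proof.
move=> iN s14 s18 s19 s20; rewrite /forced.
have hf : ev (Enot (V 18)) (~~ free) by exact: ev_not.
apply: (ev_cond (t := ~~ reg d c (NS - i.+1))) => [|->|/negbTE ->] //.
  by apply: ev_not; exact: ev_reg.
apply: (ev_cond (t := rim d c (NS - i.+1))) => [|->|/negbTE ->] //.
- exact: ev_rim.
- by rewrite later_step //; apply: ev_Mod.
apply: (ev_cond (t := isK O n c (NS - i.+1) && ~~ free)) => [|->|/negbTE ->] //.
- by apply: ev_and => //; exact: ev_isK.
- by rewrite later_step //; apply: ev_Mod.
apply: (ev_cond (t := ctr d c (NS - i.+1) && ~~ free)) => [|->|/negbTE ->] //.
by apply: ev_and => //; exact: ev_ctr.
Qed.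

End OneState.

(** A code is consumed from its lowest digit: after [i] sites the register holds the quotient by [q]
    to the number of sites of [P] passed, and its remainder modulo [q] is the next letter. *)
Lemma cnt_div (P : pred nat) (X i : nat) :
  (if P i then X %/ q ^ cnt P i %/ q else X %/ q ^ cnt P i)%N =
  (X %/ q ^ cnt P i.+1)%N.
Proof.
rewrite cntS; case: (P i); last by rewrite addn0.
by rewrite addn1 expnSr divnMA.
Qed.

Hypothesis ab : (a < 2 ^ b)%N.
Hypothesis Db : (D < 2 ^ b)%N.
Hypothesis Wb : (W < 2 ^ b)%N.
Hypothesis zdp_bd : forall i st, (i <= NS)%N -> (st < q ^ R)%N ->
  (zdp i st < 2 ^ b)%N.

Notation cn P i := (cnt (fun k => P (NS - k.+1)%N) i).
Notation vs := [:: 19; 20; 21; 22; 23; 24; 25]%N.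

Definition dp_pre (s : memory) : Prop :=
  [/\ [/\ s 0 = n%:Z, s 3%:Z = c%:Z, s 4%:Z = m%:Z & s 7%:Z = (q ^ R)%N%:Z],
      s 14%:Z = a%:Z, s 18%:Z = (free : nat)%:Z &
      forall e, (e <= R)%N -> s (arr 0 e) = (q ^ e)%N%:Z].

Lemma dp_pre_frame s s' : frame vs [:: 1%N] s s' -> dp_pre s -> dp_pre s'.
Proof.
move=> [h1 h2] [[k1 k2 k3 k4] k5 k6 k7].
split; [split| | |] => [|||||| e eR]; rewrite ?h1 ?h2 ?k7 //.
Qed.

Definition layer (i : nat) (s : memory) : Prop :=
  forall st, (0 < i)%N -> (st < q ^ R)%N -> s (arr 1 (i * q ^ R + st)) = (zdp i st)%:Z.

Definition dp_inv (s0 : memory) (i : nat) (s : memory) : Prop :=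
  [/\ frame vs [:: 1%N] s0 s, s 21%:Z = i%:Z,
      s 19%:Z = (D %/ q ^ cn (rim d c) i)%N%:Z,
      s 20%:Z = (W %/ q ^ cn (isK O n c) i)%N%:Z & layer i s].

Lemma forced_lt p : (forced p < 2 ^ b)%N.
Proof.
rewrite /forced; case: ifP => _; first by rewrite expn_gt0.
have h i x : (digit q i x < 2 ^ b)%N.
  by apply: leq_ltn_trans qb; apply/ltnW/digit_lt/card_gt0.
by do 3 (case: ifP => _ //).
Qed.

Lemma runs_DPstep s0 i s : (i < NS)%N -> bounded b s -> dp_pre s0 ->
  dp_inv s0 i s -> runs O b s (DPstep supp) (q ^ R).+1
    (fun s' => s' 21%:Z = i%:Z /\ dp_inv s0 i.+1 (update s' 21%:Z i.+1%:Z)).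
Proof.
move=> iN bs pre0 [fr s21 s19 s20 lay].
have [[e0 e3 e4 e7] e14 e18 ePW] := dp_pre_frame fr pre0.
have divb X k : (X < 2 ^ b)%N -> (X %/ k < 2 ^ b)%N.
  by apply: leq_ltn_trans; exact: leq_div.
set p := (NS - i.+1)%N.
have pb : (p < 2 ^ b)%N by apply: leq_ltn_trans NSb; rewrite leq_subr.
apply: (runs_seq (Q1 := fun s1 => s1 = update s 22%:Z p%:Z)).
  apply: (runs_set (v := p)) => //; last first.
    by apply: ask_Bin; [apply: ask_pow|]; ask_tac.
  by rewrite /p -[i.+1]addn1; apply: ev_Sub; [exact: ev_MD|exact: ev_Add|lia].
move=> ? bs1 ?; subst; rewrite /DPstep.
apply: (runs_seq
  (Q1 := fun s1 => s1 = update (update s 22%:Z p%:Z) 23%:Z (forced p)%:Z)).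
  apply: (runs_set (v := forced p)) => //; last exact: forced_lt.
    rewrite /p; apply: (ev_forced (i := i)); rewrite ?updE //.
  exact: ask_forced.
move=> ? bs2 ?; subst.
set D' := (D %/ q ^ cn (rim d c) i.+1)%N.
set W' := (W %/ q ^ cn (isK O n c) i.+1)%N.
set s2 := update _ 23%:Z _ in bs2 *.
apply: (runs_seq (Q1 := fun s1 => s1 = update s2 19%:Z D'%:Z)).
  apply: (runs_set (v := D')) => //; last exact: divb.
    rewrite /D' -cnt_div.
    apply: (ev_cond (t := rim d c p)) => [|->|/negbTE ->]; rewrite /s2 ?updE //.
      by apply: ev_rim; rewrite ?updE.
    by apply: ev_Div => //=; rewrite ?updE.
  have := ask_rim (ask_V O b s2 22); rewrite /Erim => ?; ask_tac.
move=> ? bs3 ?; subst.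
apply: (runs_seq
  (Q1 := fun s1 => s1 = update (update s2 19%:Z D'%:Z) 20%:Z W'%:Z)).
  apply: (runs_set (v := W')) => //; last exact: divb.
    rewrite /W' -cnt_div.
    apply: (ev_cond (t := isK O n c p)) => [|->|/negbTE ->]; rewrite /s2 ?updE //.
      by apply: ev_isK; rewrite ?updE.
    by apply: ev_Div => //=; rewrite ?updE.
  have := ask_isK (ask_V O b (update s2 19%:Z D'%:Z) 22) => ?; ask_tac.
move=> ? bs4 ?; subst.
set s3 := update _ 20%:Z _ in bs4 *.
have fr3 : frame vs [:: 1%N] s s3.
  by do 4 (apply: frame_V => //).
have pre3 := dp_pre_frame fr3 (dp_pre_frame fr pre0).
pose I k s' := [/\ frame [:: 24%N] [:: 1%N] s3 s', s' 24%:Z = k%:Z, layer i s' &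
  forall st, (st < k)%N -> s' (arr 1 (i.+1 * q ^ R + st)) = (zdp i.+1 st)%:Z].
have I_layer k x s' : layer i s' -> layer i (update s' k%:Z x).
  by move=> h st i0 stR; rewrite updE h.
apply: (@runs_mono _ _ _ _ _ _ (q ^ R).+1 _ (I (q ^ R)%N)) => //; last first.
  move=> s' bs' [fr' s'24 lay' new]; split.
    by case: fr' => h _; rewrite h // /s3 /s2 !updE.
  have [h1 h2] := fr'; split.
  - apply: frame_V => //; apply: frame_trans fr _.
    by apply: frame_trans fr3 _; apply: frame_sub fr' _ _.
  - by rewrite updE.
  - by rewrite updE /= h1 // /s3 /s2 !updE.
  - by rewrite updE /= h1 // /s3 /s2 !updE.
  - by move=> st _ stR; rewrite updE new.
apply: (@runs_for _ _ _ _ _ _ _ _ 1 _ (q ^ R)) => //; rewrite ?mul1n //.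
- move=> k s' [fr' s'24 _ _]; split; [by []| |exact: ask_V].
  case: fr' => h _; rewrite /= h // /s3 /s2 !updE /=; exact: e7.
- split; [by apply: frame_V|by []| |by []].
  by do 5 apply: (I_layer _ _ _ _).
- move=> k s' kR bs' [fr' s'24 lay' new].
  have fr2 : frame vs [:: 1%N] s3 s' by apply: frame_sub fr' _ _.
  have [[f0 f3 f4 f7] f14 f18 fPW] := dp_pre_frame fr2 pre3.
  have [h1 h2] := fr'.
  have f21 : s' 21%:Z = i%:Z by rewrite h1 // /s3 /s2 !updE.
  have f22 : s' 22%:Z = p%:Z by rewrite h1 // /s3 /s2 !updE.
  have f23 : s' 23%:Z = (forced p)%:Z by rewrite h1 // /s3 /s2 !updE.
  apply: (@runs_setA _ _ _ _ _ _ _ _ (i.+1 * q ^ R + k)%N _ (zdp i.+1 k)) => //.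
  + apply: ev_Add; last exact: ev_V.
    by rewrite -[i.+1]addn1; apply: ev_Mul; [apply: ev_Add; [exact: ev_V|]|exact: ev_V].
  + exact: ev_layer.
  + exact: ask_layer.
  + exact: zdp_bd.
  (* Writing into layer [i.+1] leaves layer [i], which is still being read, intact. *)
  have kl st : (st < q ^ R)%N -> (i * q ^ R + st != i.+1 * q ^ R + k)%N.
    by rewrite mulSn; clear; move: (q ^ R)%N => X; lia.
  split; first by rewrite updE.
  split.
  + by apply: frame_V => //; apply: frame_A.
  + by rewrite updE.
  + move=> st i0 stR; rewrite updE upd_AA // eqxx /= (negbTE (kl _ stR)).
    exact: lay'.
  + move=> st; rewrite ltnS leq_eqVlt updE upd_AA // eqn_add2l eqxx /=.
    by case: eqP => [->//|_] /= /new.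
Qed.

Definition DP : cmd d A :=
  Seq (Set_ 19 (V 17)) (Seq (Set_ 20 (V 12)) (Seq (For 21%:Z (EMD d A) (DPstep supp))
    (Set_ 25 (VA 1 (Bin Mul (EMD d A) (V 7)))))).

Lemma runs_DP s : bounded b s -> dp_pre s -> s 17%:Z = D%:Z -> s 12%:Z = W%:Z ->
  runs O b s DP ((q ^ R).+1 * NS.+1)
    (fun s' => frame vs [:: 1%N] s s' /\ s' 25%:Z = (zdp NS 0)%:Z).
Proof.
move=> bs pre s17 s12; set k := (_ * _)%N.
have k0 : (0 < k)%N by rewrite muln_gt0.
apply: (runs_seq (Q1 := fun s1 => s1 = update s 19%:Z D%:Z)).
  by apply: (runs_set (v := D)).
move=> ? bs1 ?; subst.
apply: (runs_seq
  (Q1 := fun s1 => s1 = update (update s 19%:Z D%:Z) 20%:Z W%:Z)).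
  by apply: (runs_set (v := W)) => //=; rewrite updE.
move=> ? bs2 ?; subst; set s2 := update _ _ _ in bs2 *.
have fr2 : frame vs [:: 1%N] s s2 by do 2 apply: frame_V => //.
apply: (runs_seq (Q1 := dp_inv s NS)).
  apply: (@runs_for _ _ _ _ _ _ _ _ (q ^ R).+1 _ NS) => //.
  - move=> i s' [fr s'21 _ _ _]; split => //; last by apply: ask_pow; exact: ask_V.
    by apply: ev_MD; have [[]] := dp_pre_frame fr pre.
  - split; rewrite ?updE //; first by apply: frame_V.
    + by rewrite /s2 !updE /= divn1.
    + by rewrite /s2 !updE /= divn1.
  - by move=> i s' iN bs' inv; exact: runs_DPstep.
move=> s' bs' [fr s'21 _ _ lay].
have [[e0 e3 e4 e7] _ _ _] := dp_pre_frame fr pre.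
apply: (runs_set (v := zdp NS 0)) => //.
- apply: ev_VA (lay 0%N _ _); rewrite ?expn_gt0 ?card_gt0 // addn0.
  by apply: ev_Mul; [exact: ev_MD|exact: ev_V].
- by apply: ask_VA; apply: ask_Bin; [apply: ask_pow|]; exact: ask_V.
- by apply: zdp_bd; rewrite ?expn_gt0 ?card_gt0.
- by split; [exact: frame_V|rewrite updE].
Qed.

End RunDP.

(** * Bounds over all boundary conditions *)

Section Quantities.
Variables (d : nat) (A : alphabetType) (supp : 'I_d -> rel A).
Variables (O : oracle d A) (n c : nat).
Notation m := c.*2.+1.
Notation q := #|A|.

(* N = bigN is a power of q, so that dividing N ^ 3 by q ^ (2 * n ^ d.-1 + 1)
   in the margin of error is exact. *)
Definition kap : nat := total d c (isK O n c).
Definition nrim : nat := total d c (rim d c).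
Definition expN : nat := (2 * kap + (4 * n ^ d.-1 + 20))%N.
Definition bigN : nat := (q ^ expN)%N.
(** The largest exponent in the table of powers: the first term dominates both the number of rim
    sites and the length of a state, the second the word length and N. *)
Definition expX : nat := (2 * d * m ^ d.-1 + expN)%N.

(** A weight above [thr] has relative error at most [2 / thr]; an interaction has at most
    [d.+1 * m ^ d] factors, so its relative error is at most 1/(8N). *)
Definition thr : nat := (16 * d.+1 * m ^ d * bigN)%N.
Definition precise : bool :=
  [forall x, thr <= `|gamma_approx O x m|]%N &&
  [forall i, forall y, forall x,
     supp i y x ==> (thr <= `|beta_approx O i y x m|)%N].

Definition zval (D W a : nat) (free : bool) : nat :=
  zdp supp O n c D W a free (m ^ d) 0.

(* The floor of N Λ^δ(w), where δ and w are the configurations coded by D and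
   by (W, a), and Λ is taken for the approximate weights. It makes sense when
   zval D W a true, the partition function, is not 0, i.e. when δ is
   admissible; lo and hi are the extreme ratios over these D. *)
Definition ratio (D W a : nat) : nat :=
  (bigN * zval D W a false %/ zval D W a true)%N.

(** The starting values, [bigN] here and 0 for [hi], are neutral: the ratio of an admissible code
    lies between them. *)
Fixpoint lo (D W a : nat) : nat :=
  if D is D'.+1 then
    if (1 <= zval D' W a true)%N && (ratio D' W a <= lo D' W a)%N
    then ratio D' W a else lo D' W a
  else bigN.

Fixpoint hi (D W a : nat) : nat :=
  if D is D'.+1 then
    if (1 <= zval D' W a true)%N && (hi D' W a <= ratio D' W a)%N
    then ratio D' W a else hi D' W a
  else 0%N.

Definition lof (W a : nat) : nat := lo (q ^ nrim) W a.
Definition hif (W a : nat) : nat := hi (q ^ nrim) W a.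
(** Floors of arbitrarily close numbers can differ by 1, so equality of the two bounds could not be
    counted on. *)
Definition good (W a : nat) : bool := (hif W a <= lof W a + 1)%N.
Definition smf (W : nat) : nat := (\sum_(a < q) lof W a)%N.

(* N ^ 2 times the harmonic number, standing for N ^ 2 ln e. *)
Definition harm (e : nat) : nat := (\sum_(k < e) bigN * bigN %/ k.+1)%N.

(* Hplus - Hminus approximates N ^ 3 times the sum of - x ln (x / X), where x
   is the mass of a word on 0 |` K and X that of its restriction to K. *)
Definition Hplus (w : nat) : nat := (\sum_(W < w) smf W * harm (smf W))%N.
Definition Hminus (w : nat) : nat :=
  (\sum_(W < w) \sum_(a < q) lof W a * harm (lof W a))%N.
Definition all_good (w : nat) : bool :=
  \big[andb/true]_(W < w) \big[andb/true]_(a < q) good W a.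

Lemma lo_le D W a : (lo D W a <= bigN)%N.
Proof.
elim: D => //= D IH; case: ifP => // /andP[_ h]; exact: leq_trans h IH.
Qed.

Lemma harmS e : harm e.+1 = (harm e + bigN * bigN %/ (e + 1))%N.
Proof. by rewrite /harm big_ord_recr /= addn1. Qed.

Lemma leq_harm : {homo harm : e e' / (e <= e')%N}.
Proof.
move=> e e' ee'; rewrite -(subnKC ee'); elim: (e' - e)%N => [|k IH].
  by rewrite addn0.
by rewrite addnS harmS (leq_trans IH) // leq_addr.
Qed.

Lemma smf_le W : (smf W <= q * bigN)%N.
Proof.
rewrite /smf -[X in (_ <= X * _)%N]card_ord -sum_nat_const leq_sum // => a _.
exact: lo_le.
Qed.

Lemma Hplus_le w : (Hplus w <= w * (q * bigN * harm (q * bigN)))%N.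
Proof.
rewrite /Hplus -[X in (_ <= X * _)%N]card_ord -sum_nat_const leq_sum // => a _.
by apply: leq_mul; [|apply: leq_harm]; exact: smf_le.
Qed.

Lemma lof_harm_le W k : (k <= q)%N ->
  (\sum_(a < k) lof W a * harm (lof W a) <= q * bigN * harm (q * bigN))%N.
Proof.
move=> kq; apply: (@leq_trans (\sum_(a < k) bigN * harm (q * bigN))).
  apply: leq_sum => a _; apply: leq_mul; first exact: lo_le.
  by apply: leq_harm; apply: leq_trans (lo_le _ _ _) _; rewrite leq_pmull ?card_gt0.
by rewrite sum_nat_const card_ord -mulnA leq_mul2r kq orbT.
Qed.

Lemma Hminus_le w : (Hminus w <= w * (q * bigN * harm (q * bigN)))%N.
Proof.
rewrite /Hminus -[X in (_ <= X * _)%N]card_ord -sum_nat_const leq_sum // => a _.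
exact: lof_harm_le.
Qed.

End Quantities.

Section Body.
Variables (d : nat) (A : alphabetType) (supp : 'I_d -> rel A).
Notation q := #|A|.
Notation C := (@C d A).
Notation V := (@V d A).
Notation DP := (DP supp).

(* Registers: 2, whether the bounds are good so far; 8, N; 9, the number of W;
   10, the number of D; 11, Hplus; 13, smf; 15 and 16, lo and hi; 26, the
   partition function; 27, the ratio; 29, Hminus. *)
Definition Dbody : cmd d A :=
  Seq (Set_ 18 (C 1)) (Seq DP (Seq (Set_ 26 (V 25))
  (Seq (Set_ 18 (C 0)) (Seq DP
  (Seq (Set_ 27 (Bin Div (Bin Mul (V 8) (V 25)) (V 26)))
  (Seq (Set_ 15 (Econd (Bin Mul (Bin Leq (C 1) (V 26)) (Bin Leq (V 27) (V 15)))
                       (V 27) (V 15)))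
       (Set_ 16 (Econd (Bin Mul (Bin Leq (C 1) (V 26)) (Bin Leq (V 16) (V 27)))
                       (V 27) (V 16))))))))).

Definition abody : cmd d A :=
  Seq (Set_ 15 (V 8)) (Seq (Set_ 16 (C 0)) (Seq (For 17%:Z (V 10) Dbody)
  (Seq (Set_ 2 (Bin Mul (V 2) (Bin Leq (V 16) (Bin Add (V 15) (C 1)))))
  (Seq (Set_ 13 (Bin Add (V 13) (V 15)))
       (Set_ 29 (Bin Add (V 29) (Bin Mul (V 15) (VA 2 (V 15))))))))).

Definition Wbody : cmd d A :=
  Seq (Set_ 13 (C 0)) (Seq (For 14%:Z (C q%:Z) abody)
    (Set_ 11 (Bin Add (V 11) (Bin Mul (V 13) (VA 2 (V 13)))))).

Variables (O : oracle d A) (b n c : nat).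
Notation m := c.*2.+1.
Notation R := (m ^ d.-1)%N.
Notation NS := (m ^ d)%N.
Notation N := (bigN O n c).
Notation X := (expX O n c).
Hypothesis b0 : (0 < b)%N.
Hypothesis gam_ge0 : forall x, 0 <= gamma_approx O x m.
Hypothesis bet_ge0 : forall i y x, supp i y x -> 0 <= beta_approx O i y x m.
Hypothesis gam_bd : forall x, (`|gamma_approx O x m| < 2 ^ b)%N.
Hypothesis bet_bd : forall i y x, supp i y x ->
  (`|beta_approx O i y x m| < 2 ^ b)%N.
Hypothesis NSb : (NS < 2 ^ b)%N.
Hypothesis qNb : (q * N < 2 ^ b)%N.
Hypothesis Xb : (X < 2 ^ b)%N.
Hypothesis qXb : (q ^ X < 2 ^ b)%N.
Hypothesis R_X : (R <= X)%N.
Hypothesis rim_X : (nrim d c <= X)%N.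
Hypothesis zdp_bd : forall D W a free i st, (i <= NS)%N -> (st < q ^ R)%N ->
  (N * zdp supp O n c D W a free i st < 2 ^ b)%N.
Hypothesis H_bd : (q ^ kap O n c * (q * N * harm O n c (q * N)) < 2 ^ b)%N.

Definition ctx (s : memory) : Prop :=
  [/\ [/\ s 0 = n%:Z, s 3%:Z = c%:Z, s 4%:Z = m%:Z & s 7%:Z = (q ^ R)%N%:Z],
      [/\ s 8%:Z = N%:Z, s 9%:Z = (q ^ kap O n c)%N%:Z
        & s 10%:Z = (q ^ nrim d c)%N%:Z],
      forall e, (e <= X)%N -> s (arr 0 e) = (q ^ e)%N%:Z &
      forall e, (e <= q * N)%N -> s (arr 2 e) = (harm O n c e)%:Z].

Lemma ctx_frame vs ts s s' : frame vs ts s s' ->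
  all [pred k | k \notin vs] [:: 0; 3; 4; 7; 8; 9; 10]%N ->
  all [pred k | k \notin ts] [:: 0; 2]%N -> ctx s -> ctx s'.
Proof.
move=> [h1 h2] /and5P[v0 v3 v4 v7 /and4P[v8 v9 v10 _]] /and3P[t0 t2 _].
move=> [[e0 e3 e4 e7] [e8 e9 e10] eP eT]; split; [split|split| | ] => *.
all: by rewrite ?(h1 _ v0) ?h1 ?h2 ?eP ?eT.
Qed.

Lemma bigN_gt0 : (0 < N)%N. Proof. by rewrite expn_gt0 card_gt0. Qed.

Lemma leq_expX e : (e <= X)%N -> (q ^ e < 2 ^ b)%N.
Proof.
by move=> eX; apply: leq_ltn_trans qXb; rewrite leq_pexp2l ?card_gt0.
Qed.

Let qb : (q < 2 ^ b)%N.
Proof. by apply: leq_ltn_trans qNb; rewrite leq_pmulr ?bigN_gt0. Qed.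
Let Nb : (N < 2 ^ b)%N.
Proof. by apply: leq_ltn_trans qNb; rewrite leq_pmull ?card_gt0. Qed.

Lemma runs_DP_free s D W a (free : bool) : bounded b s -> ctx s ->
  s 12%:Z = W%:Z -> s 14%:Z = a%:Z -> s 17%:Z = D%:Z ->
  s 18%:Z = (free : nat)%:Z ->
  runs O b s DP ((q ^ R).+1 * NS.+1)
    (fun s' => frame [:: 19; 20; 21; 22; 23; 24; 25]%N [:: 1%N] s s' /\
               s' 25%:Z = (zval supp O n c D W a free)%:Z).
Proof.
move=> bs [e e' ePW eT] s12 s14 s17 s18.
have bz i st : (i <= NS)%N -> (st < q ^ R)%N ->
    (zdp supp O n c D W a free i st < 2 ^ b)%N.
  move=> iN stR; apply: leq_ltn_trans (zdp_bd D W a free iN stR).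
  by rewrite leq_pmull ?bigN_gt0.
apply: runs_DP => //.
- exact: leq_expX.
- by have := bs 14%:Z; rewrite s14.
- by have := bs 17%:Z; rewrite s17.
- by have := bs 12%:Z; rewrite s12.
- by split => // ee eR; apply: ePW; apply: leq_trans eR R_X.
Qed.

Definition Dinv s0 W a k s :=
  [/\ frame [:: 15; 16; 17; 18; 19; 20; 21; 22; 23; 24; 25; 26; 27]%N [:: 1%N] s0 s,
      s 17%:Z = k%:Z, s 15%:Z = (lo supp O n c k W a)%:Z &
      s 16%:Z = (hi supp O n c k W a)%:Z].

Lemma runs_Dbody s0 W a k s : bounded b s -> ctx s0 ->
  s0 12%:Z = W%:Z -> s0 14%:Z = a%:Z -> Dinv s0 W a k s ->
  runs O b s Dbody ((q ^ R).+1 * NS.+1)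
    (fun s' => s' 17%:Z = k%:Z /\ Dinv s0 W a k.+1 (update s' 17%:Z k.+1%:Z)).
Proof.
move=> bs cx0 s12 s14 [fr s17 s15 s16]; set K := (_ * _)%N.
have K0 : (0 < K)%N by rewrite muln_gt0.
have ratio_lt : (ratio supp O n c k W a < 2 ^ b)%N.
  apply: leq_ltn_trans (zdp_bd k W a false (leqnn _) _); first exact: leq_div.
  by rewrite expn_gt0 card_gt0.
have b1 : (1 < 2 ^ b)%N by rewrite -(expn0 2) ltn_exp2l.
have lo_lt : (lo supp O n c k.+1 W a < 2 ^ b)%N.
  by apply: leq_ltn_trans Nb; exact: lo_le.
have hi_lt : (hi supp O n c k.+1 W a < 2 ^ b)%N.
  by have := bs 16%:Z; rewrite s16 /=; case: ifP.
pose zt := zval supp O n c k W a true; pose zf := zval supp O n c k W a false.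
pose f s' := frame [:: 18; 19; 20; 21; 22; 23; 24; 25; 26; 27]%N [:: 1%N] s s'.
have cxf s' : f s' -> [/\ ctx s', s' 12%:Z = W%:Z, s' 14%:Z = a%:Z, s' 17%:Z = k%:Z &
    s' 15%:Z = (lo supp O n c k W a)%:Z /\ s' 16%:Z = (hi supp O n c k W a)%:Z].
  move=> fs'; split; first exact: ctx_frame fs' _ _ (ctx_frame fr _ _ cx0).
  1-3: by case: fs' => h _; rewrite h //; case: fr => h' _; rewrite ?h'.
  by case: fs' => h _; rewrite !h.
apply: (runs_seq (Q1 := fun s' => f s' /\ s' 18%:Z = 1)).
  by apply: (runs_set (v := 1)) => //; split; [exact: frame_V|].
move=> s1 bs1 [f1 s1_18]; have [cx1 e12 e14 e17 _] := cxf _ f1.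
apply: (runs_seq (Q1 := fun s' => f s' /\ s' 25%:Z = zt%:Z)).
  apply: runs_mono (runs_DP_free (free := true) bs1 cx1 e12 e14 e17 s1_18) _ _ => //.
  move=> s' _ [f2 ->]; split => //; apply: frame_trans f1 _.
  by apply: frame_sub f2 _ _.
move=> s2 bs2 [f2 s2_25].
apply: (runs_seq (Q1 := fun s' => f s' /\ s' 26%:Z = zt%:Z)).
  apply: (runs_set (v := zt)) => //.
    by have := bs2 25%:Z; rewrite s2_25.
  by split; [exact: frame_V|rewrite updE].
move=> s3 bs3 [f3 s3_26].
apply: (runs_seq
  (Q1 := fun s' => [/\ f s', s' 26%:Z = zt%:Z & s' 18%:Z = 0])).
  apply: (runs_set (v := 0)) => //.
    by rewrite expn_gt0.
  by split; [exact: frame_V|rewrite updE|].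
move=> s4 bs4 [f4 s4_26 s4_18]; have [cx4 e12' e14' e17' _] := cxf _ f4.
apply: (runs_seq
  (Q1 := fun s' => [/\ f s', s' 26%:Z = zt%:Z & s' 25%:Z = zf%:Z])).
  apply: runs_mono (runs_DP_free (free := false) bs4 cx4 e12' e14' e17' s4_18) _ _ => //.
  move=> s' _ [f5 ->]; split => //; last by case: f5 => h _; rewrite h.
  by apply: frame_trans f4 _; apply: frame_sub f5 _ _.
move=> s5 bs5 [f5 s5_26 s5_25].
(* If the partition function is 0, the division returns 0 in the program as in [ratio], and the
   tests that follow discard the result. *)
apply: (runs_seq (Q1 := fun s' => [/\ f s', s' 26%:Z = zt%:Z &
    s' 27%:Z = (ratio supp O n c k W a)%:Z])).
  apply: (runs_set (v := ratio supp O n c k W a)) => //.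
    have [[_ [s8 _ _] _ _] _ _ _ _] := cxf _ f5.
    by apply: ev_Div => //; apply: ev_Mul.
  by split; [exact: frame_V|rewrite updE|rewrite updE].
move=> s6 bs6 [f6 s6_26 s6_27]; have [_ _ _ _ [s6_15 s6_16]] := cxf _ f6.
pose lo' := lo supp O n c k.+1 W a.
apply: (runs_seq (Q1 := fun s' => s' = update s6 15%:Z lo'%:Z)).
  apply: (runs_set (v := lo')) => //.
  apply: (ev_cond (t :=
    (1 <= zt)%N && (ratio supp O n c k W a <= lo supp O n c k W a)%N)).
  - by apply: ev_and; apply: ev_Leq.
  - by rewrite /lo' /= -/zt => ->.
  - by rewrite /lo' /= -/zt => /negbTE ->.
move=> s7 bs7 ?; subst s7.
apply: (runs_set (v := hi supp O n c k.+1 W a)) => //.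
  apply: (ev_cond (t :=
    (1 <= zt)%N && (hi supp O n c k W a <= ratio supp O n c k W a)%N)).
  - by apply: ev_and; apply: ev_Leq => //=; rewrite updE.
  - by rewrite /= -/zt => ->; rewrite updE.
  - by rewrite /= -/zt => /negbTE ->; rewrite updE.
split; first by rewrite !updE /=; have [_ _ _ ? _] := cxf _ f6.
split; rewrite ?updE //.
do 3 apply: frame_V => //; apply: frame_trans fr _; exact: frame_sub f6 _ _.
Qed.

Notation vsa := [:: 2; 13; 14; 15; 16; 17; 18; 19; 20; 21; 22; 23; 24; 25; 26; 27; 29]%N.

(** [ok] and [h] are the contents of registers 2 and 29 before the loop over letters; both
    accumulate over all words. *)
Definition ainv (ok : bool) (h : nat) s0 W k s :=
  [/\ frame vsa [:: 1%N] s0 s, s 14%:Z = k%:Z,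
      s 13%:Z = (\sum_(a < k) lof supp O n c W a)%N%:Z,
      s 29%:Z = (h + \sum_(a < k) lof supp O n c W a * harm O n c (lof supp O n c W a))%N%:Z &
      s 2%:Z = (ok && \big[andb/true]_(a < k) good supp O n c W a : nat)%:Z].

Lemma runs_abody (ok : bool) h s0 W k s : bounded b s -> (k < q)%N -> ctx s0 ->
  (h + q * N * harm O n c (q * N) < 2 ^ b)%N ->
  s0 12%:Z = W%:Z -> ainv ok h s0 W k s ->
  runs O b s abody ((q ^ R).+1 * NS.+1 * (q ^ nrim d c).+1)
    (fun s' => s' 14%:Z = k%:Z /\ ainv ok h s0 W k.+1 (update s' 14%:Z k.+1%:Z)).
Proof.
move=> bs kq cx0 hb s12 [fr s14 s13 s29 s2]; set K := (_ * _ * _)%N.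
have K0 : (0 < K)%N by rewrite !muln_gt0.
have cx := ctx_frame fr isT isT cx0; have [_ [s8 _ _] _ _] := cx.
apply: (runs_seq (Q1 := fun s' => s' = update s 15%:Z N%:Z)).
  by apply: (runs_set (v := N)).
move=> s1 bs1 ?; subst s1.
apply: (runs_seq
  (Q1 := fun s' => s' = update (update s 15%:Z N%:Z) 16%:Z 0)).
  by apply: (runs_set (v := 0)) => //; rewrite expn_gt0.
move=> s1 {}bs1 E; have f1 : frame vsa [:: 1%N] s s1.
  by rewrite E; do 2 apply: frame_V => //.
have cx1 := ctx_frame f1 isT isT cx.
have s1_12 : s1 12%:Z = W%:Z.
  by case: f1 => h1 _; rewrite h1 //; case: fr => h2 _; rewrite h2.
have s1_14 : s1 14%:Z = k%:Z by rewrite E !updE.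
apply: (runs_seq (Q1 := Dinv s1 W k (q ^ nrim d c))).
  apply: (@runs_for _ _ _ _ _ _ _ _ ((q ^ R).+1 * NS.+1) _ (q ^ nrim d c)) => //.
  - exact: leq_expX.
  - move=> i s' [fr' s'17 _ _]; split => //.
    by have [_ [_ _ ?] _ _] := ctx_frame fr' isT isT cx1.
  - by split; rewrite ?updE //; [exact: frame_V|rewrite E !updE|rewrite E !updE].
  - by move=> i s' _ bs' inv; exact: runs_Dbody.
move=> s2' bs2 [f2 s2_17 s2_15 s2_16].
rewrite -/(lof supp O n c W k) -/(hif supp O n c W k) in s2_15 s2_16.
have cx2 := ctx_frame f2 isT isT cx1; have [_ _ _ eT] := cx2.
have f02 : frame vsa [:: 1%N] s0 s2'.
  by apply: frame_trans fr _; apply: frame_trans f1 _; exact: frame_sub f2 _ _.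
have e2 : s2' 2%:Z = s 2%:Z.
  by case: f2 => h1 _; rewrite h1 // E !updE.
have e13 : s2' 13%:Z = s 13%:Z.
  by case: f2 => h1 _; rewrite h1 // E !updE.
have e29 : s2' 29%:Z = s 29%:Z.
  by case: f2 => h1 _; rewrite h1 // E !updE.
have e14 : s2' 14%:Z = s 14%:Z.
  by case: f2 => h1 _; rewrite h1 // E !updE.
pose ok' := ok && \big[andb/true]_(a < k.+1) good supp O n c W a.
apply: (runs_seq (Q1 := fun s' => s' = update s2' 2%:Z (ok' : nat)%:Z)).
  apply: (runs_set (v := ok' : nat)) => //.
    have -> : ok' = (ok && \big[andb/true]_(a < k) good supp O n c W a)
                      && good supp O n c W k.
      by rewrite /ok' big_ord_recr /= andbA.
    apply: ev_and; first by rewrite -s2 -e2.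
    by apply: ev_Leq => //; apply: ev_Add.
  have b1 : (1 < 2 ^ b)%N by rewrite -(expn0 2) ltn_exp2l.
  by case: ok'; rewrite ?expn_gt0.
move=> s3 bs3 ?; subst s3.
pose t' := (\sum_(a < k.+1) lof supp O n c W a)%N.
set s3 := update _ _ _ in bs3 *.
apply: (runs_seq (Q1 := fun s' => s' = update s3 13%:Z t'%:Z)).
  apply: (runs_set (v := t')) => //.
    have -> : t' = (\sum_(a < k) lof supp O n c W a + lof supp O n c W k)%N.
      by rewrite /t' big_ord_recr.
    apply: ev_Add; first by rewrite /= /s3 updE -s13 -e13.
    by rewrite /= /s3 updE.
  apply: leq_ltn_trans qNb; rewrite /t'.
  apply: (@leq_trans (\sum_(a < k.+1) N)); first by apply: leq_sum => a _; exact: lo_le.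
  by rewrite sum_nat_const card_ord leq_mul2r kq orbT.
move=> s4 bs4 ?; subst s4.
set lk := lof supp O n c W k.
set H' := (h + \sum_(a < k.+1) lof supp O n c W a * harm O n c (lof supp O n c W a))%N.
apply: (runs_set (v := H')) => //.
- have -> : H' = ((h + \sum_(a < k) lof supp O n c W a *
      harm O n c (lof supp O n c W a)) + lk * harm O n c lk)%N.
    by rewrite /H' big_ord_recr /= addnA.
  apply: ev_Add.
    by rewrite /= /s3 !updE /= e29.
  have l15 : update s3 13%:Z t'%:Z 15%:Z = lk%:Z by rewrite /s3 !updE.
  apply: ev_Mul; first exact: l15.
  apply: (@ev_VA _ _ _ _ _ (V 15) _ _ l15).
  rewrite upd_VA /s3 upd_VA eT //.
  by apply: leq_trans (lo_le _ _ _ _ _ _ _) _; rewrite leq_pmull ?card_gt0.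
- by apply: leq_ltn_trans hb; rewrite leq_add2l; exact: lof_harm_le.
split; first by rewrite /s3 !updE /= e14.
split; rewrite /s3 ?updE //.
by do 4 apply: frame_V => //.
Qed.

Notation vsW := (11 :: 12 :: vsa)%N.

Definition Winv (ok : bool) s0 k s :=
  [/\ frame vsW [:: 1%N] s0 s, s 12%:Z = k%:Z,
      s 11%:Z = (Hplus supp O n c k)%:Z, s 29%:Z = (Hminus supp O n c k)%:Z &
      s 2%:Z = (ok && all_good supp O n c k : nat)%:Z].

Lemma runs_Wbody ok s0 k s : bounded b s -> ctx s0 -> (k < q ^ kap O n c)%N ->
  Winv ok s0 k s ->
  runs O b s Wbody ((q ^ R).+1 * NS.+1 * (q ^ nrim d c).+1 * q.+1)
    (fun s' => s' 12%:Z = k%:Z /\ Winv ok s0 k.+1 (update s' 12%:Z k.+1%:Z)).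
Proof.
move=> bs cx0 kW [fr s12 s11 s29 s2]; set K := (_ * _ * _)%N.
have K0 : (0 < K)%N by rewrite !muln_gt0.
have cx := ctx_frame fr isT isT cx0.
have Hb x : (x <= q * N * harm O n c (q * N))%N -> forall y,
  (y <= k * (q * N * harm O n c (q * N)))%N -> (y + x < 2 ^ b)%N.
  move=> xb y yb; apply: leq_ltn_trans H_bd.
  apply: (@leq_trans (k.+1 * (q * N * harm O n c (q * N)))).
    by rewrite mulSn addnC leq_add.
  by rewrite leq_mul2r kW orbT.
apply: (runs_seq (Q1 := fun s' => s' = update s 13%:Z 0)).
  by apply: (runs_set (v := 0)) => //; rewrite expn_gt0.
move=> s1 bs1 ?; subst s1; set s1 := update _ _ _ in bs1 *.
have f1 : frame vsW [:: 1%N] s s1 by exact: frame_V.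
have cx1 := ctx_frame f1 isT isT cx.
pose ok1 := ok && all_good supp O n c k.
apply: (runs_seq (Q1 := ainv ok1 (Hminus supp O n c k) s1 k q)).
  apply: (@runs_for _ _ _ _ _ _ _ _ ((q ^ R).+1 * NS.+1 * (q ^ nrim d c).+1) _ q) => //.
  - by move=> i s' [_ ? _ _ _]; split.
  - split; rewrite ?updE ?big_ord0 //; first exact: frame_V.
    + by rewrite addn0 -s29 /s1 !updE.
    + by rewrite andbT /ok1 -s2 /s1 !updE.
  - move=> i s' iq bs' inv; apply: runs_abody => //.
    by apply: Hb => //; exact: Hminus_le.
move=> s2' bs2 [f2 s2_14 s2_13 s2_29 s2_2].
have [_ _ _ eT] := ctx_frame f2 isT isT cx1.
apply: (runs_set (v := Hplus supp O n c k.+1)) => //.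
- have -> : Hplus supp O n c k.+1 = (Hplus supp O n c k +
      smf supp O n c k * harm O n c (smf supp O n c k))%N.
    by rewrite /Hplus big_ord_recr.
  apply: ev_Add.
    by case: f2 => h _; rewrite /= h // /s1 updE.
  have e13 : s2' 13%:Z = (smf supp O n c k)%:Z by [].
  apply: ev_Mul; first exact: e13.
  apply: (@ev_VA _ _ _ _ _ (V 13) _ _ e13); rewrite eT //; exact: smf_le.
- rewrite /Hplus big_ord_recr /=; apply: Hb; last exact: Hplus_le.
  by apply: leq_mul; [|apply: leq_harm]; exact: smf_le.
have e12 : s2' 12%:Z = k%:Z by case: f2 => h _; rewrite h // /s1 updE.
split; first by rewrite updE.
split; rewrite ?updE //.
- do 2 apply: frame_V => //; apply: frame_trans fr _; apply: frame_trans f1 _.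
  exact: frame_sub f2 _ _.
- by rewrite /= s2_29 /Hminus big_ord_recr.
- by rewrite /= s2_2 /ok1 /all_good [in RHS]big_ord_recr /= andbA.
Qed.

End Body.

(** * The whole program *)

Section Whole.
Variables (d : nat) (A : alphabetType) (supp : 'I_d -> rel A).
Notation q := #|A|.
Notation C := (@C d A).
Notation V := (@V d A).

(* Registers: 1, the round j; 2, whether to stop; 5, |K|; 6, the number of
   sites on the rim; 28, a loop counter; 30, the margin of error. *)
Definition ER0 : expr d A := Epow (V 0) d.-1.
Definition EexpN : expr d A :=
  Bin Add (Bin Mul (C 2) (V 5)) (Bin Add (Bin Mul (C 4) ER0) (C 20)).
Definition EexpX : expr d A :=
  Bin Add (Bin Mul (C (2 * d)%N%:Z) (EMR d A)) EexpN.
Definition Ethr : expr d A :=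
  Bin Mul (Bin Mul (C (16 * d.+1)%N%:Z) (EMD d A)) (V 8).
Definition Eprecise : expr d A :=
  Bin Mul (Eprod (enum A) (fun x => Bin Leq Ethr (AskGamma x (V 4))))
    (Eprod (enum 'I_d) (fun i => Eprod (enum A) (fun y => Eprod (enum A) (fun x =>
       if supp i y x then Bin Leq Ethr (AskBeta i y x (V 4)) else C 1)))).
Definition Esite : expr d A :=
  Bin Defs.Sub (EMD d A) (Bin Add (V 28) (C 1)).

Definition geometry_part : cmd d A :=
  Seq (Set_ 1 (Bin Add (V 1) (C 1)))
  (Seq (Set_ 3 (Bin Add (V 0) (Bin Add (Bin Mul (V 1) (Bin Add ER0 (C 1))) (C 1))))
  (Seq (Set_ 4 (Bin Add (Bin Mul (C 2) (V 3)) (C 1)))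
  (Seq (Set_ 5 (C 0)) (Seq (Set_ 6 (C 0))
  (For 28%:Z (EMD d A) (Seq (Set_ 5 (Bin Add (V 5) (EisK Esite)))
                            (Set_ 6 (Bin Add (V 6) (Erim Esite))))))))).

(** Neither variable powers nor harmonic sums are expressions of constant length, so both are
    tabulated up to the largest argument needed. *)
Definition table_part : cmd d A :=
  Seq (SetA 0 (C 0) (C 1))
  (Seq (For 28%:Z EexpX
     (SetA 0 (Bin Add (V 28) (C 1)) (Bin Mul (VA 0 (V 28)) (C q%:Z))))
  (Seq (Set_ 7 (VA 0 (EMR d A))) (Seq (Set_ 8 (VA 0 EexpN))
  (Seq (Set_ 9 (VA 0 (V 5))) (Seq (Set_ 10 (VA 0 (V 6)))
  (Seq (SetA 2 (C 0) (C 0))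
  (For 28%:Z (Bin Mul (C q%:Z) (V 8))
     (SetA 2 (Bin Add (V 28) (C 1))
        (Bin Add (VA 2 (V 28))
                 (Bin Div (Bin Mul (V 8) (V 8)) (Bin Add (V 28) (C 1)))))))))))).

Definition main_part : cmd d A :=
  Seq (Set_ 2 Eprecise) (Seq (Set_ 11 (C 0)) (Seq (Set_ 29 (C 0))
  (For 12%:Z (V 9) (Wbody supp)))).

Definition body : cmd d A := Seq geometry_part (Seq table_part main_part).

Definition output_part : cmd d A :=
  Seq (Set_ 30 (Bin Div (Bin Mul (Bin Mul (V 8) (V 8)) (V 8))
                        (VA 0 (Bin Add (Bin Mul (C 2) ER0) (C 1)))))
  (Seq (Set_ 0 (Bin Defs.Sub (Bin Defs.Sub (V 11) (V 29)) (V 30)))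
  (Seq (Set_ 1 (Bin Add (Bin Defs.Sub (V 11) (V 29)) (V 30)))
       (Set_ 2 (Bin Mul (Bin Mul (V 8) (V 8)) (V 8))))).

(** Register 2 is 0 in the initial memory, so at least one round is run; only after the last one is
    it reused for the output. *)
Definition program : cmd d A :=
  Seq (While (Bin Eq (V 2) (C 0)) body) output_part.

Variables (O : oracle d A) (b n : nat).

(* The half-side of the cube in round j. Steps of order n ^ d.-1 bring the
   mixing bound below 1 / N after a number of rounds independent of n. *)
Definition center (j : nat) : nat := (n + (j * (n ^ d.-1 + 1) + 1))%N.

(** The product counts the nested loops over states, layers, boundary codes, letters and words; the
    other terms are the loops that prepare the round. *)
Definition kbody (c : nat) : nat :=
  ((q ^ c.*2.+1 ^ d.-1).+1 * (c.*2.+1 ^ d).+1 * (q ^ nrim d c).+1 * q.+1 *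
   (q ^ kap O n c).+1 + (c.*2.+1 ^ d).+1 + (expX O n c).+1 +
   (q * bigN O n c).+1)%N.

(* The round with half-side c only uses numbers of at most b bits. *)
Definition fits (c : nat) : Prop :=
  [/\ [/\ forall x, 0 <= gamma_approx O x c.*2.+1,
          forall i y x, supp i y x -> 0 <= beta_approx O i y x c.*2.+1,
          forall x, (`|gamma_approx O x c.*2.+1| < 2 ^ b)%N &
          forall i y x, supp i y x -> (`|beta_approx O i y x c.*2.+1| < 2 ^ b)%N],
      [/\ (c.*2.+1 < 2 ^ b)%N, (c.*2.+1 ^ d < 2 ^ b)%N,
          (q * bigN O n c < 2 ^ b)%N, (expX O n c < 2 ^ b)%N &
          (q ^ expX O n c < 2 ^ b)%N],
      [/\ (c.*2.+1 ^ d.-1 <= expX O n c)%N & (nrim d c <= expX O n c)%N],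
      (forall D W a free i st, (i <= c.*2.+1 ^ d)%N ->
         (st < q ^ c.*2.+1 ^ d.-1)%N ->
         (bigN O n c * zdp supp O n c D W a free i st < 2 ^ b)%N) &
      (q ^ kap O n c * (q * bigN O n c * harm O n c (q * bigN O n c)) +
       bigN O n c * bigN O n c * bigN O n c < 2 ^ b)%N].

Hypothesis b0 : (0 < b)%N.
Hypothesis nb : (n < 2 ^ b)%N.

Section AtCenter.
Variable j : nat.
Notation c := (center j).
Notation m := c.*2.+1.
Notation NS := (m ^ d)%N.
Notation R := (m ^ d.-1)%N.
Notation N := (bigN O n c).
Notation X := (expX O n c).
Hypothesis fit : fits c.
Hypothesis j0 : (0 < j)%N.

Let cm : (c < m)%N. Proof. by lia. Qed.
Let b1 : (1 < 2 ^ b)%N. Proof. by rewrite -(expn0 2) ltn_exp2l. Qed.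
Let mb : (m < 2 ^ b)%N. Proof. by have [_ []] := fit. Qed.
Let NSb : (NS < 2 ^ b)%N. Proof. by have [_ []] := fit. Qed.
Let Nb : (q * N < 2 ^ b)%N. Proof. by have [_ []] := fit. Qed.
Let Xb : (X < 2 ^ b)%N. Proof. by have [_ []] := fit. Qed.
Let qXb : (q ^ X < 2 ^ b)%N. Proof. by have [_ []] := fit. Qed.

Definition geom (s : memory) : Prop :=
  [/\ s 0 = n%:Z, s 1%:Z = j%:Z, s 3%:Z = c%:Z, s 4%:Z = m%:Z &
      s 5%:Z = (kap O n c)%:Z /\ s 6%:Z = (nrim d c)%:Z].

Lemma runs_geometry s : bounded b s -> s 0 = n%:Z -> s 1%:Z = j.-1%:Z ->
  runs O b s geometry_part NS.+1 geom.
Proof.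
move=> bs s0 s1.
have jc : (j <= c)%N by rewrite /center; nia.
apply: (runs_seq (Q1 := fun s' => s' = update s 1%:Z j%:Z)).
  apply: (runs_set (v := j)) => //.
    by have -> : j%:Z = (j.-1 + 1)%N%:Z; [lia|apply: ev_Add].
  by apply: leq_ltn_trans mb; apply: leq_trans jc (ltnW cm).
move=> s1' bs1 ?; subst s1'; set s1' := update _ _ _ in bs1 *.
apply: (runs_seq (Q1 := fun s' => s' = update s1' 3%:Z c%:Z)).
  apply: (runs_set (v := c)) => //.
  - apply: ev_Add; first by rewrite /= /s1' updE.
    apply: ev_Add => //; apply: ev_Mul; first by rewrite /= /s1' updE.
    apply: ev_Add => //; apply: ev_pow.
    by rewrite /= /s1' updE.
  - do 3 (apply: ask_Bin => //); apply: ask_Bin => //; apply: ask_pow; exact: ask_V.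
  by apply: leq_ltn_trans mb; exact: ltnW.
move=> s2 bs2 ?; subst s2; set s2 := update _ _ _ in bs2 *.
apply: (runs_seq (Q1 := fun s' => s' = update s2 4%:Z m%:Z)).
  apply: (runs_set (v := m)) => //.
  have -> : m%:Z = (2 * c + 1)%N%:Z by lia.
  apply: ev_Add => //; apply: ev_Mul => //.
move=> s3 bs3 ?; subst s3; set s3 := update _ _ _ in bs3 *.
apply: (runs_seq (Q1 := fun s' => s' = update s3 5%:Z 0)).
  by apply: (runs_set (v := 0)) => //; rewrite expn_gt0.
move=> s4 bs4 ?; subst s4; set s4 := update _ _ _ in bs4 *.
apply: (runs_seq (Q1 := fun s' => s' = update s4 6%:Z 0)).
  by apply: (runs_set (v := 0)) => //; rewrite expn_gt0.
move=> s5 bs5 ?; subst s5; set s5 := update _ _ _ in bs5 *.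
pose I k s' := [/\ [/\ s' 0 = n%:Z, s' 1%:Z = j%:Z, s' 3%:Z = c%:Z & s' 4%:Z = m%:Z],
  s' 28%:Z = k%:Z, s' 5%:Z = (cnt (fun k => isK O n c (NS - k.+1)) k)%:Z &
  s' 6%:Z = (cnt (fun k => rim d c (NS - k.+1)) k)%:Z].
have cntb P k : (k <= NS)%N -> (cnt P k < 2 ^ b)%N.
  by move=> kN; apply: leq_ltn_trans NSb; apply: leq_trans (cnt_le _ _) kN.
apply: (@runs_mono _ _ _ _ _ _ NS.+1 _ (I NS)) => //; last first.
  by move=> s' _ [[? ? ? ?] _ ? ?].
apply: (@runs_for _ _ _ _ _ _ _ _ 1 _ NS) => //.
- by rewrite mul1n.
- move=> k s' [[_ _ _ ?] ? _ _]; split => //; first exact: ev_MD.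
  by apply: ask_pow; exact: ask_V.
move=> k s' kN bs' [[e0 e1 e3 e4] e28 e5 e6].
have site st : st 4%:Z = m%:Z -> st 28%:Z = k%:Z ->
    Defs.eval O st Esite = (NS - k.+1)%N%:Z.
  move=> st4 st28; rewrite -[k.+1]addn1; apply: ev_Sub; [exact: ev_MD| |lia].
  by apply: ev_Add.
have asite st : ask_bounded O b st Esite.
  by apply: ask_Bin; [apply: ask_pow|apply: ask_Bin]; do ?[exact: ask_C|exact: ask_V].
pose k5 := cnt (fun k => isK O n c (NS - k.+1)) k.+1.
pose k6 := cnt (fun k => rim d c (NS - k.+1)) k.+1.
apply: (runs_seq (Q1 := fun s1 => s1 = update s' 5%:Z k5%:Z)).
  apply: (runs_set (v := k5)) => //.
  - have -> : k5 = (cnt (fun k => isK O n c (NS - k.+1)) k + isK O n c (NS - k.+1))%N.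
      exact: cntS.
    by apply: ev_Add; [exact: e5|apply: ev_isK => //; exact: site].
  - by apply: ask_Bin; [exact: ask_V|exact: ask_isK].
  - exact: cntb.
move=> s6 bs6 ?; subst s6.
apply: (runs_set (v := k6)) => //.
- have -> : k6 = (cnt (fun k => rim d c (NS - k.+1)) k + rim d c (NS - k.+1))%N.
    exact: cntS.
  apply: ev_Add; first by rewrite /= updE.
  by apply: ev_rim; rewrite ?updE //; apply: site; rewrite updE.
- by apply: ask_Bin; [exact: ask_V|exact: ask_rim].
- exact: cntb.
Qed.

Lemma ev_expN s : geom s -> Defs.eval O s EexpN = (expN O n c)%:Z.
Proof.
move=> [s0 _ _ _ [s5 _]]; apply: ev_Add; first exact: ev_Mul.
by apply: ev_Add => //; apply: ev_Mul => //; exact: ev_pow.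
Qed.

Lemma ev_expX s : geom s -> Defs.eval O s EexpX = X%:Z.
Proof.
move=> g; have [_ _ _ s4 _] := g.
apply: ev_Add; last exact: ev_expN.
by apply: ev_Mul => //; exact: ev_MR.
Qed.

Lemma geom_frame s s' vs ts : frame vs ts s s' ->
  all [pred k | k \notin vs] [:: 0; 1; 3; 4; 5; 6]%N -> geom s -> geom s'.
Proof.
move=> [h _] /and5P[v0 v1 v3 v4 /and3P[v5 v6 _]] [e0 e1 e3 e4 [e5 e6]].
by rewrite /geom (h _ v0) !h.
Qed.

Lemma runs_table s : bounded b s -> geom s ->
  runs O b s table_part (X.+1 + (q * N).+1) (fun s' => geom s' /\ ctx O n c s').
Proof.
move=> bs g; set K := (_ + _)%N.
have [_ [_ _ _ _ _] [R_X rim_X] _ _] := fit.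
have K0 : (0 < K)%N by [].
have R0b : (0 < 2 ^ b)%N by rewrite expn_gt0.
have pX e : (e <= X)%N -> (q ^ e < 2 ^ b)%N.
  by move=> eX; apply: leq_ltn_trans qXb; rewrite leq_pexp2l ?card_gt0.
have ask0 s' : ask_bounded O b s' ER0 by apply: ask_pow; exact: ask_V.
have askMR s' : ask_bounded O b s' (EMR d A) by apply: ask_pow; exact: ask_V.
have askN s' : ask_bounded O b s' EexpN.
  by have := ask0 s' => ?; rewrite /EexpN; do !(apply: ask_Bin => //).
have askX s' : ask_bounded O b s' EexpX by do !(apply: ask_Bin => //).
apply: (runs_seq (Q1 := fun s' => s' = update s (arr 0 0) 1)).
  by apply: (@runs_setA _ _ _ _ _ _ _ _ 0 _ 1).
move=> s1 bs1 E1.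
pose I k s' := [/\ frame [:: 28]%N [:: 0%N] s s', s' 28%:Z = k%:Z &
   forall e, (e <= k)%N -> s' (arr 0 e) = (q ^ e)%N%:Z].
have XK : (X.+1 <= K)%N by rewrite leq_addr.
apply: (runs_seq (Q1 := I X)).
  apply: (@runs_for _ _ _ _ _ _ _ _ 1 _ X) => //.
  - by rewrite mul1n.
  - move=> k s' [fr ? _]; split => //; first exact/ev_expX/(geom_frame fr).
  - split; first by rewrite E1; apply: frame_V => //; exact: frame_A.
      by rewrite updE.
    by case=> // _; rewrite updE E1 upd_AA.
  - move=> k s' kX bs' [fr s'28 old].
    have pk : (q ^ k.+1 < 2 ^ b)%N by exact: pX.
    apply: (@runs_setA _ _ _ _ _ _ _ _ k.+1 _ (q ^ k.+1)) => //.
    + by rewrite -[k.+1]addn1; apply: ev_Add.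
    + rewrite expnSr; apply: ev_Mul => //.
      by apply: (@ev_VA _ _ _ _ _ (V 28) _ _ s'28); exact: old.
    split; first by rewrite updE.
    split; first by apply: frame_V => //; exact: frame_A.
      by rewrite updE.
    move=> e; rewrite leq_eqVlt updE upd_AA // eqxx /= => /orP[/eqP ->|ek].
      by rewrite eqxx.
    by rewrite ltn_eqF // old.
move=> s2 bs2 [fr2 _ PW].
have g2 := geom_frame fr2 isT g; have [e0 _ _ e4 [e5 e6]] := g2.
have expNX : (expN O n c <= X)%N by rewrite leq_addl.
have kapX : (kap O n c <= X)%N.
  by apply: leq_trans expNX; rewrite /expN; lia.
apply: (runs_seq (Q1 := fun s' => s' = update s2 7%:Z (q ^ R)%N%:Z)).
  apply: (runs_set (v := q ^ R)) => //; last exact: pX.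
  by apply: ev_VA (ev_MR _ e4) _; exact: PW.
move=> s3 bs3 ?; subst s3; set s3 := update _ _ _ in bs3 *.
have g3 : geom s3 by apply: (geom_frame (frame_V _ (frame_refl [:: 7%N] [::] _) _)).
apply: (runs_seq (Q1 := fun s' => s' = update s3 8%:Z N%:Z)).
  apply: (runs_set (v := N)) => //; last exact: pX.
  by apply: ev_VA (ev_expN g3) _; rewrite /s3 updE; exact: PW.
move=> s4 bs4 ?; subst s4; set s4 := update _ _ _ in bs4 *.
have g4 : geom s4 by apply: (geom_frame (frame_V _ (frame_refl [:: 8%N] [::] _) _)).
apply: (runs_seq (Q1 := fun s' => s' = update s4 9%:Z (q ^ kap O n c)%N%:Z)).
  apply: (runs_set (v := q ^ kap O n c)) => //; last exact: pX.
  have [_ _ _ _ [g5 _]] := g4.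
  apply: (@ev_VA _ _ _ _ _ (V 5) _ _ g5).
  by rewrite /s4 updE /s3 updE; exact: PW.
move=> s5 bs5 ?; subst s5; set s5 := update _ _ _ in bs5 *.
have g5 : geom s5 by apply: (geom_frame (frame_V _ (frame_refl [:: 9%N] [::] _) _)).
apply: (runs_seq (Q1 := fun s' => s' = update s5 10%:Z (q ^ nrim d c)%N%:Z)).
  apply: (runs_set (v := q ^ nrim d c)) => //; last exact: pX.
  have [_ _ _ _ [_ g6]] := g5.
  apply: (@ev_VA _ _ _ _ _ (V 6) _ _ g6).
  by rewrite /s5 updE /s4 updE /s3 updE; exact: PW.
move=> s6 bs6 ?; subst s6; set s6 := update _ _ _ in bs6 *.
have g6 : geom s6 by apply: (geom_frame (frame_V _ (frame_refl [:: 10%N] [::] _) _)).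
apply: (runs_seq (Q1 := fun s' => s' = update s6 (arr 2 0) 0)).
  by apply: (@runs_setA _ _ _ _ _ _ _ _ 0 _ 0).
move=> s7 bs7 E7.
pose I2 k s' := [/\ frame [:: 28]%N [:: 2%N] s6 s', s' 28%:Z = k%:Z &
   forall e, (e <= k)%N -> s' (arr 2 e) = (harm O n c e)%:Z].
have s6_8 : s6 8%:Z = N%:Z by rewrite /s6 updE /= /s5 updE /= /s4 updE.
apply: (@runs_mono _ _ _ _ _ _ (q * N).+1 _ (I2 (q * N)%N)) => //; first last.
- move=> s' bs' [fr s'28 hT].
  have g' := geom_frame fr isT g6; split => //.
  have [k0 k1 k3 k4 _] := g'; have [h1 h2] := fr.
  split; [split| split| |] => //.
  + by rewrite h1 // /s6 updE /= /s5 updE /= /s4 updE /= /s3 updE.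
  + by rewrite h1.
  + by rewrite h1 // /s6 updE /= /s5 updE.
  + by rewrite h1 // /s6 updE.
  + move=> e eX; rewrite h2 // /s6 updE /s5 updE /s4 updE /s3 updE; exact: PW.
- by rewrite leq_addl.
have harm_b e : (e <= q * N)%N -> (harm O n c e < 2 ^ b)%N.
  move=> eN; have [_ _ _ _ Hb] := fit.
  apply: leq_ltn_trans Hb; apply: leq_trans (leq_harm _ _ _ eN) _.
  apply: leq_trans (leq_addr _ _); rewrite mulnA leq_pmull //.
  by rewrite !muln_gt0 !expn_gt0 card_gt0.
apply: (@runs_for _ _ _ _ _ _ _ _ 1 _ (q * N)) => //.
- by rewrite mul1n.
- move=> k s' [[h1 _] ? _]; split => //.
  by apply: ev_Mul => //; rewrite /= h1.
- split; first by rewrite E7; apply: frame_V => //; exact: frame_A.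
    by rewrite updE.
  by case=> // _; rewrite updE E7 upd_AA // /harm big_ord0.
- move=> k s' kX bs' [fr s'28 old].
  have s'8 : s' 8%:Z = N%:Z by case: fr => h1 _; rewrite h1.
  apply: (@runs_setA _ _ _ _ _ _ _ _ k.+1 _ (harm O n c k.+1)) => //.
  + by rewrite -[k.+1]addn1; apply: ev_Add.
  + rewrite harmS; apply: ev_Add.
      by apply: (@ev_VA _ _ _ _ _ (V 28) _ _ s'28); exact: old.
    by apply: ev_Div; [apply: ev_Mul|apply: ev_Add].
  + exact: harm_b.
  split; first by rewrite updE.
  split; first by apply: frame_V => //; exact: frame_A.
    by rewrite updE.
  move=> e; rewrite leq_eqVlt updE upd_AA // eqxx /= => /orP[/eqP ->|ek].
    by rewrite eqxx.
  by rewrite ltn_eqF // old.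
Qed.

Lemma ev_precise s : geom s -> s 8%:Z = N%:Z ->
  Defs.eval O s Eprecise = (precise supp O n c : nat)%:Z.
Proof.
move=> [_ _ _ s4 _] s8; have [[g0 bt0 _ _] _ _ _ _] := fit.
have et : Defs.eval O s Ethr = (thr O n c)%:Z.
  by apply: ev_Mul => //; apply: ev_Mul => //; exact: ev_MD.
have eL e (x : int) : Defs.eval O s e = x -> 0 <= x ->
    Defs.eval O s (Bin Leq Ethr e) = (thr O n c <= `|x| : nat)%N%:Z.
  by move=> ex x0; apply: ev_Leq => //; rewrite ex gez0_abs.
apply: ev_and.
  rewrite -prod_nat_of_bool; apply: ev_prod => x; apply: eL => //.
  by rewrite /= s4.
rewrite -prod_nat_of_bool; apply: ev_prod => i.
rewrite -prod_nat_of_bool; apply: ev_prod => y.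
rewrite -prod_nat_of_bool; apply: ev_prod => x.
case: ifP => h //; rewrite implyTb; apply: eL; last exact: bt0.
by rewrite /= s4.
Qed.

Definition body_post (s : memory) : Prop :=
  [/\ geom s, ctx O n c s,
      s 2%:Z = (precise supp O n c && all_good supp O n c (q ^ kap O n c) : nat)%:Z,
      s 11%:Z = (Hplus supp O n c (q ^ kap O n c))%:Z &
      s 29%:Z = (Hminus supp O n c (q ^ kap O n c))%:Z].

Lemma runs_body s : bounded b s -> s 0 = n%:Z -> s 1%:Z = j.-1%:Z ->
  runs O b s body (kbody c) body_post.
Proof.
move=> bs s0 s1.
have [[g0 bt0 gb btb] [_ _ _ _ _] [R_X rim_X] zb Hb] := fit.
have K0 : (0 < kbody c)%N by rewrite /kbody addnS.
apply: (runs_seq (Q1 := geom)).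
  apply: runs_mono (runs_geometry bs s0 s1) _ _ => //.
  by rewrite /kbody -!addnA; apply: leq_trans (leq_addl _ _); rewrite leq_addr.
move=> s2 bs2 g2.
apply: (runs_seq (Q1 := fun s' => geom s' /\ ctx O n c s')).
  apply: runs_mono (runs_table bs2 g2) _ _ => //.
  by rewrite /kbody -addnA leq_addl.
move=> s3 bs3 [g3 cx3]; have [_ [s3_8 _ _] _ _] := cx3.
apply: (runs_seq
  (Q1 := fun s' => s' = update s3 2%:Z (precise supp O n c : nat)%:Z)).
  apply: (runs_set (v := precise supp O n c : nat)) => //.
  - exact: ev_precise.
  - have [_ _ _ s3_4 _] := g3.
    have at_ : ask_bounded O b s3 Ethr.
      by do !(apply: ask_Bin => //); apply: ask_pow; exact: ask_V.
    apply: ask_Bin.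
      apply: ask_prod => x; apply: ask_Bin => //.
      by split; [exact: ask_V|rewrite /= s3_4].
    do 3 apply: ask_prod => ?; case: ifP => h; last exact: ask_C.
    apply: ask_Bin => //; split; first exact: ask_V.
    by rewrite /= s3_4; exact: btb.
  - by case: (precise _ _ _ _); rewrite ?expn_gt0.
move=> s4 bs4 E4.
apply: (runs_seq (Q1 := fun s' => s' = update s4 11%:Z 0)).
  by apply: (runs_set (v := 0)) => //; rewrite expn_gt0.
move=> s5 bs5 E5.
apply: (runs_seq (Q1 := fun s' => s' = update s5 29%:Z 0)).
  by apply: (runs_set (v := 0)) => //; rewrite expn_gt0.
move=> s6 bs6 E6.
have f6 : frame [:: 2; 11; 29]%N [::] s3 s6.
  by rewrite E6 E5 E4; do 3 apply: frame_V => //.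
have cx6 := ctx_frame f6 isT isT cx3; have g6 := geom_frame f6 isT g3.
apply: (@runs_mono _ _ _ _ _ _ (kbody c) _
  (Winv supp O n c (precise supp O n c) s6 (q ^ kap O n c))) => //; last first.
  move=> s' bs' [fr s'12 s'11 s'29 s'2]; split => //.
    exact: geom_frame fr isT g6.
  exact: ctx_frame fr isT isT cx6.
have Hb' : (q ^ kap O n c * (q * N * harm O n c (q * N)) < 2 ^ b)%N.
  by apply: leq_ltn_trans Hb; rewrite leq_addr.
apply: (@runs_for _ _ _ _ _ _ _ _
  ((q ^ R).+1 * NS.+1 * (q ^ nrim d c).+1 * q.+1) _ (q ^ kap O n c)) => //.
- apply: leq_ltn_trans Hb'; rewrite leq_pmulr // !muln_gt0 card_gt0 expn_gt0 card_gt0 /=.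
  rewrite /harm; have : (0 < q * N)%N by rewrite muln_gt0 expn_gt0 card_gt0.
  case: (q * N)%N => // x _; rewrite big_ord_recl divn1.
  by rewrite addn_gt0 muln_gt0 expn_gt0 card_gt0.
- by rewrite /kbody -!addnA leq_addr.
- move=> k s' [fr s'12 _ _ _]; split => //.
  by have [_ [_ ? _] _ _] := ctx_frame fr isT isT cx6.
- rewrite /Winv /Hplus /Hminus /all_good !big_ord0 andbT updE; split => //.
  + exact: frame_V.
  + by rewrite updE E6 updE /= E5 updE.
  + by rewrite updE E6 updE.
  + by rewrite updE E6 updE /= E5 updE /= E4 updE.
- move=> k s' kW bs' inv; exact: runs_Wbody.
Qed.

End AtCenter.

Definition stops (j : nat) : bool :=
  precise supp O n (center j) &&
  all_good supp O n (center j) (q ^ kap O n (center j)).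

Definition numer (c : nat) : int :=
  (Hplus supp O n c (q ^ kap O n c))%:Z - (Hminus supp O n c (q ^ kap O n c))%:Z.

(** Divided by N^3 this is q^-(2n^(d-1)+1). As q ≥ 2 and e ≤ 4, twice this is at most
    exp(-n^(d-1)). *)
Definition margin (c : nat) : nat :=
  (bigN O n c * bigN O n c * bigN O n c %/ q ^ (2 * n ^ d.-1 + 1))%N.

Definition outputs (j : nat) (s : memory) : Prop :=
  let c := center j in
  [/\ s 0 = numer c - (margin c)%:Z, s 1 = numer c + (margin c)%:Z &
      s 2 = (bigN O n c * bigN O n c * bigN O n c)%N%:Z].

Lemma runs_output j s k : (0 < k)%N -> fits (center j) -> bounded b s -> body_post j s ->
  runs O b s output_part k (outputs j).
Proof.
move=> k0 fit bs [g [_ [s8 _ _] PW _] _ s11 s29].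
have [s0 _ _ _ _] := g.
have [_ _ _ _ Hb] := fit.
set c := center j in fit PW s8 s11 s29 g Hb *; set N := bigN O n c in s8 Hb *.
have EC : Defs.eval O s (VA 0 (Bin Add (Bin Mul (C 2) ER0) (C 1))) =
    (q ^ (2 * n ^ d.-1 + 1))%N%:Z.
  apply: (@ev_VA _ _ _ _ _ _ (2 * n ^ d.-1 + 1)).
    by apply: ev_Add => //; apply: ev_Mul => //; exact: ev_pow.
  by apply: PW; rewrite /expX /expN; clear; lia.
have ME : (margin c <= N * N * N)%N by exact: leq_div.
have hp := Hplus_le supp O n c (q ^ kap O n c).
have hm := Hminus_le supp O n c (q ^ kap O n c).
have B (z : int) : (`|z| <= `|numer c| + margin c)%N -> (`|z| < 2 ^ b)%N.
  move=> h; apply: leq_ltn_trans Hb; apply: leq_trans h _; apply: leq_add => //.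
  rewrite /numer -/N in hp hm *; move: hp hm; clear.
  by move: (_ ^ _ * _)%N (Hplus _ _ _ _ _) (Hminus _ _ _ _ _) => x y z; lia.
apply: (runs_seq (Q1 := fun s' => s' = update s 30%:Z (margin c)%:Z)).
  apply: (runs_set (v := margin c)) => //.
  - by apply: ev_Div => //; apply: ev_Mul => //; apply: ev_Mul.
  - by do !split => //; apply: ask_pow; exact: ask_V.
  - by have := B (margin c) (leq_addl _ _).
move=> s1 bs1 ?; subst s1; set s1 := update _ _ _ in bs1 *.
apply: (runs_seq
  (Q1 := fun s' => s' = update s1 0%:Z (numer c - (margin c)%:Z))).
  apply: runs_store => //; rewrite /= /s1 !updE /= s11 s29 //.
  by apply: B; rewrite /numer; move: (Hplus _ _ _ _ _) (Hminus _ _ _ _ _) (margin _); clear=> x y z; lia.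
move=> s2 bs2 ?; subst s2; set s2 := update _ _ _ in bs2 *.
apply: (runs_seq
  (Q1 := fun s' => s' = update s2 1%:Z (numer c + (margin c)%:Z))).
  apply: runs_store => //; rewrite /= /s2 !updE /= /s1 !updE /= s11 s29 //.
  by apply: B; rewrite /numer; move: (Hplus _ _ _ _ _) (Hminus _ _ _ _ _) (margin _); clear=> x y z; lia.
move=> s3 bs3 ?; subst s3; set s3 := update _ _ _ in bs3 *.
have e8 : s3 8%:Z = N%:Z by rewrite /s3 updE /= /s2 updE /= /s1 updE.
apply: (runs_set (v := N * N * N)) => //.
- by apply: ev_Mul => //; apply: ev_Mul.
- by apply: leq_ltn_trans Hb; rewrite leq_addl.
Qed.

(** [J] occurs in the analysis only. The loop may stop at an earlier round, and any round that
    passes the test is certified by it. *)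
Lemma runs_program J k : (0 < J)%N ->
  (forall j, (0 < j <= J)%N -> fits (center j)) ->
  (forall j, (0 < j <= J)%N -> (kbody (center j) <= k)%N) -> stops J ->
  runs O b (input n) program (k * J.+1)
    (fun s => exists j, [/\ (0 < j <= J)%N, stops j & outputs j s]).
Proof.
move=> J0 fit kk stJ.
have k0 : (0 < k)%N by apply: leq_trans (kk J _); rewrite ?J0 ?leqnn // /kbody addnS.
have bin : bounded b (input n).
  by move=> a; rewrite /input /update; case: ifP => // _; rewrite expn_gt0.
pose I i s := [/\ (i <= J)%N, s 0 = n%:Z, s 1 = i%:Z, (i = 0%N -> s 2 = 0) &
  ((0 < i)%N -> body_post i s)].
apply: (runs_seq (Q1 := fun s =>
  Defs.eval O s (Bin Eq (V 2) (C 0)) = 0 /\ exists i, I i s)).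
  apply: (@runs_while _ _ _ _ _ _ _ _ J I) => //.
  move=> i s bs [iJ s0 s1 s2 bp]; split => // c0.
  have s20 : s 2%:Z = 0.
    by apply/eqP; apply: contraNT c0 => /negbTE /= ->.
  have iltJ : (i < J)%N.
    rewrite ltn_neqAle iJ andbT; apply/eqP => E; subst i.
    by have [_ _ + _ _] := bp J0; rewrite s20 -/(stops J) stJ.
  split => //; apply: runs_mono (runs_body (j := i.+1) _ _ bs s0 s1) _ _ => //.
  - exact: fit.
  - exact: kk.
  - by move=> s' bs' [g ? ? ? ?]; have [? ? _ _ _] := g; split.
move=> s bs [c0 [i [iJ s0 s1 s2 bp]]].
have s20 : s 2%:Z != 0 by apply/eqP => E; move: c0; rewrite /= E.
have i0 : (0 < i)%N by rewrite lt0n; apply: contraNneq s20 => /s2 ->.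
apply: runs_mono (runs_output k0 (fit i _) bs (bp i0)) _ _; rewrite ?i0 //.
  by rewrite leq_pmulr.
move=> s' bs' out; exists i; split; rewrite ?i0 //.
have [_ _ s2' _ _] := bp i0.
by move: s20; rewrite s2' -/(stops i); case: (stops i).
Qed.

End Whole.

(** * Boxes of the lattice *)

Lemma rowP0 (T : Type) (d : nat) (u v : 'rV[T]_d) :
  u = v <-> forall i, u ord0 i = v ord0 i.
Proof. by split=> [->//|h]; apply/rowP => i; exact: h. Qed.

Section Cube.
Variables (d c : nat).
Hypothesis c0 : (0 < c)%N.
Notation m := c.*2.+1.
Notation NS := (m ^ d)%N.
Notation point_ := 'rV[int]_d.

Definition inner : {fset point_} := fset_set [set v : point_ | in_box c.-1 v].

Lemma in_inner v : (v \in inner) = in_box c.-1 v.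
Proof.
rewrite /inner in_fset_set; last exact: finite_box.
by apply/idP/idP => [/set_mem //|h]; exact/mem_set.
Qed.

Lemma vtx_box p : in_box c (vtx d c p).
Proof.
apply/forallP => i; rewrite mxE.
by have := @digit_lt m i p isT; lia.
Qed.

Lemma vtx_inj p p' : (p < NS)%N -> (p' < NS)%N -> vtx d c p = vtx d c p' -> p = p'.
Proof.
move=> pN pN' /rowP0 E; apply: (digit_inj pN pN') => i id.
by have := E (Ordinal id); rewrite !mxE /=; lia.
Qed.

Lemma vtx_surj (v : point_) : in_box c v -> exists p : 'I_NS, vtx d c p = v.
Proof.
move=> /forallP vc.
pose t k := if insub k is Some i then `|(v ord0 i + c%:Z)%R|%N else 0%N.
have [k kd|p pN E] := @digit_exists m d t.
  by rewrite /t; case: insubP => // i _ _; have := vc i; lia.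
exists (Ordinal pN); apply/rowP0 => i; rewrite mxE /= E //.
by rewrite /t valK; have := vc i; lia.
Qed.

Definition ext (v : point_) : nat := (\sum_(i < d) (`|v ord0 i|%N == c))%N.

Lemma extremes_ext p : extremes d c p = ext (vtx d c p).
Proof.
apply: eq_bigr => i _; rewrite mxE; have := @digit_lt m i p isT; lia.
Qed.

Lemma inner_ext v : in_box c v -> (v \in inner) = (ext v == 0%N).
Proof.
move=> /forallP vc; rewrite in_inner sum_nat_eq0; apply/forallP/forallP => h i.
  by rewrite implyTb eqb0; have := h i; lia.
by have := h i; rewrite implyTb eqb0; have := vc i; lia.
Qed.

Lemma rim_box v : v \in boundary inner -> in_box c v.
Proof.
rewrite in_boundary => /andP[_ /existsP[u /eqP uv]]; apply/forallP => i.
have : val u \in inner := fsvalP u; rewrite in_inner => /forallP/(_ i).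
have : (`|((val u) ord0 i - v ord0 i)%R|%N <= l1dist (val u) v)%N.
  by rewrite /l1dist (bigD1 i) //= leq_addr.
rewrite uv; move: (val u ord0 i : int) (v ord0 i : int) => x y; lia.
Qed.

(** A single extreme coordinate is repaired by one step towards 0; two of them cannot be repaired by
    one step, since each contributes to the distance from the inner box. *)
Lemma rim_ext v : in_box c v -> (v \in boundary inner) = (ext v == 1%N).
Proof.
move=> vc; rewrite in_boundary inner_ext //; apply/andP/eqP => [[e0 /existsP[u /eqP uv]]|e1].
  have : (ext v <= l1dist (val u) v)%N.
    apply: leq_sum => i _; have : val u \in inner := fsvalP u; rewrite in_inner => /forallP/(_ i).
    lia.
  by rewrite uv; lia.
split; first by rewrite e1.
have [i vi] : exists i, `|v ord0 i|%N == c.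
  apply/existsP; apply: contra_eqT e1; rewrite negb_exists => /forallP h.
  by rewrite /ext big1 // => i _; rewrite (negbTE (h i)).
have vj j : j != i -> `|v ord0 j|%N != c.
  move=> ji; apply/negP => vj; move: e1.
  by rewrite /ext (bigD1 i) // (bigD1 j) //= vi vj.
(* The neighbour of [v] one step closer to 0 in the extreme coordinate. *)
pose u : point_ := \row_j (if j == i then v ord0 j - sgz (v ord0 j) else v ord0 j).
have uV : u \in inner.
  rewrite in_inner; apply/forallP => j; rewrite mxE.
  case: eqP => [->|/eqP /vj]; last by move/forallP: vc => /(_ j); lia.
  by move: vi; case: (v ord0 i) => x /eqP <-; case: sgzP; lia.
apply/existsP; exists [` uV] => /=; apply/eqP.
rewrite /l1dist (bigD1 i) //= big1 => [|j /negbTE ji]; last by rewrite mxE ji subrr.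
rewrite mxE eqxx addn0; move: vi c0; case: (v ord0 i) => x /eqP <- x0.
  by case: sgzP x0 => //; lia.
by case: sgzP => //; lia.
Qed.

Lemma reg_region p : reg d c p = (vtx d c p \in inner `|` boundary inner).
Proof.
rewrite in_fsetU inner_ext ?vtx_box // rim_ext ?vtx_box // -extremes_ext /reg.
by case: (extremes d c p) => [|[]].
Qed.

Lemma rim_boundary p : rim d c p = (vtx d c p \in boundary inner).
Proof. by rewrite rim_ext ?vtx_box // -extremes_ext. Qed.

Lemma ctr_eq0 p : ctr d c p = (vtx d c p == 0).
Proof.
apply/forallP/eqP => [h|/rowP0 h i].
  by apply/rowP0 => i; rewrite !mxE (eqP (h i)) subrr.
by have := h i; rewrite !mxE; lia.
Qed.

Lemma pow_le_pred p (i : 'I_d) : (1 <= digit m i p)%N -> (m ^ i <= p)%N.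
Proof. by apply: contraTT; rewrite -ltnNge => h; rewrite /digit divn_small. Qed.

(** A positive digit makes the subtraction of [m ^ i] free of borrows, so that only digit [i]
    changes. *)
Lemma vtx_pred p (i : 'I_d) : (1 <= digit m i p)%N ->
  vtx d c (p - m ^ i) = vtx d c p - unit_vec i.
Proof.
move=> dp; have ip := pow_le_pred dp.
have pi0 : (0 < m ^ i)%N by rewrite expn_gt0.
set x := (p %/ m ^ i)%N; set r := (p %% m ^ i)%N.
have pE : p = (x * m ^ i + r)%N by exact: divn_eq.
have dx : (1 <= x %% m)%N by exact: dp.
have pE' : (p - m ^ i = x.-1 * m ^ i + r)%N.
  by rewrite pE; case: (x) dx => [|y _]; [rewrite mod0n|rewrite /= mulSn; lia].
have rlt : (r < m ^ i)%N by rewrite ltn_mod.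
have xE : x.-1 = (x %/ m * m + (x %% m).-1)%N.
  by rewrite {1}(divn_eq x m); case: (x %% m)%N dx => // y _; rewrite addnS.
have xm : ((x %% m).-1 < m)%N by have := ltn_pmod x (isT : (0 < m)%N); lia.
have H1 : (x.-1 %% m = (x %% m).-1)%N by rewrite {1}xE modnMDl modn_small.
have H2 : (x.-1 %/ m = x %/ m)%N by rewrite {1}xE divnMDl // (divn_small xm) addn0.
apply/rowP0 => k; rewrite !mxE eqxx /=.
suff -> : digit m k (p - m ^ i) = (digit m k p - (k == i))%N.
  case: eqP => [->|_]; last by rewrite subn0 subr0.
  have aux (a e : nat) : (1 <= a)%N -> (a - true)%N%:Z - e%:Z = a%:Z - e%:Z - 1.
    by clear; lia.
  exact: aux.
have [ki|ik] := ltnP k i.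
  have kni : (k == i) = false by apply/negbTE; rewrite -val_eqE /= ltn_eqF.
  rewrite kni subn0 -(digit_mod m (p - m ^ i) ki) -(digit_mod m p ki) pE'.
  by rewrite modnMDl -/r (modn_small rlt).
have sh y : digit m k (y * m ^ i + r) = digit m (k - i) y.
  rewrite /digit -{1}(subnKC ik) expnD divnMA divnMDl // (divn_small rlt) addn0.
  by [].
rewrite pE' [in RHS]pE !sh.
have [ki|ki] := eqVneq k i; first by rewrite ki subnn !digit0E H1 subn1.
have : (0 < k - i)%N by rewrite subn_gt0 ltn_neqAle ik andbT eq_sym.
by case: (k - i)%N => // l _; rewrite !digitS H2 subn0.
Qed.

Lemma vtx_pred_out p (i : 'I_d) : (digit m i p < 1)%N ->
  ~~ in_box c (vtx d c p - unit_vec i).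
Proof.
move=> dp; apply/forallPn; exists i; rewrite !mxE !eqxx /=; lia.
Qed.

Definition site (v : point_) : option 'I_NS := [pick p : 'I_NS | vtx d c p == v].

Lemma site_vtx (p : 'I_NS) : site (vtx d c p) = Some p.
Proof.
rewrite /site; case: pickP => [p' /eqP E|/(_ p)]; last by rewrite eqxx.
by congr Some; apply/val_inj/(vtx_inj _ _ E).
Qed.

Lemma big_region (T : Type) (idx : T) (op : Monoid.com_law idx)
    (U : {fset point_}) (F : point_ -> T) : (forall v, v \in U -> in_box c v) ->
  \big[op/idx]_(v : U) F (val v) = \big[op/idx]_(p < NS | vtx d c p \in U) F (vtx d c p).
Proof.
move=> Uc.
have ex (u : U) : exists p : 'I_NS, vtx d c p == val u.
  by have [p E] := vtx_surj (Uc _ (fsvalP u)); exists p; apply/eqP.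
pose h (u : U) : 'I_NS := xchoose (ex u).
have hE u : vtx d c (h u) = val u by exact/eqP/(xchooseP (ex u)).
rewrite [RHS](@reindex_omap _ _ _ _ _ h (fun p => insub (vtx d c p))) => [|p pU].
  apply: eq_big => [u|u _]; last by rewrite hE.
  by rewrite hE valK eqxx (fsvalP u).
rewrite insubT /=; congr Some; apply/val_inj; apply: vtx_inj; [exact: ltn_ord|exact: ltn_ord|].
exact: hE.
Qed.

End Cube.

(** * The transfer matrix computes partition functions *)

(** Configurations on different shapes have different types; writing them as restrictions of
    functions on the whole lattice makes words, concatenations and restrictions comparable. *)
Definition conf (d : nat) (A : alphabetType) (U : {fset 'rV[int]_d})
  (w : 'rV[int]_d -> A) : cfg A U := [ffun u => w (val u)].

(* The value off the support is irrelevant. *)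
Definition extend (d : nat) (A : alphabetType) (U : {fset 'rV[int]_d})
  (w : cfg A U) (v : 'rV[int]_d) : A :=
  if insub v is Some u then w u else point.

Lemma extend_in d A (U : {fset 'rV[int]_d}) (w : @cfg d A U) u :
  extend w (val u) = w u.
Proof. by rewrite /extend valK. Qed.

Lemma conf_extend d A (U : {fset 'rV[int]_d}) (w : @cfg d A U) :
  conf U (extend w) = w.
Proof. by apply/ffunP => u; rewrite ffunE extend_in. Qed.

Lemma extend_conf d (A : alphabetType) (U : {fset 'rV[int]_d}) (w : 'rV[int]_d -> A) v :
  v \in U -> extend (conf U w) v = w v.
Proof. by move=> vU; rewrite -[v]/(val [` vU]) extend_in ffunE. Qed.

Lemma concat_extend d A (S T : {fset 'rV[int]_d}) (w : @cfg d A S) (x : cfg A T) :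
  [disjoint S & T] ->
  concat w x =
  conf (S `|` T) (fun v => if v \in S then extend w v else extend x v).
Proof.
move=> ST; apply/ffunP => u; rewrite !ffunE; case: fsetULVR => h.
  by rewrite h -[X in extend w X]/(val [` h]) extend_in.
rewrite -[X in extend x X]/(val [` h]) extend_in ifF //.
by apply/negbTE; apply: contraTN h => h; exact: (fdisjointP ST).
Qed.

Section InteractionProduct.
Variables (R : realType) (d : nat) (A : alphabetType) (c : nat).
Hypothesis c0 : (0 < c)%N.
Notation m := c.*2.+1.
Notation NS := (m ^ d)%N.
Variables (gamma : A -> R) (beta : 'I_d -> A -> A -> R).

(** Every edge is listed at its upper end: that end and the direction determine the other end, so
    the product over pairs collapses to one over sites. *)
Lemma interaction_conf (U : {fset 'rV[int]_d}) (w : 'rV[int]_d -> A) :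
  (forall v, v \in U -> in_box c v) ->
  interaction gamma beta (conf U w) =
  \prod_(p < NS | vtx d c p \in U)
    (gamma (w (vtx d c p)) * \prod_(i < d)
       (if (1 <= digit m i p)%N && (vtx d c (p - m ^ i)%N \in U)
        then beta i (w (vtx d c (p - m ^ i)%N)) (w (vtx d c p)) else 1)).
Proof.
move=> Uc; rewrite /interaction big_split /=; congr (_ * _).
  rewrite -(big_region c0 _ (fun v => gamma (w v)) Uc).
  by apply: eq_bigr => u _; rewrite ffunE.
rewrite exchange_big /=; apply: eq_bigr => i _.
pose F v := if v - unit_vec i \in U then beta i (w (v - unit_vec i)) (w v) else 1.
transitivity (\prod_(v : U) F (val v)).
  rewrite big_mkcond /= -(pair_bigA _ (fun p1 p2 : U =>
    if val p2 == val p1 + unit_vec i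
    then beta i (conf U w p1) (conf U w p2) else 1)) /=.
  rewrite exchange_big /=; apply: eq_bigr => v _; rewrite -big_mkcond /F /=.
  case: ifP => [h|h].
    rewrite (big_pred1 [` h]) ?ffunE //= => u.
    by rewrite -subr_eq eq_sym -[RHS]val_eqE.
  rewrite big_pred0 // => u; apply/negP => /eqP E.
  by move: h; rewrite E addrK (fsvalP u).
rewrite (big_region c0 _ F Uc); apply: eq_bigr => p pU; rewrite /F.
have [dp|dp] := leqP 1 (digit m i p); first by rewrite vtx_pred.
rewrite /= ifF //; apply/negbTE; move: (vtx_pred_out c0 dp); apply: contra; exact: Uc.
Qed.

End InteractionProduct.

Lemma allowedE (A : alphabetType) (k : nat) (x : A) :
  allowed k x = ((k == #|A|) || (k == rank x)) :> nat.
Proof.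
rewrite /allowed; case: eqP => // ->.
by rewrite gtn_eqF ?rank_lt.
Qed.

Section PartitionFunction.
Variables (R : realType) (d : nat) (A : alphabetType) (supp : 'I_d -> rel A).
Variables (O : oracle d A) (n c : nat).
Hypotheses (d0 : (0 < d)%N) (c0 : (0 < c)%N).
Notation m := c.*2.+1.
Notation NS := (m ^ d)%N.
Notation q := #|A|.
Notation Vi := (inner d c).
Notation BV := (boundary Vi).
Notation K := (oracle_set O n).
Hypothesis KV : forall v, v \in K -> (v \in Vi) && (v != 0).

Definition rgam (x : A) : R := (gam O c x)%:R.
Definition rbet (i : 'I_d) (y x : A) : R := (bet supp O c i y x)%:R.

Lemma disjoint_rim : [disjoint Vi & BV].
Proof.
apply/fdisjointP => v vV; rewrite in_boundary vV //.
Qed.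

Lemma region_box v : v \in Vi `|` BV -> in_box c v.
Proof.
rewrite in_fsetU => /orP[|]; last exact: rim_box.
rewrite in_inner => /forallP h; apply/forallP => i; have := h i; lia.
Qed.

Lemma zero_inner : 0 \in Vi.
Proof. by rewrite in_inner; apply/forallP => i; rewrite mxE. Qed.

Lemma local_wt_local D W a free p (x : A) (f g : nat -> A) : (p < NS)%N ->
  (forall r, (0 < r <= m ^ d.-1)%N -> (r <= p)%N -> f r = g r) ->
  local_wt supp O n c D W a free p x f = local_wt supp O n c D W a free p x g.
Proof.
move=> pN fg; rewrite /local_wt /site_wt; case: ifP => // _.
congr (_ * (_ * _))%N; apply: eq_bigr => i _; case: ifP => // /andP[dp _].
rewrite fg ?expn_gt0 //; last exact: pow_le_pred.
by rewrite leq_pexp2l //; have := ltn_ord i; lia.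
Qed.

Variables (D W a : nat) (free : bool).
Variables (delta : cfg A BV) (tau : 'rV[int]_d -> A).
Hypothesis deltaE : forall p, (p < NS)%N -> vtx d c p \in BV ->
  extend delta (vtx d c p) = letter (digit q (later d c (rim d c) p) D).
Hypothesis tauE : forall p, (p < NS)%N -> vtx d c p \in K ->
  tau (vtx d c p) = letter (digit q (later d c (isK O n c) p) W).
Hypothesis tau0 : tau 0 = letter a.
Hypothesis aq : (a < q)%N.

Definition target (w : cfg A Vi) : bool :=
  free || [forall u : Vi, (val u \in 0 |` K) ==> (w u == tau (val u))].

Let glue (w : cfg A Vi) (v : 'rV[int]_d) : A :=
  if v \in Vi then extend w v else extend delta v.

Let respects (y : {ffun 'I_NS -> A}) : bool :=
  [forall p : 'I_NS, (forced O n c D W a free p == q) ||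
                     (forced O n c D W a free p == rank (y p))].

Let spread (w : cfg A Vi) : {ffun 'I_NS -> A} :=
  [ffun p : 'I_NS => if vtx d c p \in Vi `|` BV then glue w (vtx d c p) else letter 0].

Let read (y : {ffun 'I_NS -> A}) : cfg A Vi :=
  conf Vi (fun v => if site c v is Some p then y p else point).

Let site_wt_interaction w :
  (\prod_(p < NS) site_wt supp O c p (spread w p)
     (fun r => at_site (spread w) (p - r)))%N%:R =
  interaction rgam rbet (concat w delta).
Proof.
rewrite concat_extend ?disjoint_rim // (interaction_conf c0); last exact: region_box.
rewrite natr_prod [RHS]big_mkcond /=; apply: eq_bigr => p _.
rewrite /site_wt reg_region //; case: ifP => // pU.
rewrite natrM natr_prod /rgam ffunE pU; congr (_ * _).
apply: eq_bigr => i _.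
have [dp|//] := leqP 1 (digit m i p); rewrite reg_region //=.
have pN : (p - m ^ i < NS)%N by apply: leq_ltn_trans (ltn_ord p); exact: leq_subr.
case: ifP => // pU'; rewrite /rbet (at_site_lt _ pN) ffunE /= pU'.
by [].
Qed.

Let readK w : read (spread w) = w.
Proof.
apply/ffunP => u; rewrite ffunE.
have uc : in_box c (val u) by apply: region_box; rewrite in_fsetU (fsvalP u).
have [p pE] := vtx_surj c0 uc.
rewrite -{1}pE (site_vtx c0) ffunE pE in_fsetU (fsvalP u) /= /glue (fsvalP u).
exact: extend_in.
Qed.

Lemma forced_corner p : vtx d c p \notin Vi `|` BV ->
  forced O n c D W a free p = 0%N.
Proof. by rewrite /forced reg_region // => ->. Qed.

Lemma forced_rim p : vtx d c p \in BV ->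
  forced O n c D W a free p = digit q (later d c (rim d c) p) D.
Proof.
by move=> pB; rewrite /forced reg_region // in_fsetU pB orbT /= rim_boundary // pB.
Qed.

Lemma forced_inner p : vtx d c p \in Vi ->
  forced O n c D W a free p =
    if (vtx d c p \in K) && ~~ free then digit q (later d c (isK O n c) p) W else
    if (vtx d c p == 0) && ~~ free then a else q.
Proof.
move=> pV; rewrite /forced reg_region // in_fsetU pV /= rim_boundary //.
by rewrite (negbTE (fdisjointP disjoint_rim _ pV)) ctr_eq0.
Qed.

Let spreadK y : respects y -> spread (read y) = y.
Proof.
move=> /forallP ry; apply/ffunP => p; rewrite ffunE.
have := ry p; case: ifPn => pU; last first.
  rewrite forced_corner // => /orP[/eqP E|/eqP E].
    by have := card_gt0 A; rewrite -E.
  by rewrite E rankK.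
move: pU; rewrite in_fsetU /glue; have [pV _ _|pV /= pB] := boolP (_ \in Vi).
  by rewrite extend_conf // (site_vtx c0).
rewrite forced_rim // deltaE // => /orP[/eqP E|/eqP ->]; last by rewrite rankK.
by have := digit_lt (later d c (rim d c) p) D (card_gt0 A); rewrite E ltnn.
Qed.

Let respects_spread w : respects (spread w) = target w.
Proof.
have dq i x : (digit q i x < q)%N by apply: digit_lt; exact: card_gt0.
have neq k : (k < q)%N -> (k == q) = false by move=> kq; rewrite ltn_eqF.
apply/forallP/idP => [h|tw p].
  rewrite /target; have [//|/negbTE fr /=] := boolP free.
  apply/forallP => u; apply/implyP => uK.
  have uc : in_box c (val u) by apply: region_box; rewrite in_fsetU (fsvalP u).
  have [p pE] := vtx_surj c0 uc.
  have := h p; rewrite ffunE forced_inner pE ?(fsvalP u) // in_fsetU (fsvalP u) /=.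
  rewrite /glue (fsvalP u) fr !andbT extend_in.
  move: uK; rewrite in_fset1U => /orP[/eqP u0'|uK].
    have u0 : val u = 0 := u0'.
    have -> : (val u \in K) = false.
      by apply/negbTE/negP => /KV; rewrite u0 eqxx andbF.
    by rewrite u0 eqxx neq // rank_eq // tau0.
  by rewrite uK neq // rank_eq // -pE tauE // pE.
rewrite ffunE; case: ifPn => pU; last first.
  by rewrite forced_corner // letterK ?eqxx ?orbT //; exact: card_gt0.
move: pU; rewrite in_fsetU /glue; have [pV _|pV /= pB] := boolP (_ \in Vi); last first.
  by rewrite forced_rim // deltaE // letterK ?eqxx ?orbT.
rewrite forced_inner //; move: tw; rewrite /target.
case: (free) => [_|/= /forallP /(_ [` pV]) /=]; first by rewrite !andbF eqxx.
rewrite -[X in extend w X]/(val [` pV]) extend_in !andbT in_fset1U.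
case: ifP => pK.
  rewrite orbT => /eqP ->; rewrite tauE // letterK ?eqxx ?orbT //.
case: eqP => [p0|_] /=; last by rewrite eqxx.
by move=> /eqP ->; rewrite p0 tau0 letterK ?eqxx ?orbT.
Qed.

(** [spread] and [read] are inverse bijections between the configurations on the box selected by
    [target] and the words on the cube that obey the forced letters. The ignored sites must carry
    letter 0, a single choice of weight 1, and the rim carries [delta]. *)
Lemma zvalE : (zval supp O n c D W a free)%:R =
  \sum_(w : cfg A Vi | target w) interaction rgam rbet (concat w delta).
Proof.
rewrite /zval /zdp dp_total; [|by rewrite expn_gt0|exact: local_wt_local].
transitivity (\sum_(y | respects y)
   (\prod_(p < NS) site_wt supp O c p (y p) (fun r => at_site y (p - r)))%N%:R : R).
  (* The product of the indicators [allowed] over all sites is the indicator of [respects]. *)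
  rewrite natr_sum [RHS]big_mkcond /=; apply: eq_bigr => y _.
  rewrite -[RHS]mulrb -[RHS]mulr_natl -natrM -prod_nat_of_bool -big_split /=; congr _%:R.
  by apply: eq_bigr => p _; rewrite /local_wt allowedE.
rewrite (reindex_onto spread read) => [|y]; last exact: spreadK.
apply: eq_big => [w|w _]; last exact: site_wt_interaction.
by rewrite readK eqxx andbT respects_spread.
Qed.

End PartitionFunction.

(** * Counting sites of the cube and enumerating configurations by codes *)

Lemma cnt_sum (P : pred nat) n : cnt P n = (\sum_(i < n) P i)%N.
Proof.
elim: n => [|n IH]; first by rewrite big_ord0.
by rewrite cntS big_ord_recr /= IH.
Qed.

Lemma total_sum d c (P : pred nat) : total d c P = (\sum_(p < c.*2.+1 ^ d) P p)%N.
Proof.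
rewrite /total cnt_sum (reindex_inj rev_ord_inj) /=.
by apply: eq_bigr => p _; congr (nat_of_bool (P _)); have := ltn_ord p; lia.
Qed.

Lemma sum_ord_mul (a e : nat) (F : nat -> nat) :
  (\sum_(p < a * e) F p = \sum_(h < a) \sum_(l < e) F (h * e + l))%N.
Proof.
elim: a => [|a IH]; first by rewrite mul0n !big_ord0.
rewrite big_ord_recr /= -IH -!(big_mkord xpredT) /= mulSn addnC.
rewrite (@big_cat_nat _ _ _ (a * e)%N) ?leq_addr //=; congr (_ + _)%N.
rewrite -{1}[(a * e)%N]add0n big_addn addnC addnK.
by rewrite big_mkord; apply: eq_bigr => l _; rewrite addnC.
Qed.

Lemma card_digit (m k i x : nat) : (i < k)%N -> (x < m)%N ->
  (\sum_(p < m ^ k) (digit m i p == x) = m ^ k.-1)%N.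
Proof.
move=> + xm; elim: k i => [//|k IH] [|i] ik; rewrite expnSr.
  rewrite (sum_ord_mul _ _ (fun p => digit m 0 p == x : nat)) /=.
  rewrite (eq_bigr (fun=> 1%N)); first by rewrite sum_nat_const card_ord muln1.
  move=> h _; rewrite (bigD1 (Ordinal xm)) //= big1 ?addn0 => [|l].
    by rewrite digit0E modnMDl modn_small // eqxx.
  rewrite -val_eqE /= digit0E modnMDl modn_small // => /negbTE -> //.
rewrite (sum_ord_mul _ _ (fun p => digit m i.+1 p == x : nat)) /=.
transitivity (\sum_(h < m ^ k) m * (digit m i h == x))%N.
  apply: eq_bigr => h _; rewrite (eq_bigr (fun=> digit m i h == x : nat)).
    by rewrite sum_nat_const card_ord.
  move=> l _; have l0 := ltn_ord l.
  by rewrite digitS divnMDl ?(leq_ltn_trans _ l0) // divn_small // addn0.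
rewrite -big_distrr /= IH // -expnS prednK //.
by move: ik; clear; lia.
Qed.

(** Each of the [d] coordinates takes each of its two extreme values at [c.*2.+1 ^ d.-1] sites, and
    a rim site has an extreme coordinate. *)
Lemma nrim_le d c : (0 < c)%N -> (nrim d c <= 2 * d * c.*2.+1 ^ d.-1)%N.
Proof.
move=> c0; rewrite /nrim total_sum.
apply: (@leq_trans (\sum_(p < c.*2.+1 ^ d) extremes d c p)).
  apply: leq_sum => p _; rewrite /rim; case: eqP => // ->; lia.
rewrite /extremes exchange_big /=.
rewrite (eq_bigr (fun=> 2 * c.*2.+1 ^ d.-1)%N); last first.
  move=> i _; rewrite big_split /= !card_digit //.
  by rewrite mul2n addnn.
by rewrite sum_nat_const card_ord mulnA (mulnC d).
Qed.

Section Codes.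
Variables (d : nat) (A : alphabetType) (c : nat).
Hypothesis c0 : (0 < c)%N.
Notation m := c.*2.+1.
Notation NS := (m ^ d)%N.
Notation q := #|A|.
Variables (P : pred nat) (U : {fset 'rV[int]_d}).
Hypothesis PU : forall p, P p = (vtx d c p \in U).
Hypothesis Uc : forall v, v \in U -> in_box c v.

Definition decode (D : nat) : cfg A U :=
  conf U (fun v => if site c v is Some p then letter (digit q (later d c P p) D)
                   else point).

Lemma decodeE D p : (p < NS)%N -> vtx d c p \in U ->
  extend (decode D) (vtx d c p) = letter (digit q (later d c P p) D).
Proof. by move=> pN pU; rewrite extend_conf // (site_vtx c0 (Ordinal pN)). Qed.

Lemma decode_surj (w : cfg A U) : exists2 D, (D < q ^ total d c P)%N & decode D = w.
Proof.
have [//||D Dlt DE] := @code_exists (fun k => P (NS - k.+1)%N) q NS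
    (fun k => rank (extend w (vtx d c (NS - k.+1)))).
- exact: card_gt0.
- by move=> *; exact: rank_lt.
exists D => //; apply/ffunP => u; rewrite ffunE.
have [p pE'] := vtx_surj c0 (Uc (fsvalP u)).
have pE : vtx d c p = val u := pE'; have pN := ltn_ord p.
rewrite -pE (site_vtx c0) /later.
have E : (NS - (NS - p.+1).+1 = p)%N by lia.
rewrite DE ?E ?rankK ?pE ?extend_in //; first by lia.
by rewrite PU pE (fsvalP u).
Qed.

Lemma total_card : total d c P = #|` U|.
Proof.
rewrite total_sum.
have /= := big_region c0 addn (fun=> 1%N) Uc.
rewrite sum1_card /= cardfE => ->; rewrite [RHS]big_mkcond /=.
by apply: eq_bigr => p _; rewrite PU; case: ifP.
Qed.

(** Decoding is onto, and there are as many codes as configurations, so it is a bijection. *)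
Lemma sum_decode (T : nmodType) (F : cfg A U -> T) :
  \sum_(D < q ^ total d c P) F (decode D) = \sum_w F w.
Proof.
pose h (D : 'I_(q ^ total d c P)) := decode D.
have card_eq : #|{: cfg A U}| = #|'I_(q ^ total d c P)|.
  by rewrite card_ord card_ffun total_card cardfE.
have hsurj (w : cfg A U) : w \in codom h.
  have [D Dlt <-] := decode_surj w.
  by apply/codomP; exists (Ordinal Dlt).
have hinj : injective h.
  apply/injectiveP/card_uniqP; rewrite size_map -cardE -card_eq.
  by apply: eq_card => w; rewrite hsurj.
rewrite [RHS](reindex h) //=.
have hcan w : h (iinv (hsurj w)) = w by exact: f_iinv.
exists (fun w => iinv (hsurj w)) => [D _|w _]; last exact: hcan.
by apply: hinj; rewrite hcan.
Qed.

End Codes.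

(** * Gibbs measures as mixtures of specifications *)

Section Mixture.
Variables (R : realType) (d : nat) (A : alphabetType).
Variable mu : probability (borel_fullshift d A) R.
Notation site_ := 'rV[int]_d.
Implicit Types (S T V : {fset site_}).

Definition mass (E : set (borel_fullshift d A)) : R := fine (mu E).

Lemma mass_ge0 E : 0 <= mass E.
Proof. exact/fine_ge0/measure_ge0. Qed.

Lemma massU E F : measurable E -> measurable F -> (E `&` F)%classic = set0 ->
  mass (E `|` F)%classic = mass E + mass F.
Proof.
move=> mE mF EF; rewrite /mass measureU // fineD //; exact: fin_num_measure.
Qed.

Lemma mass_le E F : measurable E -> measurable F -> (E `<=` F)%classic ->
  mass E <= mass F.
Proof.
move=> mE mF EF; apply: fine_le; rewrite ?fin_num_measure //.
by apply: le_measure; rewrite ?inE.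
Qed.

Lemma cylinder_inj S (x y : cfg A S) p : cylinder x p -> cylinder y p -> x = y.
Proof. by move=> hx hy; apply/ffunP => s; rewrite -hx -hy. Qed.

Lemma mass_partition S E : measurable E ->
  mass E = \sum_(x : cfg A S) mass (E `&` cylinder x)%classic.
Proof.
move=> mE.
have mI (x : cfg A S) : measurable (E `&` cylinder x)%classic.
  by apply: measurableI => //; exact: measurable_cylinder.
have H (s : seq (cfg A S)) : uniq s ->
    mass (\big[setU/set0]_(x <- s) (E `&` cylinder x)%classic) =
    \sum_(x <- s) mass (E `&` cylinder x)%classic.
  elim: s => [|x s IH] /= us; first by rewrite !big_nil /mass measure0.
  move: us => /andP[xs us]; rewrite !big_cons massU ?IH //.
    exact: bigsetU_measurable.
  rewrite -bigcup_seq -subset0 => p [[_ xp] [y /= ys [_ yp]]].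
  by move: xs; rewrite (cylinder_inj xp yp) ys.
rewrite -[RHS]big_enum /= -H ?enum_uniq //; congr mass.
rewrite -bigcup_seq; apply/seteqP; split=> p; last by case=> x _ [].
move=> Ep; pose x : cfg A S := [ffun s => p (val s)].
exists x; first by rewrite /= mem_enum.
by split => // s; rewrite ffunE.
Qed.

Lemma mass_setT : mass setT = 1.
Proof. by rewrite /mass probability_setT. Qed.

Definition matches V (S : {pred site_}) (tau : site_ -> A) (w : cfg A V) : bool :=
  [forall u : V, (val u \in S) ==> (w u == tau (val u))].

Variables (gamma : A -> R) (beta : 'I_d -> A -> A -> R).

Definition spec_mass V (delta : cfg A (boundary V)) (E : pred (cfg A V)) : R :=
  \sum_(w : cfg A V | E w) spec gamma beta delta w.

Hypothesis gibbs : gibbs_measure gamma beta mu.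

Lemma pr_mixture V S (tau : site_ -> A) : (S `<=` V)%fset ->
  pr mu (conf S tau) =
  \sum_(delta : cfg A (boundary V) | 0 < pr mu delta)
    pr mu delta * spec_mass delta (matches (mem S) tau).
Proof.
move=> SV; set E := cylinder (conf S tau).
have mE : measurable E by exact: measurable_cylinder.
have m2 (x : cfg A (boundary V)) (w : cfg A V) :
    measurable (cylinder w `&` cylinder x)%classic.
  by apply: measurableI; exact: measurable_cylinder.
rewrite [LHS](mass_partition (boundary V) mE) [RHS]big_mkcond /=.
apply: eq_bigr => delta _.
rewrite (mass_partition V); last first.
  by apply: measurableI => //; exact: measurable_cylinder.
have key (w : cfg A V) : mass (E `&` cylinder delta `&` cylinder w)%classic =
    if matches (mem S) tau w then mass (cylinder w `&` cylinder delta)%classic else 0.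
  case: ifPn => [/forallP mt|nm].
    congr mass; apply/seteqP; split=> [p [[_ ?] ?] //|p [wp dp]]; split => //; split => //.
    move=> s; rewrite ffunE.
    have sV : val s \in V by apply: (fsubsetP SV); exact: fsvalP.
    have := mt [` sV]; rewrite /= (fsvalP s) /= => /eqP <-.
    by rewrite -(wp [` sV]).
  suff -> : (E `&` cylinder delta `&` cylinder w)%classic = set0 by rewrite /mass measure0.
  rewrite -subset0 => p [[Ep _] wp]; move: nm => /forallPn[u].
  rewrite negb_imply => /andP[uS /eqP]; apply.
  rewrite -wp; have := Ep [` uS]; rewrite ffunE /= => <- //.
rewrite (eq_bigr _ (fun w _ => key w)) -big_mkcond /=.
case: ifPn => [dp|]; last first.
  rewrite -leNgt => d0; rewrite big1 // => w _; apply/eqP; rewrite eq_le mass_ge0 andbT.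
  apply: le_trans d0; apply: mass_le => //; exact: measurable_cylinder.
have [_ _ gs] := gibbs; have [_ cp] := gs _ _ dp.
rewrite /spec_mass big_distrr /=; apply: eq_bigr => w _.
rewrite -cp /cond_pr mulrC divfK //; exact: lt0r_neq0.
Qed.

(** The weights μ(δ) sum to 1. Only δ with μ(δ) > 0 occur in the mixture, but the bound is asked for
    all admissible δ, a condition that can be tested without knowing μ. *)
Lemma mixture_bound V S (tau : site_ -> A) (x e : R) : (S `<=` V)%fset ->
  (forall delta : cfg A (boundary V), admissible gamma beta delta ->
     `|spec_mass delta (matches (mem S) tau) - x| <= e) ->
  `|pr mu (conf S tau) - x| <= e.
Proof.
move=> SV h; rewrite (pr_mixture _ SV).
have one : \sum_(delta : cfg A (boundary V) | 0 < pr mu delta) pr mu delta = 1.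
  rewrite -mass_setT (mass_partition (boundary V) measurableT) [LHS]big_mkcond /=.
  apply: eq_bigr => delta _; rewrite setTI; case: ifPn => //.
  by rewrite -leNgt => d0; apply/eqP; rewrite eq_le mass_ge0 d0.
rewrite -[x]mul1r -{1}one big_distrl /= -sumrB.
apply: le_trans (ler_norm_sum _ _ _) _.
rewrite -[e]mul1r -{1}one big_distrl /=; apply: ler_sum => delta dp.
rewrite -mulrBr normrM (ger0_norm (ltW dp)); apply: ler_wpM2l; first exact: ltW.
by apply: h; have [_ _ gs] := gibbs; have [] := gs _ _ dp.
Qed.

Lemma pr_sum T (tau : site_ -> A) (a0 : site_) : a0 \notin T ->
  pr mu (conf T tau) =
  \sum_(a : A) pr mu (conf (a0 |` T)%fset (fun v => if v == a0 then a else tau v)).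
Proof.
move=> a0T; rewrite [LHS](mass_partition [fset a0]); last exact: measurable_cylinder.
pose h (a : A) : cfg A [fset a0] := [ffun=> a].
rewrite (reindex h) /=; last first.
  exists (fun x => x [` fset11 a0]) => [a _|x _]; first by rewrite ffunE.
  apply/ffunP => s; rewrite ffunE; congr (x _); apply/val_inj => /=.
  by have := fsvalP s; rewrite in_fset1 => /eqP.
apply: eq_bigr => a _; congr mass; apply/seteqP; split=> p.
  move=> [hT h0] s; rewrite ffunE; case: eqP => [s0|/eqP s0].
    have pa : p a0 = a by have := h0 [` fset11 a0]; rewrite ffunE.
    by rewrite s0.
  have sT : val s \in T by have := fsvalP s; rewrite in_fset1U (negbTE s0).
  by have := hT [` sT]; rewrite ffunE.
move=> hp; split=> s.
  have sT : val s \in (a0 |` T)%fset by rewrite in_fset1U (fsvalP s) orbT.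
  have := hp [` sT]; rewrite !ffunE /= => ->; case: eqP => // s0.
  by move: a0T; rewrite -s0 (fsvalP s).
have sE : val s = a0 by have := fsvalP s; rewrite in_fset1 => /eqP.
have s0 : val s \in (a0 |` T)%fset by rewrite sE fset1U1.
by have := hp [` s0]; rewrite !ffunE /= sE eqxx.
Qed.

End Mixture.

(** * Consequences of strong spatial mixing *)

Section Telescoping.
Variables (R : realType) (d : nat) (A : alphabetType).
Variables (gamma : A -> R) (beta : 'I_d -> A -> A -> R).
Hypothesis gamma_gt0 : forall a, 0 < gamma a.
Hypothesis beta_ge0 : forall i a b, 0 <= beta i a b.
Notation site_ := 'rV[int]_d.
Variable V : {fset site_}.
Notation BV := (boundary V).
Notation smass := (@spec_mass R d A gamma beta V).

Lemma interaction_ge0 (U : {fset site_}) (w : cfg A U) :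
  0 <= interaction gamma beta w.
Proof.
by apply: mulr_ge0; [apply: prodr_ge0 => *; exact: ltW|do 2 apply: prodr_ge0 => *].
Qed.

Definition partition_fun (delta : cfg A BV) (E : pred (cfg A V)) : R :=
  \sum_(w : cfg A V | E w) interaction gamma beta (concat w delta).

Lemma partition_fun_ge0 delta E : 0 <= partition_fun delta E.
Proof. by apply: sumr_ge0 => w _; exact: interaction_ge0. Qed.

Lemma admissibleP delta : admissible gamma beta delta <-> 0 < partition_fun delta predT.
Proof.
split=> [[w w0]|h].
  rewrite /partition_fun (bigD1 w) //=; apply: ltr_pwDl => //.
  by apply: sumr_ge0 => *; exact: interaction_ge0.
apply: contrapT => na; move: h; rewrite /partition_fun big1 ?ltxx // => w _.
apply/eqP; rewrite eq_le interaction_ge0 andbT leNgt; apply/negP => w0.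
by apply: na; exists w.
Qed.

Lemma spec_massE delta E :
  smass delta E = partition_fun delta E / partition_fun delta predT.
Proof. by rewrite /partition_fun big_distrl. Qed.

Lemma spec_mass_ge0 delta E : 0 <= smass delta E.
Proof. by rewrite spec_massE divr_ge0 ?partition_fun_ge0. Qed.

Lemma spec_mass_le delta (E F : pred (cfg A V)) : (forall w, E w -> F w) -> smass delta E <= smass delta F.
Proof.
move=> EF; rewrite !spec_massE ler_wpM2r ?invr_ge0 ?partition_fun_ge0 //.
rewrite /partition_fun [leLHS]big_mkcond [leRHS]big_mkcond /=; apply: ler_sum => w _.
case: ifPn => [/EF ->//|_]; case: ifP => // _; exact: interaction_ge0.
Qed.

Lemma boundary_disjoint : [disjoint V & BV].
Proof. by apply/fdisjointP => v vV; rewrite in_boundary vV. Qed.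

Lemma agree_conf (U T : {fset site_}) (w w' : site_ -> A) :
  agree (conf U w) (conf T w') = [forall t : T, (val t \in U) ==> (w (val t) == w' (val t))].
Proof.
apply/forallP/forallP => [h t|h s].
  apply/implyP => tU; have /forallP/(_ t) := h [` tU].
  by rewrite !ffunE /= eqxx implyTb.
apply/forallP => t; apply/implyP => /eqP st; rewrite !ffunE st.
by have := h t; rewrite -st (fsvalP s).
Qed.

Lemma agree_concat (T : {fset site_}) (delta : cfg A BV) (w : cfg A V)
    (s : seq site_) (tau : site_ -> A) : {subset s <= V} ->
  (forall v, v \in T -> (v \in BV) || (v \in s)) -> {subset s <= T} ->
  agree (concat w delta)
    (conf T (fun v => if v \in BV then extend delta v else tau v)) =
  matches (mem s) tau w.
Proof.
move=> sV Ts sT; rewrite concat_extend ?boundary_disjoint // agree_conf.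
have VB v : v \in V -> v \notin BV by apply/fdisjointP/boundary_disjoint.
apply/forallP/forallP => [h u|h t].
  apply/implyP => us; have := h [` sT _ us]; rewrite /= in_fsetU (fsvalP u) /=.
  by rewrite (negbTE (VB _ (fsvalP u))) -[X in extend w X]/(val u) extend_in.
apply/implyP => _; have := Ts _ (fsvalP t).
have [tB _|tB /= ts] := boolP (fsval t \in BV).
  rewrite ifF //; apply/negbTE; apply: contraTN tB; exact: VB.
have tV := sV _ ts; rewrite tV.
by have := h [` tV]; rewrite /= ts /= -[X in extend w X]/(val [` tV]) extend_in.
Qed.

Variables (C alpha : R).
Hypotheses (C0 : 0 < C) (alpha0 : 0 < alpha).
Hypothesis ssm : forall (u : site_) (T : {fset site_}) (VT : BV `<=` T)
    (x : cfg A [fset u]) (y z : cfg A T),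
  u \in V -> T `<=` V `|` BV ->
  let delta := restr VT y in let eta := restr VT z in
  admissible gamma beta delta -> admissible gamma beta eta ->
  0 < spec_pr gamma beta delta y -> 0 < spec_pr gamma beta eta z ->
  (`|spec_cond_pr gamma beta delta x y - spec_cond_pr gamma beta eta x z|%:E <=
      C%:E * expeR (- (alpha%:E * set_dist R u (diff_set y z))))%E.

(** Mixing is applied with [T] the boundary together with the sites of [s] already fixed. Off the
    boundary both configurations equal [tau], so they differ only at distance at least [r] from
    [u]. *)
Lemma ssm_step (delta eta : cfg A BV) (s : seq site_) (u : site_)
    (tau : site_ -> A) (r : nat) :
  admissible gamma beta delta -> admissible gamma beta eta ->
  {subset s <= V} -> u \in V ->
  (forall v, v \in BV -> (r <= l1dist u v)%N) ->
  0 < smass delta (matches (mem s) tau) -> 0 < smass eta (matches (mem s) tau) ->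
  `|smass delta (matches (mem (u :: s)) tau) / smass delta (matches (mem s) tau) -
    smass eta (matches (mem (u :: s)) tau) / smass eta (matches (mem s) tau)| <=
  C * expR (- (alpha * r%:R)).
Proof.
move=> ad ae sV uV ur ds es.
pose T : {fset site_} := BV `|` [fset v in s].
have VT : BV `<=` T by exact: fsubsetUl.
have TU : T `<=` V `|` BV.
  apply/fsubsetP => v; rewrite !in_fsetU => /orP[->|]; first by rewrite orbT.
  by rewrite in_fset => /sV ->.
have Ts v : v \in T -> (v \in BV) || (v \in s) by rewrite in_fsetU in_fset.
have sT : {subset s <= T} by move=> v vs; rewrite in_fsetU in_fset vs orbT.
pose y (dd : cfg A BV) := conf T (fun v => if v \in BV then extend dd v else tau v).
have resy dd : restr VT (y dd) = dd.
  apply/ffunP => t; rewrite !ffunE /= (fsvalP t).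
  by rewrite -[X in extend dd X]/(val t) extend_in.
have pry dd : spec_pr gamma beta dd (y dd) = smass dd (matches (mem s) tau).
  by rewrite /spec_pr /spec_event /spec_mass; apply: eq_bigl => w; rewrite (agree_concat dd w tau sV Ts sT).
have cy dd : spec_cond_pr gamma beta dd (conf [fset u] tau) (y dd) =
    smass dd (matches (mem (u :: s)) tau) / smass dd (matches (mem s) tau).
  rewrite /spec_cond_pr pry; congr (_ / _); rewrite /spec_event /spec_mass.
  apply: eq_bigl => w; rewrite (agree_concat dd w tau sV Ts sT).
  have -> : agree (concat w dd) (conf [fset u] tau) = (extend w u == tau u).
    rewrite concat_extend ?boundary_disjoint // agree_conf.
    have uU : u \in V `|` BV by rewrite in_fsetU uV.
    apply/forallP/idP => [/(_ [` fset11 u])|ww t]; first by rewrite /= uU uV.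
    have tu : val t = u by have := fsvalP t; rewrite in_fset1 => /eqP.
    by rewrite tu uV ww implybT.
  apply/andP/forallP => [[eu /forallP h] v|h].
    apply/implyP; rewrite /= inE => /orP[/eqP vu|vs]; last by have := h v; rewrite vs.
    by move: eu; rewrite -vu extend_in.
  have eu : extend w u = w [` uV] := extend_in w [` uV].
  split; first by have := h [` uV]; rewrite /= inE eqxx eu.
  by apply/forallP => v; apply/implyP => vs; have := h v; rewrite /= inE vs orbT.
have := @ssm u T VT (conf [fset u] tau) (y delta) (y eta) uV TU.
rewrite /= !resy !pry !cy => /(_ ad ae ds es) /le_trans H.
rewrite -lee_fin; apply: H; rewrite EFinM lee_pmul2l ?lte_fin //.
rewrite -[X in (_ <= X)%E]/(expeR (- (alpha * r%:R))%:E) lee_expeR EFinN leeN2 EFinM.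
rewrite lee_pmul2l ?lte_fin //; apply: le_ereal_inf_tmp => _ [v [t <- /eqP ne] <-].
rewrite lee_fin ler_nat; apply: ur; apply: contra_notT ne => tB.
by rewrite !ffunE (negbTE tB).
Qed.

(** Sites are added one at a time. With p, q the masses before and p', q' after, p' - q' = (p -
    q)(p'/p) + q(p'/p - q'/q): the first term is at most the old error, since p' ≤ p, and the second
    at most one mixing bound, since q ≤ 1. *)
Lemma ssm_masses (delta eta : cfg A BV) (s : seq site_) (tau : site_ -> A) (r : nat) :
  admissible gamma beta delta -> admissible gamma beta eta -> {subset s <= V} ->
  (forall u v, u \in s -> v \in BV -> (r <= l1dist u v)%N) ->
  `|smass delta (matches (mem s) tau) - smass eta (matches (mem s) tau)| <=
  (size s)%:R * (C * expR (- (alpha * r%:R))).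
Proof.
move=> ad ae; elim: s => [|u s IH] sV sr.
  rewrite mul0r; set f := matches _ _.
  have f1 dd : admissible gamma beta dd -> smass dd f = 1.
    move=> /admissibleP a; rewrite spec_massE.
    have -> : partition_fun dd f = partition_fun dd predT.
      by apply: eq_bigl => w; apply/forallP => v.
    by rewrite divff // lt0r_neq0.
  by rewrite !f1 // subrr normr0.
have sV' : {subset s <= V} by move=> v vs; apply: sV; rewrite inE vs orbT.
have {}IH : `|smass delta (matches (mem s) tau) - smass eta (matches (mem s) tau)| <=
  (size s)%:R * (C * expR (- (alpha * r%:R))).
  by apply: IH => // w v ws; apply: sr; rewrite inE ws orbT.
have uV : u \in V by apply: sV; rewrite inE eqxx.
have ur v : v \in BV -> (r <= l1dist u v)%N by apply: sr; rewrite inE eqxx.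
have step := ssm_step (tau := tau) ad ae sV' uV ur.
have sub dd : smass dd (matches (mem (u :: s)) tau) <= smass dd (matches (mem s) tau).
  apply: spec_mass_le => w /forallP h; apply/forallP => v; apply/implyP => vs.
  by have := h v; rewrite /= inE vs orbT.
have ge dd e := spec_mass_ge0 dd e.
have q1 : smass eta (matches (mem s) tau) <= 1.
  have /admissibleP a := ae; rewrite spec_massE ler_pdivrMr // mul1r.
  rewrite -[leLHS]mul1r -[leRHS]mulr1 mul1r mulr1.
  rewrite /partition_fun [leLHS]big_mkcond /=; apply: ler_sum => w _.
  by case: ifP => // _; exact: interaction_ge0.
move: IH step (sub delta) (sub eta) (ge delta (matches (mem (u :: s)) tau))
  (ge eta (matches (mem (u :: s)) tau)) q1.
move: (smass delta (matches (mem s) tau)) (smass eta (matches (mem s) tau))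
  (smass delta (matches (mem (u :: s)) tau)) (smass eta (matches (mem (u :: s)) tau)).
have e0 : 0 <= C * expR (- (alpha * r%:R)) by rewrite mulr_ge0 ?expR_ge0 ?ltW.
move: (C * expR _) e0 => e e0 p q p' q' IH step pp qq p0 q0 q1.
rewrite /= -natr1 mulrDl mul1r.
(* Mixing says nothing about null words; but p = 0 forces p' = 0, and q' ≤ q = |p - q| is covered by
   the induction hypothesis. *)
have [pz|pz] := leP p 0.
  have -> : p' = 0 by apply/eqP; rewrite eq_le p0 andbT (le_trans pp).
  rewrite sub0r normrN ger0_norm //; apply: le_trans qq _.
  apply: (@le_trans _ _ `|p - q|); last by rewrite (le_trans IH) // lerDl.
  by rewrite distrC; apply: le_trans (ler_norm _); rewrite lerBrDr gerDl.
have [qz|qz] := leP q 0.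
  have -> : q' = 0 by apply/eqP; rewrite eq_le q0 andbT (le_trans qq).
  rewrite subr0 ger0_norm //; apply: le_trans pp _.
  apply: (@le_trans _ _ `|p - q|); last by rewrite (le_trans IH) // lerDl.
  by apply: le_trans (ler_norm _); rewrite lerBrDr gerDl.
have {}step := step pz qz.
have -> : p' - q' = (p - q) * (p' / p) + q * (p' / p - q' / q).
  by field; rewrite !lt0r_neq0.
apply: le_trans (ler_normD _ _) _.
rewrite (normrM (p - q)) (normrM q); apply: lerD.
  have a0 : 0 <= p' / p by rewrite divr_ge0 // ltW.
  have a1 : p' / p <= 1 by rewrite ler_pdivrMr // mul1r.
  by rewrite (ger0_norm a0); apply: le_trans IH; apply: ler_piMr.
rewrite (ger0_norm (ltW qz)); apply: le_trans step.
by apply: ler_piMl.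
Qed.

End Telescoping.

(** * Approximation of the entropy *)

Section Entropy.
Variable R : realType.

Definition phi (x : R) : R := - (x * ln x).

Lemma ln_le_subr1 (x : R) : 0 < x -> ln x <= x - 1.
Proof.
move=> x0; have := @le_ln1Dx R (x - 1); rewrite (_ : 1 + (x - 1) = x); last by ring.
by apply; rewrite ltrBrDr addNr.
Qed.

(** With s = √h, phi(h) = 2s(-s ln s), and -s ln s ≤ s(1/s - 1) ≤ 1. *)
Lemma phi_le_sqrt (h t : R) : 0 < h -> 0 <= t -> h <= t ^+ 2 -> phi h <= 2 * t.
Proof.
move=> h0 t0 ht; rewrite /phi.
set s := Num.sqrt h.
have s0 : 0 < s by rewrite sqrtr_gt0.
have hE : h = s * s by rewrite -expr2 sqr_sqrtr // ltW.
have st : s <= t by rewrite -(ger0_norm t0) -sqrtr_sqr ler_wsqrtr.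
have L : - ln s <= s^-1 - 1.
  by rewrite -lnV ?posrE //; apply: ln_le_subr1; rewrite invr_gt0.
rewrite hE lnM ?posrE //.
have -> : - (s * s * (ln s + ln s)) = 2 * (s * (s * - ln s)) by ring.
rewrite ler_pM2l //; apply: le_trans st; rewrite -[leRHS]mulr1 ler_pM2l //.
apply: (@le_trans _ _ (s * (s^-1 - 1))); first by rewrite ler_pM2l.
by rewrite mulrBr divff ?lt0r_neq0 // mulr1 gerBl ltW.
Qed.

(** For x ≤ y and h = y - x, phi(y) - phi(x) = x(ln x - ln y) - h ln y. This is at most phi(h),
    because h ≤ y, and at least -2h, because ln(y/x) ≤ y/x - 1 and ln y ≤ 1. The range extends to 2
    because a rounded sum is only known to be close to a mass. *)
Lemma phi_modulus (x y t : R) : 0 <= x -> x <= 2 -> 0 <= y -> y <= 2 ->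
  0 <= t -> t <= 1 -> `|x - y| <= t ^+ 2 -> `|phi x - phi y| <= 2 * t.
Proof.
wlog xy : x y / x <= y => [H|].
  move=> x0 x2 y0 y2 t0 t1; have [/H|/ltW /H] := leP x y; first exact.
  by rewrite distrC (distrC (phi x)); exact.
move=> x0 x2 y0 y2 t0 t1; rewrite distrC ger0_norm ?subr_ge0 // => ht.
have [->|yx] := eqVneq x y; first by rewrite subrr normr0 mulr_ge0.
have h0 : 0 < y - x by rewrite subr_gt0 lt_neqAle yx.
have y1 : 0 < y by rewrite (le_lt_trans x0) // -subr_gt0.
have hy : y - x <= y by rewrite gerBl.
have lny : ln (y - x) <= ln y by rewrite ler_ln ?posrE.
have P1 := phi_le_sqrt h0 t0 ht.
have t2 : t ^+ 2 <= t by rewrite expr2 ler_piMl.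
have lny1 : ln y <= 1.
  by apply: le_trans (ln_le_subr1 y1) _; rewrite lerBlDr.
have X1 : x * (ln x - ln y) <= 0.
  move: x0; rewrite le_eqVlt => /orP[/eqP <-|x0]; first by rewrite mul0r.
  by rewrite pmulr_rle0 // subr_le0 ler_ln ?posrE.
have X2 : x * (ln y - ln x) <= y - x.
  move: (x0); rewrite le_eqVlt => /orP[/eqP <-|x0']; first by rewrite mul0r subr0.
  rewrite -ln_div ?posrE //; apply: (@le_trans _ _ (x * (y / x - 1))).
    by rewrite ler_pM2l //; apply: ln_le_subr1; rewrite divr_gt0.
  by rewrite mulrBr mulr1 mulrCA divff ?mulr1 // lt0r_neq0.
have P1' : - ((y - x) * ln (y - x)) <= 2 * t := P1.
have M1 : (y - x) * ln (y - x) <= (y - x) * ln y by rewrite ler_pM2l.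
have M2 : (y - x) * ln y <= y - x by rewrite -[leRHS]mulr1 ler_pM2l.
rewrite ler_norml /phi; apply/andP; split; nra.
Qed.

Lemma ln_succ (k : nat) : (0 < k)%N ->
  (k.+1%:R)^-1 <= ln (k.+1%:R : R) - ln k%:R <= (k%:R)^-1.
Proof.
move=> k0; have kr : 0 < k%:R :> R by rewrite ltr0n.
have k1r : 0 < k.+1%:R :> R by rewrite ltr0n.
apply/andP; split.
  rewrite -opprB lerNr -ln_div ?posrE //.
  apply: le_trans (ln_le_subr1 _) _; first by rewrite divr_gt0.
  have -> : k%:R = k.+1%:R - 1 :> R by rewrite -natr1 addrK.
  by rewrite mulrBl divff ?lt0r_neq0 // mul1r addrAC subrr sub0r.
rewrite -ln_div ?posrE //; apply: le_trans (ln_le_subr1 _) _; first by rewrite divr_gt0.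
by rewrite -natr1 mulrDl divff ?lt0r_neq0 // mul1r addrAC subrr add0r.
Qed.

Definition hsum (M e : nat) : nat := (\sum_(k < e) M %/ k.+1)%N.

(** Each step of the logarithm lies between 1/(k+1) and 1/k. Rounding down loses at most 1 per term,
    at most [s] in all, and the differences 1/k - 1/(k+1) telescope to at most 1/l. In a difference
    of two sums Euler's constant cancels. *)
Lemma hsum_ln (M l s : nat) : (0 < l)%N -> (l <= s)%N ->
  `|(hsum M s)%:R - (hsum M l)%:R - M%:R * (ln s%:R - ln l%:R)| <=
  s%:R + M%:R / l%:R :> R.
Proof.
move=> l0 ls.
have lr : 0 < l%:R :> R by rewrite ltr0n.
(* The telescoped form of the error passes through the induction on [s - l]. *)
suff : (M%:R : R) * (ln s%:R - ln l%:R) - (s%:R - l%:R) - M%:R * (l%:R^-1 - s%:R^-1) <=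
    (hsum M s)%:R - (hsum M l)%:R <= M%:R * (ln s%:R - ln (l%:R : R)).
  have s0 : 0 <= M%:R * s%:R^-1 :> R by rewrite mulr_ge0 // invr_ge0.
  have s1 : 0 <= M%:R * l%:R^-1 :> R by rewrite mulr_ge0 // invr_ge0.
  have s2 : 0 <= s%:R :> R by [].
  rewrite ler_norml !mulrBr => /andP[h1 h2].
  move: h1 h2 s0 s1 s2 lr; move: (M%:R * ln _) (M%:R * ln _) => x y.
  move: (M%:R * _) (M%:R * _) => u v h1 h2 s0 s1 s2 lr.
  by apply/andP; split; lra.
rewrite -(subnKC ls); elim: (s - l)%N => [|i IH].
  by rewrite addn0 !subrr mulr0 !subr0 lexx.
rewrite addnS; set k := (l + i)%N in IH *.
have k0 : (0 < k)%N by rewrite addn_gt0 l0.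
have -> : hsum M k.+1 = (hsum M k + M %/ k.+1)%N by rewrite /hsum big_ord_recr.
have /andP[n1 n2] := ln_succ k0.
have M0 : 0 <= M%:R :> R by [].
have d1 : (M %/ k.+1)%:R <= M%:R / k.+1%:R :> R.
  by rewrite ler_pdivlMr ?ltr0n // -natrM ler_nat leq_divM.
have d2 : M%:R / k.+1%:R - 1 <= (M %/ k.+1)%:R :> R.
  rewrite lerBlDr natr1 ler_pdivrMr ?ltr0n // -natrM ler_nat.
  by rewrite ltnW // ltn_ceil.
have m1 := ler_wpM2l M0 n1; have m2 := ler_wpM2l M0 n2.
have e1 : k.+1%:R = k%:R + 1 :> R by rewrite natr1.
move: IH; rewrite natrD => /andP[].
move: e1 m1 m2 d1 d2; rewrite !mulrBr.
move: (M%:R * ln k.+1%:R) (M%:R * ln k%:R) (M%:R * ln l%:R) => x y z.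
move: (M%:R / k.+1%:R : R) (M%:R / k%:R : R) (M%:R / l%:R : R) (k.+1%:R : R) => u v w K.
by move=> e1 m1 m2 d1 d2 i1 i2; apply/andP; split; lra.
Qed.

(** The factor l/N^3 turns the error s + N^2/l into at most (s + N)/N^2; hence the scaling of the
    harmonic sums by N^2. *)
Lemma hsum_term (N l s : nat) : (0 < N)%N -> (l <= s)%N -> (l <= N)%N ->
  `|l%:R / N%:R * (ln s%:R - ln l%:R) -
    l%:R * ((hsum (N * N) s)%:R - (hsum (N * N) l)%:R) / (N ^ 3)%:R| <=
  (s%:R + N%:R) / (N * N)%:R :> R.
Proof.
move=> N0 ls lN; have Nr : 0 < N%:R :> R by rewrite ltr0n.
have NN0 : 0 < (N * N)%:R :> R by rewrite ltr0n muln_gt0 N0.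
have [->|l0] := posnP l.
  by rewrite !mul0r subrr normr0 divr_ge0 // addr_ge0.
have lr : 0 < l%:R :> R by rewrite ltr0n.
have H := hsum_ln (N * N) l0 ls.
set h := (hsum _ s)%:R - _ in H *; set L := ln _ - ln _ in H *.
have -> : l%:R / N%:R * L - l%:R * h / (N ^ 3)%:R =
    - (l%:R / (N ^ 3)%:R * (h - (N * N)%:R * L)) :> R.
  by rewrite natrM natrX; field; rewrite lt0r_neq0.
rewrite normrN normrM ger0_norm ?divr_ge0 //.
apply: (@le_trans _ _ (l%:R / (N ^ 3)%:R * (s%:R + (N * N)%:R / l%:R))).
  by rewrite ler_wpM2l // divr_ge0.
have -> : l%:R / (N ^ 3)%:R * (s%:R + (N * N)%:R / l%:R) =
    (l%:R / N%:R * s%:R + N%:R) / (N * N)%:R :> R.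
  by rewrite natrM natrX; field; rewrite !lt0r_neq0.
rewrite ler_wpM2r ?invr_ge0 // lerD2r ler_piMl //.
by rewrite ler_pdivrMr // mul1r ler_nat.
Qed.

Variables (I A : finType) (x : I -> A -> R) (l : I -> A -> nat) (r : nat).
Notation q := #|A|.
Notation N := (r * r)%N.
Notation X w := (\sum_a x w a).
Notation S w := (\sum_a l w a)%N.
Hypotheses (q2 : (2 <= q)%N) (qr : (2 * q <= r)%N).
Hypothesis x0 : forall w a, 0 <= x w a.
Hypothesis X1 : forall w, X w <= 1.
Hypothesis lN : forall w a, (l w a <= N)%N.
Hypothesis xl : forall w a, `|N%:R * x w a - (l w a)%:R| <= 3.

Let r0 : (0 < r)%N. Proof. by apply: leq_trans qr; lia. Qed.
Let N0 : (0 < N)%N. Proof. by rewrite muln_gt0 r0. Qed.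
Let Nr : 0 < N%:R :> R. Proof. by rewrite ltr0n. Qed.
Let rr : 0 < r%:R :> R. Proof. by rewrite ltr0n. Qed.
(** Chosen so that [t ^ 2 * N = 4 * q ^ 2], which exceeds both the error 3 of a single mass and the
    error [3 * q] of a sum. *)
Let t : R := 2 * q%:R / r%:R.
Let t0 : 0 <= t. Proof. by rewrite /t divr_ge0 // mulr_ge0. Qed.

Let t1 : t <= 1.
Proof. by rewrite /t ler_pdivrMr // mul1r -natrM ler_nat. Qed.
Let scale (y e : R) (k : nat) : `|N%:R * y - k%:R| <= e -> e <= (4 * q ^ 2)%:R ->
  `|y - k%:R / N%:R| <= t ^+ 2.
Proof.
move=> h he.
have -> : y - k%:R / N%:R = (N%:R * y - k%:R) / N%:R.
  by field; rewrite lt0r_neq0.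
rewrite normrM (ger0_norm (x := N%:R^-1)) ?invr_ge0 // ler_pdivrMr //.
apply: le_trans h (le_trans he _).
suff -> : t ^+ 2 * N%:R = (4 * q ^ 2)%:R by [].
by rewrite /t !natrM; field; rewrite lt0r_neq0.
Qed.

Let q2r : (2 : R) <= q%:R. Proof. by rewrite ler_nat. Qed.

(** Each [w] involves [q.+1] values of [phi], each off by at most [2 * t], and [q] logarithmic
    terms, each off by at most [(q + 1) / N]; as [N >= r], these add up to at most
    [10 * q ^ 2 / r]. *)
Lemma entropy_error :
  `|\sum_w \sum_(a | 0 < x w a) - (x w a * ln (x w a / X w)) -
    ((\sum_w S w * hsum (N * N) (S w))%N%:R -
     (\sum_w \sum_a l w a * hsum (N * N) (l w a))%N%:R) / (N ^ 3)%:R| <=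
  #|I|%:R * (10 * q%:R ^+ 2 / r%:R).
Proof.
have E1 w : \sum_(a | 0 < x w a) - (x w a * ln (x w a / X w)) =
    \sum_a phi (x w a) - phi (X w).
  rewrite /phi opprK big_distrl /= -big_split /= big_mkcond /=.
  apply: eq_bigr => a _; case: ifPn => [xa|].
    have Xw : 0 < X w.
      by rewrite (bigD1 a) //=; apply: ltr_pwDl => //; exact: sumr_ge0.
    by rewrite ln_div ?posrE //; ring.
  by rewrite lt0r x0 andbT negbK => /eqP ->; rewrite !mul0r oppr0 addr0.
rewrite (eq_bigr _ (fun w _ => E1 w)) !natr_sum -sumrB big_distrl /= -sumrB.
apply: le_trans (ler_norm_sum _ _ _) _.
rewrite -sum1_card natr_sum big_distrl /=; apply: ler_sum => w _; rewrite mul1r.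
rewrite natr_sum.
pose F a := (l w a)%:R / N%:R * (ln (S w)%:R - ln (l w a)%:R) : R.
have Sr : (S w)%:R = \sum_a (l w a)%:R :> R by rewrite natr_sum.
(* The terms ln N cancel between the letters and their sum, so only differences of logarithms of
   integers remain. *)
have E2 : \sum_a phi ((l w a)%:R / N%:R) - phi ((S w)%:R / N%:R) = \sum_a F a.
  rewrite /phi opprK; set L := ln ((S w)%:R / _).
  rewrite Sr !mulr_suml -big_split /=; apply: eq_bigr => a _.
  rewrite /F /L; have [la|la] := posnP (l w a); first by rewrite la !mul0r oppr0 add0r.
  have Sw : (0 < S w)%N by rewrite (bigD1 a) //= addn_gt0 la.
  by rewrite !ln_div ?posrE ?ltr0n //; ring.
pose G a := (l w a)%:R * ((hsum (N * N) (S w))%:R -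
  (hsum (N * N) (l w a))%:R) / (N ^ 3)%:R : R.
have E3 : ((S w * hsum (N * N) (S w))%N%:R -
    \sum_a (l w a * hsum (N * N) (l w a))%N%:R) / (N ^ 3)%:R =
    \sum_a G a.
  rewrite natrM Sr big_distrl /= -sumrB big_distrl /=.
  by apply: eq_bigr => a _; rewrite natrM /G mulrBr.
rewrite E3.
have xa1 a : x w a <= 1.
  by apply: le_trans (X1 w); rewrite (bigD1 a) //= lerDl sumr_ge0.
have le2 (k : nat) : (k <= 2 * N)%N -> k%:R / N%:R <= 2 :> R.
  by move=> kN; rewrite ler_pdivrMr // -natrM ler_nat.
have D1 a : `|phi (x w a) - phi ((l w a)%:R / N%:R)| <= 2 * t.
  apply: phi_modulus => //; rewrite ?divr_ge0 //.
  - by apply: le_trans (xa1 a) _; rewrite ler1n.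
  - by apply: le2; apply: leq_trans (lN _ _) _; rewrite leq_pmull.
  - apply: scale (xl w a) _; rewrite ler_nat; nia.
have XS : `|N%:R * X w - (S w)%:R| <= 3 * q%:R.
  rewrite Sr big_distrr /= -sumrB; apply: le_trans (ler_norm_sum _ _ _) _.
  rewrite -sum1_card natr_sum big_distrr /=; apply: ler_sum => a _.
  by rewrite mulr1.
have qN : 3 * q%:R <= N%:R :> R.
  rewrite -natrM ler_nat; have := leq_mul qr qr; nia.
have D2 : `|phi (X w) - phi ((S w)%:R / N%:R)| <= 2 * t.
  apply: phi_modulus => //; rewrite ?divr_ge0 ?sumr_ge0 //.
  - by apply: le_trans (X1 w) _; rewrite ler1n.
  - rewrite ler_pdivrMr //; move: XS; rewrite ler_norml => /andP[h _].
    have : N%:R * X w <= N%:R by rewrite -[leRHS]mulr1 ler_pM2l.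
    move: h qN; lra.
  - apply: scale XS _; rewrite -natrM ler_nat; nia.
have Slr : (S w)%:R <= q%:R * N%:R :> R.
  rewrite -natrM ler_nat -sum1_card big_distrl /=; apply: leq_sum => a _.
  by rewrite mul1n.
have D3 a : `|F a - G a| <= (q%:R + 1) / N%:R.
  apply: le_trans (hsum_term N0 _ (lN w a)) _; first by rewrite (bigD1 a) //= leq_addr.
  rewrite (natrM _ N N) [leRHS](_ : _ = (q%:R * N%:R + N%:R) / (N%:R * N%:R)).
    by apply: ler_wpM2r; rewrite ?invr_ge0 ?mulr_ge0 // lerD2r.
  by field; rewrite lt0r_neq0.
have -> : \sum_a phi (x w a) - phi (X w) - \sum_a G a =
    \sum_a (phi (x w a) - phi ((l w a)%:R / N%:R)) -
    (phi (X w) - phi ((S w)%:R / N%:R)) + \sum_a (F a - G a).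
  rewrite !sumrB -E2; ring.
apply: (@le_trans _ _ (q%:R * (2 * t) + 2 * t + q%:R * ((q%:R + 1) / N%:R))).
  have sb (H : A -> R) e : (forall a, `|H a| <= e) -> `|\sum_a H a| <= q%:R * e.
    move=> He; apply: le_trans (ler_norm_sum _ _ _) _.
    rewrite -sum1_card natr_sum big_distrl /=; apply: ler_sum => a _.
    by rewrite mul1r.
  apply: le_trans (ler_normD _ _) _; apply: lerD; last exact: sb.
  apply: le_trans (ler_normB _ _) _; apply: lerD => //; exact: sb.
have NE : (N%:R : R)^-1 <= r%:R^-1.
  by rewrite lef_pV2 ?posrE // ler_nat leq_pmull.
rewrite /t.
have -> : q%:R * (2 * (2 * q%:R / r%:R)) + 2 * (2 * q%:R / r%:R) =
   (4 * (q%:R + 1) * q%:R) / r%:R :> R by ring.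
apply: (@le_trans _ _ ((4 * (q%:R + 1) * q%:R) / r%:R + (q%:R * (q%:R + 1)) / r%:R)).
  by rewrite lerD2l mulrA ler_wpM2l // mulr_ge0 // addr_ge0.
rewrite -mulrDl ler_wpM2r ?invr_ge0 //.
move: q2r; nra.
Qed.

End Entropy.

(** * Approximate weights *)

Lemma bernoulli (R : realType) (x : R) (k : nat) : 0 <= x -> x <= 1 ->
  1 - k%:R * x <= (1 - x) ^+ k.
Proof.
move=> x0 x1; elim: k => [|k IH]; first by rewrite mul0r subr0 expr0.
rewrite exprS; apply: (@le_trans _ _ ((1 - x) * (1 - k%:R * x))); last first.
  by rewrite ler_wpM2l // subr_ge0.
have k0 : 0 <= k%:R :> R by [].
have : 0 <= k%:R * (x * x) by rewrite !mulr_ge0.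
rewrite -natr1; nra.
Qed.

Section Perturbation.
Variables (R : realType) (d : nat) (A : alphabetType) (c : nat).
Hypothesis c0 : (0 < c)%N.
Notation m := c.*2.+1.
Notation NS := (m ^ d)%N.
Variables (gamma gamma' : A -> R) (beta beta' : 'I_d -> A -> A -> R) (t rho : R).
Hypotheses (t0 : 0 < t) (rho0 : 0 <= rho) (rho1 : rho <= 1).
Hypothesis gamma_ge0 : forall x, 0 <= gamma x.
Hypothesis beta_ge0 : forall i y x, 0 <= beta i y x.
Hypothesis gammaP : forall x, (1 - rho) * gamma' x <= t * gamma x <= gamma' x.
Hypothesis betaP : forall i y x,
  (1 - rho) * beta' i y x <= t * beta i y x <= beta' i y x.

(** [s] collects one factor [t] per site and per edge inside [U]. It does not depend on [w], so it
    cancels in quotients; the exponent [d.+1 * NS] bounds the number of factors. *)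
Lemma interaction_perturb (U : {fset 'rV[int]_d}) :
  (forall v, v \in U -> in_box c v) ->
  exists2 s : R, 0 < s & forall w : 'rV[int]_d -> A,
    (1 - rho) ^+ (d.+1 * NS) * interaction gamma' beta' (conf U w) <=
      s * interaction gamma beta (conf U w) <= interaction gamma' beta' (conf U w).
Proof.
move=> Uc; have r1 : 0 <= 1 - rho by rewrite subr_ge0.
have g'0 x : 0 <= gamma' x.
  have /andP[_] := gammaP x; apply: le_trans; exact: mulr_ge0 (ltW t0) _.
have b'0 i y x : 0 <= beta' i y x.
  have /andP[_] := betaP i y x; apply: le_trans; exact: mulr_ge0 (ltW t0) _.
pose P p := vtx d c p \in U.
pose B p (i : 'I_d) := (1 <= digit m i p)%N && (vtx d c (p - m ^ i)%N \in U).
exists (\prod_(p < NS | P p) (t * \prod_(i < d) (if B p i then t else 1))).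
  apply: prodr_gt0 => p _; apply: mulr_gt0 => //; apply: prodr_gt0 => i _.
  by case: ifP.
move=> w.
have int g b : interaction g b (conf U w) =
    \prod_(p < NS | P p) (g (w (vtx d c p)) * \prod_(i < d) (if B p i then
       b i (w (vtx d c (p - m ^ i)%N)) (w (vtx d c p)) else 1)) :> R.
  exact: interaction_conf.
rewrite !int -big_split /=.
have scale p : t * \prod_(i < d) (if B p i then t else 1) *
    (gamma (w (vtx d c p)) * \prod_(i < d) (if B p i then
       beta i (w (vtx d c (p - m ^ i)%N)) (w (vtx d c p)) else 1)) =
    t * gamma (w (vtx d c p)) * \prod_(i < d) (if B p i then
       t * beta i (w (vtx d c (p - m ^ i)%N)) (w (vtx d c p)) else 1).
  rewrite mulrACA; congr (_ * _); rewrite -big_split /=; apply: eq_bigr => i _.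
  by case: ifP => // _; rewrite mulr1.
under [X in _ <= X <= _]eq_bigr => p _ do rewrite scale.
apply/andP; split; last first.
  apply: ler_prod => p _; rewrite mulr_ge0 ?mulr_ge0 ?(ltW t0) //=; last first.
    by apply: prodr_ge0 => i _; case: ifP => // _; rewrite mulr_ge0 // ltW.
  have /andP[_ gp] := gammaP (w (vtx d c p)).
  apply: ler_pM => //; first by rewrite mulr_ge0 // ltW.
    by apply: prodr_ge0 => i _; case: ifP => // _; rewrite mulr_ge0 // ltW.
  apply: ler_prod => i _; case: (B p i); last by rewrite ler01 lexx.
  by have /andP[_ ->] := betaP i (w (vtx d c (p - m ^ i)%N)) (w (vtx d c p)); rewrite mulr_ge0 // ltW.
have le1 k l : (k <= l)%N -> (1 - rho) ^+ l <= (1 - rho) ^+ k.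
  by move=> kl; apply: ler_wiXn2l => //; rewrite gerBl.
apply: (@le_trans _ _ (\prod_(p < NS | P p) ((1 - rho) ^+ d.+1 *
   (gamma' (w (vtx d c p)) * \prod_(i < d) (if B p i then
       beta' i (w (vtx d c (p - m ^ i)%N)) (w (vtx d c p)) else 1))))).
  rewrite [leRHS]big_split /= ler_wpM2r //.
    apply: prodr_ge0 => p _; apply: mulr_ge0 => //; apply: prodr_ge0 => i _.
    by case: ifP.
  rewrite prodr_const -exprM; apply: le1; rewrite leq_mul2l /=.
  by rewrite (leq_trans (max_card _)) ?card_ord.
apply: ler_prod => p _; apply/andP; split.
  apply: mulr_ge0; first exact: exprn_ge0.
  by apply: mulr_ge0 => //; apply: prodr_ge0 => i _; case: ifP.
rewrite exprS mulrACA; apply: ler_pM.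
- exact: mulr_ge0.
- by apply: mulr_ge0; [exact: exprn_ge0|apply: prodr_ge0 => i _; case: ifP].
- by have /andP[] := gammaP (w (vtx d c p)).
rewrite -[X in _ ^+ X]card_ord -prodr_const -big_split /=.
apply: ler_prod => i _; case: (B p i).
  have /andP[-> _] := betaP i (w (vtx d c (p - m ^ i)%N)) (w (vtx d c p)).
  by rewrite mulr_ge0.
by rewrite mulr1 r1 gerBl.
Qed.

End Perturbation.

Section Position.
Variables (d n c : nat) (K : {fset 'rV[int]_d}).
Hypothesis nc : (n < c)%N.
Hypothesis Kbox : forall v, v \in K -> in_box n v && (v != 0).
Notation Vi := (inner d c).
Notation BV := (boundary Vi).

Let c0 : (0 < c)%N. Proof. by apply: leq_ltn_trans nc. Qed.

(** A boundary site has a coordinate of absolute value [c], while those of [u] are at most [n]. *)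
Lemma inner_dist (u v : 'rV[int]_d) : in_box n u -> v \in BV -> (c - n <= l1dist u v)%N.
Proof.
move=> /forallP un vB; have := rim_ext c0 (rim_box c0 vB); rewrite vB => /esym/eqP e1.
have [i vi] : exists i, `|v ord0 i|%N == c.
  apply/existsP; apply: contra_eqT e1; rewrite negb_exists => /forallP h.
  by rewrite /ext big1 // => i _; rewrite (negbTE (h i)).
apply: (@leq_trans `|(u ord0 i - v ord0 i)%R|%N); last first.
  by rewrite /l1dist (bigD1 i) //= leq_addr.
have := un i; move: vi => /eqP; move: (u ord0 i : int) (v ord0 i : int) => x y; lia.
Qed.

Lemma K_inner v : v \in K -> (v \in Vi) && (v != 0).
Proof.
move=> /Kbox/andP[/forallP h ->]; rewrite andbT in_inner; apply/forallP => i.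
by have := h i; lia.
Qed.

Lemma K_box v : v \in K -> in_box c v.
Proof.
move=> /Kbox/andP[/forallP h _]; apply/forallP => i.
by have := h i; lia.
Qed.

End Position.

Section Approximation.
Variables (R : realType) (m : nat).
Notation t := (2 ^+ m : R).

Let t0 : 0 < t. Proof. by rewrite exprn_gt0. Qed.

Lemma approximates_scaled (f : nat -> int) (x : R) : approximates f x ->
  `|t * x - (f m)%:~R| <= 1.
Proof.
move=> /(_ m) h; have -> : t * x - (f m)%:~R = t * (x - (f m)%:~R / t).
  by field; rewrite lt0r_neq0.
by rewrite normrM (gtr0_norm t0) -ler_pdivlMl // mulr1.
Qed.

Lemma approx_ge0 (f : nat -> int) (x : R) : approximates f x -> 0 < x -> 0 <= f m.
Proof.
move=> /approximates_scaled + x0; rewrite ler_norml => /andP[_ h].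
have tx : 0 < t * x by rewrite mulr_gt0.
have : - 1 < (f m)%:~R :> R by lra.
rewrite -[-1]/((-1)%:~R) ltr_int; lia.
Qed.

Lemma approx_upper (f : nat -> int) (x : R) : approximates f x -> 0 <= f m ->
  t * x <= (`|f m|.+1)%:R <= t * x + 2.
Proof.
move=> /approximates_scaled + f0; rewrite ler_norml.
have -> : (f m)%:~R = (`|f m|%N)%:R :> R by rewrite -[in LHS](gez0_abs f0) pmulrn.
rewrite -natr1 => /andP[h1 h2]; apply/andP; split; lra.
Qed.

End Approximation.

Section AtCenter.
Variables (R : realType) (d : nat) (A : alphabetType) (supp : 'I_d -> rel A).
Variables (gamma : A -> R) (beta : 'I_d -> A -> A -> R).
Variable O : oracle d A.
Variables (n c : nat).
Hypotheses (d0 : (0 < d)%N) (nc : (n < c)%N).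
Hypothesis gamma_gt0 : forall a, 0 < gamma a.
Hypothesis beta_ge0 : forall i a b, 0 <= beta i a b.
Hypothesis suppE : forall i a b, (0 < beta i a b) = supp i a b.
Hypothesis gammaA : forall a, approximates (gamma_approx O a) (gamma a).
Hypothesis betaA : forall i a b, approximates (beta_approx O i a b) (beta i a b).
Hypothesis Kbox : forall v, v \in oracle_set O n -> in_box n v && (v != 0).
Notation m := c.*2.+1.
Notation NS := (m ^ d)%N.
Notation q := #|A|.
Notation N := (bigN O n c).
Notation Vi := (inner d c).
Notation BV := (boundary Vi).
Notation K := (oracle_set O n).
Notation rgam := (@rgam R d A O c).
Notation rbet := (@rbet R d A supp O c).
Notation t := (2 ^+ m : R).

Let c0 : (0 < c)%N. Proof. by apply: leq_ltn_trans nc. Qed.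
Let t0 : 0 < t. Proof. by rewrite exprn_gt0. Qed.
Let N0 : (0 < N)%N. Proof. by rewrite expn_gt0 card_gt0. Qed.

Lemma gam_approx_ge0 x : 0 <= gamma_approx O x m.
Proof. exact: approx_ge0 (gammaA x) _. Qed.

Lemma bet_approx_ge0 i y x : supp i y x -> 0 <= beta_approx O i y x m.
Proof. by rewrite -suppE; exact: approx_ge0. Qed.

Let rho : R := 2 / (thr O n c)%:R.

Let thr0 : 0 < (thr O n c)%:R :> R.
Proof. by rewrite ltr0n /thr !muln_gt0 expn_gt0 N0. Qed.
Let rho0 : 0 <= rho. Proof. by rewrite /rho divr_ge0. Qed.
Let rho1 : rho <= 1.
Proof.
rewrite /rho ler_pdivrMr // mul1r ler_nat /thr.
have h : (0 < NS * N)%N by rewrite muln_gt0 expn_gt0.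
by move: h; rewrite -mulnA; set x := (NS * N)%N; nia.
Qed.

Lemma precise_close (f : nat -> int) (x : R) : approximates f x ->
  0 <= f m -> (thr O n c <= `|f m|)%N ->
  (1 - rho) * (`|f m|.+1)%:R <= t * x <= (`|f m|.+1)%:R.
Proof.
move=> fx f0 th; have /andP[-> h2] := approx_upper fx f0; rewrite andbT.
have : 2 <= rho * (`|f m|.+1)%:R.
  rewrite /rho mulrAC ler_pdivlMr // ler_pM2l // ler_nat; exact: leqW.
by rewrite mulrBl mul1r; lra.
Qed.

Lemma weights_close : precise supp O n c ->
  (forall x, (1 - rho) * rgam x <= t * gamma x <= rgam x) /\
  (forall i y x, (1 - rho) * rbet i y x <= t * beta i y x <= rbet i y x).
Proof.
move=> /andP[/forallP pg /forallP pb]; split=> [x|i y x].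
  by apply: precise_close; [exact: gammaA|exact: gam_approx_ge0|exact: pg].
rewrite /rbet /bet; case: ifPn => s.
  apply: precise_close; [exact: betaA|exact: bet_approx_ge0|].
  by have /forallP/(_ y)/forallP/(_ x) := pb i; rewrite s.
suff -> : beta i y x = 0 by rewrite !mulr0 lexx.
by apply/eqP; rewrite eq_le beta_ge0 andbT leNgt suppE.
Qed.

Lemma rgam_gt0 x : 0 < rgam x. Proof. by rewrite ltr0n. Qed.
Lemma rbet_ge0 i y x : 0 <= rbet i y x. Proof. by []. Qed.

Notation Z := (partition_fun gamma beta).
Notation Z' := (partition_fun rgam rbet).

(** One [s] serves all boundary conditions and events, so it will cancel in ratios. Bernoulli's
    inequality and the choice of [thr] give the relative error 1/(8N). *)
Lemma rel_err : precise supp O n c ->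
  exists2 s : R, 0 < s & forall (delta : cfg A BV) (E : pred (cfg A Vi)),
    (1 - (8 * N)%:R^-1) * Z' delta E <= s * Z delta E <= Z' delta E.
Proof.
move=> /weights_close[hg hb].
have [s s0 hs] := interaction_perturb c0 t0 rho0 rho1 (fun x => ltW (gamma_gt0 x))
  beta_ge0 hg hb (@region_box d c d0 c0).
exists s => // delta E; rewrite /partition_fun !big_distrr /=.
have eps : 1 - (8 * N)%:R^-1 <= (1 - rho) ^+ (d.+1 * NS).
  apply: le_trans (bernoulli _ rho0 rho1); rewrite lerD2l lerN2 /rho.
  have M0 : (d.+1 * NS)%:R != 0 :> R by rewrite pnatr_eq0 muln_eq0 -!lt0n expn_gt0.
  have Nn0 : N%:R != 0 :> R by rewrite pnatr_eq0 -lt0n.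
  have -> : (thr O n c)%:R = 16 * (d.+1 * NS)%:R * N%:R :> R.
    by rewrite -!natrM /thr mulnA.
  rewrite (natrM _ 8 N) le_eqVlt; apply/orP; left; apply/eqP.
  move: M0 Nn0; move: ((d.+1 * NS)%:R : R) (N%:R : R) => x y x0 y0; field.
  by rewrite x0 y0.
apply/andP; split; apply: ler_sum => w _.
  have /andP[h _] := hs (fun v => if v \in Vi then extend w v else extend delta v).
  rewrite concat_extend ?disjoint_rim //; apply: le_trans h.
  rewrite ler_wpM2r //; apply: interaction_ge0 ; [exact: rgam_gt0|exact: rbet_ge0].
have /andP[_ h] := hs (fun v => if v \in Vi then extend w v else extend delta v).
by rewrite concat_extend ?disjoint_rim.
Qed.

(** [rel_err] bounds each partition function by a positive multiple of the other, so the computed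
    one decides admissibility. *)
Lemma admissible_Z' (delta : cfg A BV) : precise supp O n c ->
  admissible gamma beta delta <-> 0 < Z' delta predT.
Proof.
move=> /rel_err[s s0 /(_ delta predT) /andP[h1 h2]].
have e : 0 < 1 - (8 * N)%:R^-1 :> R.
  rewrite subr_gt0 invf_lt1 ?ltr0n ?ltr1n; lia.
rewrite (admissibleP gamma_gt0 beta_ge0); split=> h.
  by apply: lt_le_trans h2; rewrite mulr_gt0.
have : 0 < s * Z delta predT by apply: lt_le_trans h1; rewrite mulr_gt0.
by rewrite pmulr_rgt0.
Qed.

(** With e = 1/(8N), [rel_err] for numerator and denominator shows that the exact quotient u and the
    approximate quotient v satisfy (1 - e)v ≤ u and (1 - e)u ≤ v; since v ≤ 1 and u ≤ 2, they differ
    by at most 2e. *)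
Lemma spec_mass_close (delta : cfg A BV) (E : pred (cfg A Vi)) : precise supp O n c -> admissible gamma beta delta ->
  `|spec_mass gamma beta delta E - Z' delta E / Z' delta predT| <= (4 * N)%:R^-1.
Proof.
move=> pc ad; have /(admissible_Z' _ pc) z' := ad.
have [s s0 hs] := rel_err pc.
have /andP[a1 a2] := hs delta E; have /andP[b1 b2] := hs delta predT.
have zT : 0 < Z delta predT by apply/(admissibleP gamma_gt0 beta_ge0).
rewrite spec_massE.
have -> : Z delta E / Z delta predT = (s * Z delta E) / (s * Z delta predT).
  by field; rewrite !lt0r_neq0.
have sT : 0 < s * Z delta predT by rewrite mulr_gt0.
have ET : Z' delta E <= Z' delta predT.
  rewrite /partition_fun [leLHS]big_mkcond /=; apply: ler_sum => w _.
  by case: ifP => // _; apply: interaction_ge0 ; [exact: rgam_gt0|exact: rbet_ge0].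
have E0 : 0 <= Z' delta E.
  by apply: partition_fun_ge0 ; [exact: rgam_gt0|exact: rbet_ge0].
have -> : (4 * N)%:R^-1 = 2 * (8 * N)%:R^-1 :> R.
  by rewrite !natrM; field; rewrite pnatr_eq0 -lt0n.
have eps0 : 0 < (8 * N)%:R^-1 :> R by rewrite invr_gt0 ltr0n muln_gt0 N0.
have eps1 : (8 * N)%:R^-1 <= 8^-1 :> R.
  by rewrite lef_pV2 ?posrE ?ltr0n ?muln_gt0 ?N0 // ler_nat leq_pmulr.
move: eps0 eps1 a1 a2 b1 b2 z' sT ET E0.
move: (_^-1) (s * Z delta E) (s * Z delta predT) (Z' delta E) (Z' delta predT).
move=> e x y x' y' e0 e1 a1 a2 b1 b2 z' sT ET E0.
set u := x / y; set v := x' / y'.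
have ue : x = u * y by rewrite /u divfK // lt0r_neq0.
have ve : x' = v * y' by rewrite /v divfK // lt0r_neq0.
have v0 : 0 <= v by rewrite /v divr_ge0 // ltW.
have v1 : v <= 1 by rewrite /v ler_pdivrMr // mul1r.
have u0 : 0 <= u.
  rewrite /u divr_ge0 ?(ltW sT) //; apply: le_trans a1; rewrite mulr_ge0 // subr_ge0.
  lra.
rewrite ler_norml; apply/andP; split.
  have : (1 - e) * v <= u.
    rewrite /u ler_pdivlMr //; apply: le_trans a1.
    rewrite -mulrA; apply: ler_wpM2l; first by rewrite subr_ge0; lra.
    by rewrite ve ler_wpM2l.
  have : e * v <= e by apply: ler_piMr => //; exact: ltW.
  rewrite mulrBl mul1r; lra.
have eu : e * u <= 8^-1 * u by apply: ler_wpM2r.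
have : (1 - e) * u <= v.
  rewrite /v ler_pdivlMr //; apply: le_trans a2.
  have -> : (1 - e) * u * y' = u * ((1 - e) * y') by ring.
  by rewrite ue ler_wpM2l.
rewrite mulrBl mul1r => h.
have u2 : u <= 2 by lra.
have : e * u <= e * 2 by apply: ler_wpM2l => //; exact: ltW.
lra.
Qed.

Definition word (W : nat) : cfg A K := decode A c (isK O n c) K W.

Definition tau (W : nat) (a : A) (v : 'rV[int]_d) : A :=
  if v == 0 then a else extend (word W) v.

Lemma zval_partition D W a (free : bool) (delta : cfg A BV) :
  decode A c (rim d c) BV D = delta ->
  (zval supp O n c D W (rank a) free)%:R =
  Z' delta (fun w => free || matches (mem (0 |` K)) (tau W a) w).
Proof.
move=> dE; rewrite /partition_fun.
apply: (@zvalE R d A supp O n c d0 c0 (K_inner nc Kbox) D W (rank a) free delta (tau W a)).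
- by move=> p pN pB; rewrite -dE decodeE.
- move=> p pN pK; rewrite /tau ifF; first by rewrite (decodeE _ c0).
  by have /andP[_ /negbTE] := K_inner nc Kbox pK.
- by rewrite /tau eqxx rankK.
- exact: rank_lt.
Qed.

End AtCenter.

(** * Certified bounds on masses of words *)

Section LoHi.
Variables (d : nat) (A : alphabetType) (supp : 'I_d -> rel A).
Variables (O : oracle d A) (n c W a : nat).
Notation valid D := (1 <= zval supp O n c D W a true)%N.
Notation ratio D := (ratio supp O n c D W a).
Notation lo D := (lo supp O n c D W a).
Notation hi D := (hi supp O n c D W a).

Lemma lo_hi_ratio D D' : (D' < D)%N -> valid D' -> (lo D <= ratio D' <= hi D)%N.
Proof.
elim: D => //= D IH; rewrite ltnS leq_eqVlt => /orP[/eqP <-|D'D] v.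
  rewrite v /=; case: ifP => h1; case: ifP => h2; rewrite ?leqnn ?andbT //=.
  - by move: h2; lia.
  - by move: h1; lia.
  - by move: h1 h2; lia.
have /andP[h1 h2] := IH D'D v; apply/andP; split.
  case: ifP => // /andP[_ h]; exact: leq_trans h h1.
case: ifP => // /andP[_ h]; exact: leq_trans h2 h.
Qed.

Lemma lo_cases D : lo D = bigN O n c \/ exists D', [/\ (D' < D)%N, valid D' & lo D = ratio D'].
Proof.
elim: D => [|D IH] /=; first by left.
case: ifP => [/andP[v _]|_]; first by right; exists D.
by case: IH => [->|[D' [h1 h2 h3]]]; [left|right; exists D'; split => //; exact: ltnW].
Qed.

Lemma hi_cases D : hi D = 0%N \/ exists D', [/\ (D' < D)%N, valid D' & hi D = ratio D'].
Proof.
elim: D => [|D IH] /=; first by left.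
case: ifP => [/andP[v _]|_]; first by right; exists D.
by case: IH => [->|[D' [h1 h2 h3]]]; [left|right; exists D'; split => //; exact: ltnW].
Qed.

End LoHi.

Section Certificate.
Variables (R : realType) (d : nat) (A : alphabetType) (supp : 'I_d -> rel A).
Variables (gamma : A -> R) (beta : 'I_d -> A -> A -> R).
Variable O : oracle d A.
Variables (n c : nat).
Hypotheses (d0 : (0 < d)%N) (nc : (n < c)%N).
Hypothesis gamma_gt0 : forall a, 0 < gamma a.
Hypothesis beta_ge0 : forall i a b, 0 <= beta i a b.
Hypothesis suppE : forall i a b, (0 < beta i a b) = supp i a b.
Hypothesis gammaA : forall a, approximates (gamma_approx O a) (gamma a).
Hypothesis betaA : forall i a b, approximates (beta_approx O i a b) (beta i a b).
Hypothesis Kbox : forall v, v \in oracle_set O n -> in_box n v && (v != 0).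
Notation m := c.*2.+1.
Notation q := #|A|.
Notation N := (bigN O n c).
Notation Vi := (inner d c).
Notation BV := (boundary Vi).
Notation K := (oracle_set O n).
Hypothesis pc : precise supp O n c.

Let c0 : (0 < c)%N. Proof. by apply: leq_ltn_trans nc. Qed.
Let N0 : (0 < N)%N. Proof. by rewrite expn_gt0 card_gt0. Qed.
Let Nr : 0 < N%:R :> R. Proof. by rewrite ltr0n. Qed.
Let Ki := K_inner nc Kbox.

Notation Z' := (partition_fun (@rgam R d A O c) (@rbet R d A supp O c)).
Notation smass := (@spec_mass R d A gamma beta Vi).
Notation event W a := (matches (mem (0 |` K)) (tau O n c W a)).

Lemma ratio_floor W (a : A) D (delta : cfg A BV) :
  decode A c (rim d c) BV D = delta -> admissible gamma beta delta ->
  (1 <= zval supp O n c D W (rank a) true)%N /\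
  (ratio supp O n c D W (rank a))%:R <=
    N%:R * (Z' delta (event W a) / Z' delta predT) <
  (ratio supp O n c D W (rank a)).+1%:R.
Proof.
move=> dE ad.
have zT : (zval supp O n c D W (rank a) true)%:R = Z' delta predT.
  by rewrite (@zval_partition R d A supp O n c d0 nc Kbox _ _ _ true delta).
have zE : (zval supp O n c D W (rank a) false)%:R = Z' delta (event W a).
  by rewrite (@zval_partition R d A supp O n c d0 nc Kbox _ _ _ false delta).
have /(admissible_Z' d0 nc gamma_gt0 beta_ge0 suppE gammaA betaA _ pc) := ad.
rewrite -zT ltr0n => z0; split => //; rewrite -zE /ratio mulrA -natrM.
have zr : 0 < (zval supp O n c D W (rank a) true)%:R :> R by rewrite ltr0n.
rewrite ler_pdivlMr // -natrM ler_nat leq_divM ltr_pdivrMr // -natrM ltr_nat.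
by rewrite ltn_ceil.
Qed.

Lemma valid_admissible W (a : A) D :
  (1 <= zval supp O n c D W (rank a) true)%N ->
  admissible gamma beta (decode A c (rim d c) BV D).
Proof.
move=> z; apply/(admissible_Z' d0 nc gamma_gt0 beta_ge0 suppE gammaA betaA _ pc).
have := @zval_partition R d A supp O n c d0 nc Kbox D W a true _ erefl.
by rewrite /= => <-; rewrite ltr0n.
Qed.

Variable mu : probability (borel_fullshift d A) R.
Hypothesis gibbs : gibbs_measure gamma beta mu.

(** By convexity it suffices to treat each admissible δ. Its floor is within 1 of [lof] because the
    word is good, rounding down loses less than 1, and the approximate weights cost at most 1/4. *)
Lemma lof_close W (a : A) : good supp O n c W (rank a) ->
  `|N%:R * pr mu (conf (0 |` K) (tau O n c W a)) - (lof supp O n c W (rank a))%:R| <= 3.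
Proof.
move=> gd; set l := (lof _ _ _ _ _ _)%:R.
suff H : `|pr mu (conf (0 |` K) (tau O n c W a)) - l / N%:R| <= 3 / N%:R.
  have -> : N%:R * pr mu (conf (0 |` K) (tau O n c W a)) - l =
      N%:R * (pr mu (conf (0 |` K) (tau O n c W a)) - l / N%:R).
    by field; rewrite lt0r_neq0.
  by rewrite normrM gtr0_norm // -ler_pdivlMl // [leRHS]mulrC.
apply: (mixture_bound gibbs (V := Vi)).
  apply/fsubsetP => v; rewrite in_fset1U => /orP[/eqP ->|/Ki/andP[]//].
  exact: zero_inner.
move=> delta ad.
have [D Dlt dE] := decode_surj (P := rim d c) c0 (@rim_boundary d c c0) (@rim_box d c c0) delta.
have [v /andP[r1 r2]] := ratio_floor W a dE ad.
have /andP[l1 l2] := lo_hi_ratio Dlt v.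
have lr : (lof supp O n c W (rank a) <= ratio supp O n c D W (rank a))%N := l1.
have rh : (ratio supp O n c D W (rank a) <= lof supp O n c W (rank a) + 1)%N.
  exact: leq_trans l2 gd.
have sc := spec_mass_close d0 nc gamma_gt0 beta_ge0 suppE gammaA betaA (event W a) pc ad.
set S := smass delta _ in sc *; set L := _ / _ in sc r1 r2.
have -> : S - l / N%:R = (N%:R * S - l) / N%:R by field; rewrite lt0r_neq0.
rewrite normrM (ger0_norm (x := N%:R^-1)) ?invr_ge0 // ler_wpM2r ?invr_ge0 //.
have NSL : `|N%:R * S - N%:R * L| <= 4^-1.
  rewrite -mulrBr normrM gtr0_norm //; apply: le_trans (ler_wpM2l (ltW Nr) sc) _.
  by rewrite natrM invfM mulrCA divff ?mulr1 // lt0r_neq0.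
have lr' : l <= (ratio supp O n c D W (rank a))%:R by rewrite ler_nat.
have rh' : (ratio supp O n c D W (rank a))%:R <= l + 1 :> R by rewrite natr1 ler_nat -addn1.
move: NSL; rewrite -natr1 in r2; rewrite !ler_norml => /andP[k1 k2].
apply/andP; split; lra.
Qed.

(** In units of 1/N, the approximate weights cost 1/4 on each side and the change of boundary
    condition another 1/4, so the unrounded ratios differ by at most 3/4 and their floors by at most
    1. *)
Lemma good_close W (a : A) :
  (forall delta eta : cfg A BV, admissible gamma beta delta -> admissible gamma beta eta ->
     `|smass delta (event W a) - smass eta (event W a)| <= (4 * N)%:R^-1) ->
  good supp O n c W (rank a).
Proof.
move=> close; rewrite /good /hif /lof.
have ratio_le D : (1 <= zval supp O n c D W (rank a) true)%N ->
    (ratio supp O n c D W (rank a) <= N)%N.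
  move=> v; have ad := valid_admissible v.
  have [_ /andP[r1 _]] := ratio_floor W a erefl ad.
  have /(admissible_Z' d0 nc gamma_gt0 beta_ge0 suppE gammaA betaA _ pc) z0 := ad.
  rewrite -(ler_nat R); apply: le_trans r1 _; apply: ler_piMr; first exact: ltW.
  rewrite ler_pdivrMr // mul1r /partition_fun [leLHS]big_mkcond /=; apply: ler_sum => w _.
  by case: ifP => // _; apply: interaction_ge0; [exact: rgam_gt0|exact: rbet_ge0].
have [->|[D [_ v ->]]] := hi_cases supp O n c W (rank a) (q ^ nrim d c); first by [].
have [->|[D' [_ v' ->]]] := lo_cases supp O n c W (rank a) (q ^ nrim d c).
  by apply: leq_trans (ratio_le _ v) _; rewrite leq_addr.
have ad := valid_admissible v; have ad' := valid_admissible v'.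
have [_ /andP[r1 _]] := ratio_floor W a erefl ad.
have [_ /andP[_ r2]] := ratio_floor W a erefl ad'.
have s1 := spec_mass_close d0 nc gamma_gt0 beta_ge0 suppE gammaA betaA (event W a) pc ad.
have s2 := spec_mass_close d0 nc gamma_gt0 beta_ge0 suppE gammaA betaA (event W a) pc ad'.
have s3 := close _ _ ad ad'.
have scale (x y : R) : `|x - y| <= (4 * N)%:R^-1 -> `|N%:R * x - N%:R * y| <= 4^-1.
  move=> h; rewrite -mulrBr normrM gtr0_norm //; apply: le_trans (ler_wpM2l (ltW Nr) h) _.
  by rewrite natrM invfM mulrCA divff ?mulr1 // lt0r_neq0.
have := scale _ _ s1; have := scale _ _ s2; have := scale _ _ s3.
rewrite !ler_norml => /andP[a1 a2] /andP[b1 b2] /andP[e1 e2].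
rewrite addn1 -ltnS.
rewrite -(ltr_nat R); apply: le_lt_trans r1 _.
rewrite -natr1; lra.
Qed.

End Certificate.

(** * Correctness of the output *)

Section CondEntropy.
Variables (R : realType) (d : nat) (A : alphabetType).
Variable mu : probability (borel_fullshift d A) R.
Variable K : {fset 'rV[int]_d}.
Hypothesis K0 : 0 \notin K.

(** A word on the union of {0} and [K] is a word on [K] and a letter at 0. Positive mass of the word
    forces positive mass of its restriction, so one of the two conditions on the terms suffices. *)
Lemma cond_entropy_sum :
  cond_entropy mu [fset 0] K =
  \sum_(w : cfg A K) \sum_(a | 0 < pr mu (conf (0 |` K) (fun v => if v == 0 then a else extend w v)))
    - (pr mu (conf (0 |` K) (fun v => if v == 0 then a else extend w v)) *
       ln (pr mu (conf (0 |` K) (fun v => if v == 0 then a else extend w v)) / pr mu w)).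
Proof.
pose h (wa : cfg A K * A) : cfg A (0 |` K) :=
  conf (0 |` K) (fun v => if v == 0 then wa.2 else extend wa.1 v).
have zK : 0 \in 0 |` K by exact: fset1U1.
pose h' (z : cfg A (0 |` K)) : cfg A K * A :=
  (conf K (extend z), z [` zK]).
have hK : cancel h h'.
  move=> [w a]; rewrite /h' /h; congr (_, _); last by rewrite ffunE /= eqxx.
  apply/ffunP => u; have uK : val u \in 0 |` K by rewrite in_fset1U (fsvalP u) orbT.
  rewrite ffunE extend_conf // ifF ?extend_in //.
  by apply: contraNF K0 => /eqP <-; exact: fsvalP.
have h'K : cancel h' h.
  move=> z; apply/ffunP => u; rewrite ffunE /=; case: eqP => [u0|/eqP u0].
    by congr (z _); apply/val_inj.
  have uK : val u \in K by have := fsvalP u; rewrite in_fset1U (negbTE u0).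
  by rewrite extend_conf // extend_in.
have resE wa : restr (fsubsetUr [fset 0] K) (h wa) = wa.1.
  apply/ffunP => u; rewrite !ffunE /= ifF ?extend_in //.
  by apply: contraNF K0 => /eqP <-; exact: fsvalP.
rewrite /cond_entropy (reindex h); last by exists h' => ? _; [exact: hK|exact: h'K].
under [RHS]eq_bigr => w _ do rewrite big_mkcond /=.
rewrite pair_big big_mkcond /=; apply: eq_bigr => -[w a] _; rewrite resE /=.
rewrite -/(h (w, a)); case: ifPn => [/andP[_ ->] //|].
case: ifPn => // pa /negP[]; rewrite andbT; apply: lt_le_trans pa _.
apply: mass_le; try exact: measurable_cylinder.
move=> p hp s; have sK : val s \in 0 |` K by rewrite in_fset1U (fsvalP s) orbT.
have := hp [` sK]; rewrite ffunE /= ifF ?extend_in //.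
by apply: contraNF K0 => /eqP <-; exact: fsvalP.
Qed.

End CondEntropy.

Section Output.
Variables (R : realType) (d : nat) (A : alphabetType) (supp : 'I_d -> rel A).
Variables (gamma : A -> R) (beta : 'I_d -> A -> A -> R).
Variable O : oracle d A.
Variables (n c : nat).
Hypotheses (d0 : (0 < d)%N) (nc : (n < c)%N) (A2 : (2 <= #|A|)%N).
Hypothesis gamma_gt0 : forall a, 0 < gamma a.
Hypothesis beta_ge0 : forall i a b, 0 <= beta i a b.
Hypothesis suppE : forall i a b, (0 < beta i a b) = supp i a b.
Hypothesis gammaA : forall a, approximates (gamma_approx O a) (gamma a).
Hypothesis betaA : forall i a b, approximates (beta_approx O i a b) (beta i a b).
Hypothesis Kbox : forall v, v \in oracle_set O n -> in_box n v && (v != 0).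
Notation q := #|A|.
Notation N := (bigN O n c).
Notation K := (oracle_set O n).
Variable mu : probability (borel_fullshift d A) R.
Hypothesis gibbs : gibbs_measure gamma beta mu.
Hypothesis pc : precise supp O n c.
Hypothesis ag : all_good supp O n c (q ^ kap O n c).

Let c0 : (0 < c)%N. Proof. by apply: leq_ltn_trans nc. Qed.
(** The exponent is a budget: [kap] for the number of words, [2 * n ^ d.-1 + 1] for the tolerance,
    and 6 for [10 * q ^ 2 <= q ^ 6]; the rest is slack. *)
Let r := (q ^ (kap O n c + (2 * n ^ d.-1 + 10)))%N.
Let NE : N = (r * r)%N.
Proof. by rewrite /r -expnD /bigN /expN; congr (_ ^ _)%N; lia. Qed.
Let K0 : 0 \notin K.
Proof. by apply/negP => /Kbox; rewrite eqxx andbF. Qed.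

Let x (W : 'I_(q ^ kap O n c)) (a : A) : R := pr mu (conf (0 |` K) (tau O n c W a)).
Let l (W : 'I_(q ^ kap O n c)) (a : A) : nat := lof supp O n c W (rank a).

Let goodWa (W : 'I_(q ^ kap O n c)) (a : A) : good supp O n c W (rank a).
Proof.
move: ag; rewrite /all_good big_andE => /forallP/(_ W); rewrite /= big_andE.
by move=> /forallP/(_ (Ordinal (rank_lt a))).
Qed.

Let xsum W : \sum_a x W a = pr mu (word O n c W).
Proof.
rewrite -[word _ _ _ _]conf_extend (@pr_sum _ _ _ mu K (extend (word O n c W)) 0 K0).
by apply: eq_bigr.
Qed.

Lemma cond_entropy_codes : cond_entropy mu [fset 0] K =
  \sum_W \sum_(a | 0 < x W a) - (x W a * ln (x W a / \sum_b x W b)).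
Proof.
rewrite (cond_entropy_sum mu K0).
rewrite -(sum_decode c0 (P := isK O n c) (fun=> erefl) (K_box nc Kbox)).
by apply: eq_bigr => W _; rewrite xsum.
Qed.

Lemma numer_sum : (numer supp O n c)%:~R =
  (\sum_W (\sum_a l W a) * hsum (N * N) (\sum_a l W a))%N%:R -
  (\sum_W \sum_a l W a * hsum (N * N) (l W a))%N%:R :> R.
Proof.
rewrite /numer intrB !pmulrn /Hplus /Hminus; congr (_%:R - _%:R).
  apply: eq_bigr => W _.
  suff -> : smf supp O n c W = (\sum_a l W a)%N by [].
  rewrite /smf -(sum_letter (fun a => l W a)).
  by apply: eq_bigr => k _; rewrite /l letterK.
apply: eq_bigr => W _; rewrite -(sum_letter (fun a => l W a * hsum (N * N) (l W a))%N).
by apply: eq_bigr => k _; rewrite /l letterK.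
Qed.

Let margin_exact : (margin O n c * q ^ (2 * n ^ d.-1 + 1))%N = (N ^ 3)%N.
Proof.
rewrite /margin divnK; first by rewrite !expnS expn0 muln1 mulnA.
by rewrite /bigN -!expnD dvdn_exp2l // /expN; lia.
Qed.

Lemma margin_ratio : (margin O n c)%:R / (N ^ 3)%:R = (q%:R ^+ (2 * n ^ d.-1 + 1))^-1 :> R.
Proof.
rewrite -margin_exact natrM natrX.
have m0 : (margin O n c)%:R != 0 :> R.
  rewrite pnatr_eq0; apply/eqP => m0; have := margin_exact; rewrite m0 mul0n => E.
  have : (0 < N ^ 3)%N by rewrite !expn_gt0 card_gt0.
  by rewrite -E.
have q0 : q%:R != 0 :> R by rewrite pnatr_eq0 -lt0n card_gt0.
move: (2 * _ + 1)%N => e; field.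
by rewrite m0 expf_neq0.
Qed.

Lemma output_close :
  `|cond_entropy mu [fset 0] K - (numer supp O n c)%:~R / (N ^ 3)%:R| <=
  (margin O n c)%:R / (N ^ 3)%:R.
Proof.
have r0 : (0 < r)%N by rewrite expn_gt0 card_gt0.
have q0 : (0 < q)%N by exact: card_gt0.
have rr : 0 < r%:R :> R by rewrite ltr0n.
have q4 : (10 <= q ^ 4)%N by apply: (@leq_trans (2 ^ 4)); rewrite // leq_exp2r.
have qr : (2 * q <= r)%N.
  apply: (@leq_trans (q ^ 2)); first by rewrite expnS expn1 leq_mul2r A2 orbT.
  by rewrite leq_pexp2l //; lia.
have x0 W a : 0 <= x W a by exact: mass_ge0.
have X1 W : \sum_a x W a <= 1.
  rewrite xsum -(mass_setT mu); apply: mass_le => //; exact: measurable_cylinder.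
have lN W a : (l W a <= r * r)%N by rewrite -NE; exact: lo_le.
have xl W a : `|(r * r)%:R * x W a - (l W a)%:R| <= 3.
  by rewrite -NE; apply: (lof_close d0 nc gamma_gt0 beta_ge0 suppE gammaA betaA Kbox pc gibbs).
have E := entropy_error A2 qr x0 X1 lN xl.
rewrite cond_entropy_codes numer_sum margin_ratio NE.
apply: le_trans E _; rewrite card_ord.
have qq0 : 0 < q%:R :> R by rewrite ltr0n.
rewrite mulrA ler_pdivrMr // ler_pdivlMl ?exprn_gt0 //.
rewrite -!natrX -!natrM ler_nat.
have -> : (10 * (q ^ 2))%N = (10 * q ^ 2)%N by [].
apply: (@leq_trans (q ^ (2 * n ^ d.-1 + 1) * (q ^ kap O n c * (q ^ 4 * q ^ 2)))).
  by rewrite !leq_mul2l !leq_mul2r q4 !orbT.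
by rewrite /r -!expnD leq_pexp2l //; lia.
Qed.

Lemma outputs_correct (s : memory) : (numer supp O n c - (margin O n c)%:Z = s 0) ->
  numer supp O n c + (margin O n c)%:Z = s 1 -> (N * N * N)%N%:Z = s 2 ->
  [/\ s 2 != 0, output_low R s <= cond_entropy mu [fset 0] K <= output_high R s &
      output_high R s - output_low R s <= expR (- (n ^ d.-1)%N%:R)].
Proof.
move=> e0 e1 e2; have N0 : (0 < N)%N by rewrite expn_gt0 card_gt0.
have N3 : (N * N * N = N ^ 3)%N by rewrite !expnS expn0 muln1 mulnA.
have N30 : 0 < (N ^ 3)%:R :> R by rewrite ltr0n expn_gt0 N0.
have s2 : (s 2)%:~R = (N ^ 3)%:R :> R by rewrite -e2 N3.
have eL : (s 0)%:~R = (numer supp O n c)%:~R - (margin O n c)%:R :> R.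
  by rewrite -e0; move: (numer _ _ _ _) => g; rewrite intrB -pmulrn.
have eR : (s 1)%:~R = (numer supp O n c)%:~R + (margin O n c)%:R :> R.
  by rewrite -e1; move: (numer _ _ _ _) => g; rewrite intrD -pmulrn.
split.
- by rewrite -e2 N3 eqz_nat -lt0n expn_gt0 N0.
- rewrite /output_low /output_high eL eR s2 mulrBl mulrDl.
  move: output_close; rewrite ler_norml => /andP[]; move: (_ / _) => y.
  move: (_ / _) => z; move: (cond_entropy _ _ _) => h h1 h2; apply/andP; split; lra.
rewrite /output_low /output_high eL eR s2 mulrBl mulrDl margin_ratio.
move: (_ / _) => y; set k := (n ^ d.-1)%N.
have q0 : 0 < q%:R :> R by rewrite ltr0n card_gt0.
have -> : y + (q%:R ^+ (2 * k + 1))^-1 - (y - (q%:R ^+ (2 * k + 1))^-1) =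
  2 * (q%:R ^+ (2 * k + 1))^-1 by ring.
(* From exp(-1/2) ≥ 1 - 1/2, squared and inverted. *)
have e4 : expR 1 <= 4 :> R.
  have h : expR (- (2^-1)) >= 2^-1 :> R.
    by apply: le_trans (expR_ge1Dx _); lra.
  have -> : expR 1 = (expR (- 2^-1) * expR (- 2^-1))^-1 :> R.
    by rewrite -expRD -expRN; congr expR; lra.
  rewrite -[4]invrK lef_pV2 ?posrE ?mulr_gt0 ?expR_gt0 ?invr_gt0 //.
  have : 0 <= (expR (- (2^-1)) - 2^-1) * (expR (- (2^-1)) + 2^-1) :> R.
    by rewrite mulr_ge0 // ?subr_ge0 // addr_ge0 ?expR_ge0.
  nra.
rewrite expRN -[k%:R]mulr1 expRM_natl exprD expr1 exprM invfM.
rewrite [2 * _]mulrCA -[leRHS]mulr1; apply: ler_pM.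
- by rewrite invr_ge0 exprn_ge0 // exprn_ge0 // ltW.
- by rewrite mulr_ge0 // invr_ge0 ltW.
- rewrite lef_pV2 ?posrE ?exprn_gt0 ?expR_gt0 //.
  apply: lerXn2r; first by rewrite nnegrE expR_ge0.
    by rewrite nnegrE exprn_ge0.
  apply: le_trans e4 _; rewrite -natrX (ler_nat R 4) (@leq_trans (2 ^ 2)) // leq_exp2r //.
by rewrite ler_pdivrMr // mul1r ler_nat.
Qed.

End Output.

(** * Running time and termination *)

Section Growth.
Local Open Scope nat_scope.

Lemma leq_self_expn2 x : x <= 2 ^ x. Proof. exact/ltnW/ltn_expl. Qed.

Lemma leq_expb x y k : x <= y -> x ^ k <= y ^ k.
Proof. by case: k => // k; rewrite leq_exp2r. Qed.

(** Because x ≤ k(⌊x/k⌋ + 1) ≤ k 2^⌊x/k⌋; raise this to the power k. *)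
Lemma expn_le_exp2 k x : 0 < k -> x ^ k <= k ^ k * 2 ^ x.
Proof.
move=> k0; have xk : x <= k * 2 ^ (x %/ k).
  apply: (@leq_trans (k * (x %/ k).+1)); last by rewrite leq_mul2l ltn_expl ?orbT.
  by rewrite mulnC ltnW // ltn_ceil.
apply: leq_trans (_ : (k * 2 ^ (x %/ k)) ^ k <= _); first by rewrite leq_exp2r.
by rewrite expnMn -expnM leq_mul2l leq_exp2l ?leq_divM ?orbT.
Qed.

(** [expn_le_exp2] with exponent [4 * d] bounds the power of the side by [(4 * d) ^ d] times the
    square root of [2 ^ c.+1]; the other square root absorbs the constant. Roots are avoided by
    raising to powers. *)
Lemma poly_le_exp2 d e c : 0 < d -> (e * (4 * d) ^ d) ^ 2 <= 2 ^ c.+1 ->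
  e * c.*2.+1 ^ d <= 2 ^ c.+1.
Proof.
move=> d0 hc; rewrite -(leq_exp2r _ _ (isT : 0 < 2)).
have [->|e0] := posnP e; first by rewrite mul0n.
have H : (c.*2.+1 ^ d) ^ 4 <= ((4 * d) ^ d) ^ 4 * (2 ^ c.+1) ^ 2.
  have := @expn_le_exp2 (d * 4) c.*2.+1; rewrite muln_gt0 d0 => /(_ isT).
  rewrite !expnM (mulnC d 4) -!expnM => /leq_trans; apply.
  rewrite leq_mul2l; apply/orP; right; rewrite leq_exp2l //; lia.
have H2 : (c.*2.+1 ^ d) ^ 2 <= ((4 * d) ^ d) ^ 2 * 2 ^ c.+1.
  rewrite -(leq_exp2r _ _ (isT : 0 < 2)) expnMn -!expnM.
  by move: H; rewrite -!expnM.
rewrite expnMn; apply: leq_trans (_ : e ^ 2 * (((4 * d) ^ d) ^ 2 * 2 ^ c.+1) <= _).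
  by rewrite leq_mul2l H2 orbT.
rewrite mulnA -expnMn; apply: leq_trans (_ : 2 ^ c.+1 * 2 ^ c.+1 <= _).
  by rewrite leq_mul2r hc orbT.
by rewrite mulnn.
Qed.

Section Bounds.
Variables (d : nat) (A : alphabetType) (supp : 'I_d -> rel A) (O : oracle d A).
Variables (n k0 G J : nat).
Hypotheses (d2 : 2 <= d) (A2 : 2 <= #|A|).
Notation q := #|A|.
Notation tt := (n ^ d.-1 + 1).

(* sizeM bounds the side of the cube and sizeU the length of a state; 2 ^ logY
   bounds all loop counters and memB the number of bits in all cells. *)
Definition sizeM : nat := (2 * J + 3) * tt.
Definition sizeU : nat := sizeM ^ d.-1.
Definition coefX : nat := 2 * d + 2 * k0 + 24.
Definition logY : nat := (q * coefX + G + 5) * sizeU.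
Definition memB : nat := logY * (d.+2 * sizeM ^ d + 20).

Let M0 : 0 < sizeM.
Proof. by rewrite /sizeM addn3 addn1. Qed.

Let U1 : 1 <= sizeU.
Proof. by rewrite expn_gt0 M0. Qed.

Let M_U : sizeM <= sizeU.
Proof.
by rewrite -[leqLHS]expn1 /sizeU leq_pexp2l //; lia.
Qed.

Let tt_M : tt <= sizeM.
Proof. by rewrite /sizeM leq_pmull // addn3. Qed.

Let d0 : 0 < d. Proof. by lia. Qed.

(** Here [2 <= d] matters: the step [n ^ d.-1 + 1] dominates [n], so the side of the cube is a
    constant multiple of it. *)
Lemma n_lt_tt : n < tt.
Proof.
rewrite addn1 ltnS; case: d d2 => [|[|k]] // _ /=.
by case: n => // x; rewrite expnS leq_pmulr // expn_gt0.
Qed.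

Section Center.
Variable j : nat.
Hypothesis jJ : j <= J.
Notation c := (center d n j).
Notation m := c.*2.+1.
Hypothesis kapE : kap O n c <= k0 * tt.

Let c0 : 0 < c. Proof. by rewrite /center !addnA addn1. Qed.

Let m_M : m <= sizeM.
Proof.
rewrite /sizeM /center; have := n_lt_tt; set T := tt; move: jJ.
have jT : j * T <= J * T by rewrite leq_mul2r jJ orbT.
move: jT; clear; lia.
Qed.

Let R_U : m ^ d.-1 <= sizeU.
Proof. by rewrite leq_exp2r //; lia. Qed.

Let NS_M : m ^ d <= sizeM ^ d.
Proof. by rewrite leq_exp2r. Qed.

Let X_U : expX O n c <= coefX * sizeU.
Proof.
rewrite /expX /expN /coefX.
have tU : tt <= sizeU by exact: leq_trans tt_M M_U.
have h1 : 2 * d * m ^ d.-1 <= 2 * d * sizeU by rewrite leq_mul2l R_U orbT.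
have h2 : k0 * tt <= k0 * sizeU by rewrite leq_mul2l tU orbT.
move: kapE h1 h2 tU U1; clear; set T := n ^ d.-1.
move: (kap _ _ _) (2 * d * _) sizeU (k0 * _) => x y u z; nia.
Qed.

Let Yn k : k <= q * coefX + G + 5 -> 2 ^ (k * sizeU) <= 2 ^ logY.
Proof. by move=> h; rewrite leq_exp2l // leq_mul2r h orbT. Qed.

Let qX k : k <= expX O n c -> q ^ k * 2 ^ (5 * sizeU) <= 2 ^ logY.
Proof.
move=> kX; apply: (@leq_trans (2 ^ ((q * coefX) * sizeU) * 2 ^ (5 * sizeU))).
  rewrite leq_mul2r; apply/orP; right.
  apply: (@leq_trans ((2 ^ q) ^ k)); first by rewrite leq_expb // leq_self_expn2.
  rewrite -expnM leq_exp2l // -mulnA leq_mul2l; apply/orP; right.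
  exact: leq_trans kX X_U.
by rewrite -expnD -mulnDl; apply: Yn; rewrite leq_add2r leq_addr.
Qed.
Notation Y := (2 ^ logY).

Let Y_ge k : k <= 2 ^ (5 * sizeU) -> k <= Y.
Proof. by move=> h; apply: leq_trans h _; apply: Yn; rewrite leq_addl. Qed.

Let two5 : 32 <= 2 ^ (5 * sizeU).
Proof. by apply: (@leq_trans (2 ^ 5)) => //; rewrite leq_exp2l // leq_pmulr. Qed.

Let qX1 k : k <= expX O n c -> 32 * q ^ k <= Y.
Proof.
move=> kX; apply: leq_trans (qX kX).
by rewrite mulnC leq_mul2l two5 orbT.
Qed.

Let NS_Y : (m ^ d).+1 <= Y.
Proof.
apply: Y_ge; apply: (@leq_trans (2 ^ (2 * sizeU)).+1).
  rewrite ltnS; apply: leq_trans NS_M _; rewrite -{1}(prednK d0) expnS mulSn mul1n expnD.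
  apply: leq_mul; last exact: leq_self_expn2.
  by apply: leq_trans M_U _; exact: leq_self_expn2.
by rewrite ltn_exp2l // ltn_mul2r U1.
Qed.

Let qk_Y k : k <= expX O n c -> (q ^ k).+1 <= Y.
Proof.
move=> kX; apply: leq_trans (qX1 kX).
have : 0 < q ^ k by rewrite expn_gt0 card_gt0.
by move: (q ^ k); clear; lia.
Qed.

Let X_Y : (expX O n c).+1 <= Y.
Proof. by apply: leq_trans (ltnW (qk_Y (leqnn _))); exact: ltn_expl. Qed.

Let expN_X : expN O n c <= expX O n c. Proof. exact: leq_addl. Qed.
Let kap_X : kap O n c <= expX O n c.
Proof. by apply: leq_trans expN_X; rewrite /expN; lia. Qed.
Let R_X : m ^ d.-1 <= expX O n c.
Proof. by rewrite /expX; apply: leq_trans (leq_addr _ _); rewrite leq_pmull // muln_gt0. Qed.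
Let rim_X : nrim d c <= expX O n c.
Proof. by apply: leq_trans (nrim_le d c0) _; rewrite leq_addr. Qed.
Let q_Y : q.+1 <= Y.
Proof. by rewrite -[q]expn1; apply: qk_Y; apply: leq_trans R_X; rewrite expn_gt0. Qed.

Let N_Y : (bigN O n c).+1 <= Y. Proof. exact: qk_Y. Qed.

Lemma kbody_le : kbody O n c <= Y ^ 7.
Proof.
have e1 := qk_Y R_X; have e2 := qk_Y rim_X; have e3 := qk_Y kap_X.
have Y2 : 32 <= Y by exact: Y_ge.
have h1 : (q ^ m ^ d.-1).+1 * (m ^ d).+1 * (q ^ nrim d c).+1 * q.+1 * (q ^ kap O n c).+1 <=
    Y * Y * Y * Y * Y by do 4 apply: leq_mul => //.
have h2 : (q * bigN O n c).+1 <= Y * Y.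
  by apply: leq_trans (_ : q.+1 * (bigN O n c).+1 <= _); [rewrite mulSn mulnS; lia|exact: leq_mul].
rewrite /kbody; apply: leq_trans (leq_add (leq_add (leq_add h1 NS_Y) X_Y) h2) _.
move: Y2; rewrite !expnS expn0 muln1; move: Y; clear => y y2.
have a1 : y <= y * y by rewrite leq_pmulr //; lia.
have a2 : y * y <= y * y * y * y * y.
  have -> : y * y * y * y * y = (y * y) * (y * y * y) by rewrite !mulnA.
  by rewrite leq_pmulr // !muln_gt0; lia.
apply: (@leq_trans (4 * (y * y * y * y * y))); first by lia.
have -> : y * (y * (y * (y * (y * (y * y))))) = (y * y) * (y * y * y * y * y) by rewrite !mulnA.
by rewrite leq_mul2r; apply/orP; right; nia.
Qed.

Hypothesis gam_b : forall x, gam O c x <= 2 ^ (m + G).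
Hypothesis bet_b : forall i y x, bet supp O c i y x <= 2 ^ (m + G).
Hypothesis gam_ge0 : forall x, (0 <= gamma_approx O x m)%R.
Hypothesis bet_ge0 : forall i y x, supp i y x -> (0 <= beta_approx O i y x m)%R.

Let W_Y : 2 ^ (m + G) <= Y.
Proof.
rewrite leq_exp2l // /logY; apply: (@leq_trans ((1 + G) * sizeU)).
  rewrite mulnDl mul1n leq_add //; first exact: leq_trans m_M M_U.
  by rewrite leq_pmulr.
by rewrite leq_mul2r; apply/orP; right; lia.
Qed.

Let Y0 : 0 < Y. Proof. by rewrite expn_gt0. Qed.

(** One layer brings a sum over [q] letters, a site weight and [d] edge weights, and each of these
    [d.+2] factors is at most [Y]. *)
Lemma zdp_le D W a free i st : zdp supp O n c D W a free i st <= (Y ^ d.+2) ^ i.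
Proof.
elim: i st => [|i IH] st; first by rewrite expn0.
rewrite zdpS expnS; apply: (@leq_trans (\sum_(x : A) Y ^ d.+1 * (Y ^ d.+2) ^ i)).
  apply: leq_sum => x _; apply: leq_mul => //.
  rewrite /local_wt -[leqRHS]mul1n; apply: leq_mul.
    by rewrite allowedE; case: orb.
  rewrite /site_wt; case: ifP => _; last by rewrite expn_gt0 Y0.
  rewrite expnS; apply: leq_mul; first exact: leq_trans (gam_b _) W_Y.
  rewrite -[X in _ <= _ ^ X]card_ord -prod_nat_const; apply: leq_prod => k _.
  case: ifP => _; last exact: Y0.
  exact: leq_trans (bet_b _ _ _) W_Y.
rewrite sum_nat_const mulnA leq_mul2r [Y ^ d.+2]expnS leq_mul2r.
by rewrite (ltnW q_Y) !orbT.
Qed.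

Let Yk_B k : k <= d.+2 * sizeM ^ d + 19 -> Y ^ k < 2 ^ memB.
Proof.
move=> h; rewrite -expnM ltn_exp2l // /memB ltn_pmul2l; first by lia.
by rewrite /logY muln_gt0 U1 addnC.
Qed.

Let small x : x <= Y -> x < 2 ^ memB.
Proof.
by move=> h; apply: leq_ltn_trans (Yk_B (k := 1) _); rewrite ?expn1 //; lia.
Qed.

Lemma fits_center : fits supp O memB n c.
Proof.
have gb x : gam O c x <= Y by exact: leq_trans (gam_b x) W_Y.
have bb i y x : bet supp O c i y x <= Y by exact: leq_trans (bet_b i y x) W_Y.
have qN_Y : q * bigN O n c <= Y ^ 2.
  by rewrite expnS expn1; apply: leq_mul; exact: ltnW.
split; [split|split|split| | ] => //.
- by move=> x; apply: small; exact: ltnW (gb x).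
- by move=> i y x s; apply: small; have := bb i y x; rewrite /bet s; exact: ltnW.
- apply: small; apply: leq_trans (ltnW NS_Y); rewrite -[leqLHS]expn1 leq_pexp2l //.
- by apply: small; exact: ltnW.
- by apply: leq_ltn_trans qN_Y (Yk_B _); lia.
- by apply: small; exact: ltnW.
- by apply: small; exact: ltnW (qk_Y (leqnn _)).
- move=> D W a free i st iN _.
  apply: (@leq_ltn_trans (Y ^ (1 + d.+2 * sizeM ^ d))).
    rewrite expnD expn1; apply: leq_mul; first exact: ltnW.
    apply: leq_trans (zdp_le _ _ _ _ _ _) _; rewrite -expnM leq_pexp2l //.
    by rewrite leq_mul2l (leq_trans iN NS_M) orbT.
  by apply: Yk_B; lia.
have hb e : harm O n c e <= e * (bigN O n c * bigN O n c).
  rewrite /harm -[X in _ <= X * _]card_ord -sum_nat_const leq_sum // => i _.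
  exact: leq_div.
have N_Y' : bigN O n c <= Y by exact: ltnW.
have k_Y : q ^ kap O n c <= Y by exact: ltnW (qk_Y kap_X).
apply: (@leq_ltn_trans (Y ^ 7 + Y ^ 3)).
  apply: leq_add; last first.
    by rewrite !expnS expn0 muln1 mulnA; apply: leq_mul => //; exact: leq_mul.
  apply: (@leq_trans (Y * (Y ^ 2 * (Y ^ 2 * (Y * Y))))).
    apply: leq_mul => //; apply: leq_mul => //; apply: leq_trans (hb _) _.
    by apply: leq_mul => //; exact: leq_mul.
  by rewrite [Y * Y]mulnn -!expnD -expnS.
apply: (@leq_ltn_trans (Y ^ 8)); last by apply: Yk_B; lia.
rewrite [Y ^ 8]expnS; apply: (@leq_trans (2 * Y ^ 7)).
  by rewrite mul2n -addnn leq_add2l leq_pexp2l.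
by rewrite leq_mul2r Y_ge ?orbT //; apply: leq_trans two5.
Qed.

Lemma n_lt_B : n < 2 ^ memB.
Proof.
apply: small; apply: leq_trans (ltnW n_lt_tt) _; apply: Y_ge.
apply: leq_trans tt_M _; apply: leq_trans M_U _; apply: leq_trans (leq_self_expn2 _) _.
by rewrite leq_exp2l // leq_pmull.
Qed.

End Center.

Lemma memB_gt0 : 0 < memB.
Proof. by rewrite /memB /logY !muln_gt0 U1 addnC addnC /= !addnS. Qed.

Definition time_coef (s : nat) : nat :=
  (9 * (q * coefX + G + 5) + (J.+1 * ((d + 22) * s))) * (2 * J + 3) ^ d.-1.

(** Seven powers of [2 ^ logY] pay for the loops and two for [memB], whence the 9 in [time_coef];
    the constants go into the exponent by x ≤ 2^x. The point is that [time_coef] does not involve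
    [n]. *)
Lemma time_le s : (2 ^ logY) ^ 7 * J.+1 * (memB * s) <= 2 ^ (time_coef s * tt ^ d.-1).
Proof.
set Y := 2 ^ logY; have yY : logY <= Y by exact: leq_self_expn2.
have MY : sizeM ^ d <= Y.
  rewrite -{1}(prednK d0) expnS; apply: (@leq_trans (2 ^ sizeU * 2 ^ sizeU)).
    apply: leq_mul; last exact: leq_self_expn2.
    by apply: leq_trans M_U _; exact: leq_self_expn2.
  by rewrite -expnD leq_exp2l // addnn -mul2n /logY leq_mul2r; apply/orP; right; lia.
have Y0 : 0 < Y by rewrite expn_gt0.
have bY : memB <= Y * ((d + 22) * Y).
  rewrite /memB; apply: leq_mul => //.
  apply: (@leq_trans (d.+2 * Y + 20 * Y)); last by rewrite -mulnDl leq_mul2r; apply/orP; right; lia.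
  by rewrite leq_add // ?leq_pmulr // leq_mul2l MY orbT.
apply: (@leq_trans (Y ^ 9 * (J.+1 * ((d + 22) * s)))).
  apply: leq_trans (_ : Y ^ 7 * J.+1 * (Y * ((d + 22) * Y) * s) <= _).
    by rewrite leq_mul2l leq_mul2r bY !orbT.
  have -> : Y ^ 9 = Y ^ 7 * (Y * Y) by rewrite mulnn -expnD.
  by apply/eq_leq; ring.
apply: (@leq_trans (Y ^ 9 * 2 ^ (J.+1 * ((d + 22) * s)))).
  by rewrite leq_mul2l leq_self_expn2 orbT.
have tE : time_coef s * tt ^ d.-1 =
    (9 * (q * coefX + G + 5) + (J.+1 * ((d + 22) * s))) * sizeU.
  by rewrite /time_coef -mulnA -expnMn.
rewrite tE -expnM -expnD leq_exp2l // [leqRHS]mulnDl; apply: leq_add.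
  by rewrite /logY mulnC mulnA.
by rewrite leq_pmulr.
Qed.

End Bounds.

End Growth.

Lemma expR_ge_exp2 (R : realType) k : (2 ^ k)%:R <= expR (k%:R) :> R.
Proof.
rewrite natrX -[k%:R]mulr1 expRM_natl; apply: lerXn2r; rewrite ?nnegrE ?expR_ge0 //.
by apply: le_trans (expR_ge1Dx 1); rewrite -natr1.
Qed.

Lemma exp2_bound (R : realType) (x : R) : exists k : nat, x <= (2 ^ k)%:R.
Proof.
exists (Num.bound x); apply: (@le_trans _ _ `|x|); first exact: ler_norm.
apply: le_trans (ltW (archi_boundP (normr_ge0 x))) _.
have -> : Num.bound `|x| = Num.bound x by rewrite /Num.bound normr_id.
by rewrite ler_nat leq_self_expn2.
Qed.

Lemma exp2_bound_fin (R : realType) (I : finType) (f : I -> R) :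
  exists k : nat, forall i, f i <= (2 ^ k)%:R.
Proof.
have [g hg] := choice (fun i => exp2_bound (f i)).
exists (\sum_i g i)%N => i; apply: le_trans (hg i) _.
by rewrite ler_nat leq_exp2l // (bigD1 i) //= leq_addr.
Qed.

(** * A round by which the search must stop *)

Section Stopping.
Variables (R : realType) (d : nat) (A : alphabetType) (supp : 'I_d -> rel A).
Variables (gamma : A -> R) (beta : 'I_d -> A -> A -> R).
Variables (O : oracle d A) (n k0 G C' J : nat) (C alpha : R).
Hypotheses (d2 : (2 <= d)%N) (A2 : (2 <= #|A|)%N).
Hypothesis gamma_gt0 : forall a, 0 < gamma a.
Hypothesis beta_ge0 : forall i a b, 0 <= beta i a b.
Hypothesis suppE : forall i a b, (0 < beta i a b) = supp i a b.
Hypothesis gammaA : forall a, approximates (gamma_approx O a) (gamma a).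
Hypothesis betaA : forall i a b, approximates (beta_approx O i a b) (beta i a b).
Hypothesis Kbox : forall v, v \in oracle_set O n -> in_box n v && (v != 0).
Notation q := #|A|.
Notation tt := (n ^ d.-1 + 1)%N.
Notation K := (oracle_set O n).
Hypothesis Kcard : (#|` K| <= k0 * tt)%N.

Lemma kap_card c : (n < c)%N -> kap O n c = #|` K|.
Proof.
move=> nc; rewrite /kap; apply: total_card => //; last exact: K_box nc Kbox.
exact: leq_ltn_trans nc.
Qed.

Definition coefN : nat := (q * (2 * k0 + 24))%N.

Lemma bigN_le c : (n < c)%N -> (bigN O n c <= 2 ^ (coefN * tt))%N.
Proof.
move=> nc; rewrite /bigN; apply: (@leq_trans ((2 ^ q) ^ expN O n c)).
  by apply: leq_expb; exact: leq_self_expn2.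
rewrite -expnM leq_exp2l // /coefN -mulnA leq_mul2l; apply/orP; right.
rewrite /expN kap_card //; move: Kcard; set x := #|` K|; set y := (n ^ d.-1)%N.
clear; nia.
Qed.

(** The hypothesis of [poly_le_exp2] for [e = 17 * d.+1]; 17 rather than 16 leaves room for the
    summand 1 in [thr_le]. *)
Definition coefP : nat := (((17 * d.+1) * (4 * d) ^ d) ^ 2)%N.

Hypothesis J1 : (coefP + coefN + G <= J)%N.
Notation c := (center d n J).
Notation m := c.*2.+1.

Let nc : (n < c)%N. Proof. by rewrite /center addnA addn1 ltnS leq_addr. Qed.
Let d0 : (0 < d)%N. Proof. by lia. Qed.

Let c_large : (coefP + coefN * tt + G <= c)%N.
Proof.
rewrite /center; apply: (@leq_trans (J * tt)); last by lia.
apply: (@leq_trans ((coefP + coefN + G) * tt)); last by rewrite leq_mul2r J1 orbT.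
rewrite addn1; clear; move: coefP coefN (n ^ d.-1)%N => x y z; nia.
Qed.

(** The exponent splits into [c.+1], which beats the polynomial in [m], and [c - G], which beats
    N. *)
Lemma thr_le : (thr O n c + 1 <= 2 ^ (m - G))%N.
Proof.
have P1 : (17 * d.+1 * m ^ d <= 2 ^ c.+1)%N.
  apply: poly_le_exp2 => //; rewrite -/coefP; apply: leq_trans (leq_self_expn2 _) _.
  by rewrite leq_exp2l //; move: c_large; lia.
have P2 := bigN_le nc.
have -> : (m - G = c.+1 + (c - G))%N by move: c_large; clear; lia.
rewrite expnD; apply: leq_trans (_ : 17 * d.+1 * m ^ d * bigN O n c <= _)%N.
  rewrite /thr; have : (0 < d.+1 * m ^ d * bigN O n c)%N.
    by rewrite !muln_gt0 !expn_gt0 card_gt0.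
  by rewrite -!mulnA; move: (d.+1 * _)%N; clear; lia.
apply: leq_mul => //; apply: leq_trans P2 _; rewrite leq_exp2l //.
by move: c_large; clear; lia.
Qed.

Hypothesis gammaG : forall x, (gamma x)^-1 <= (2 ^ G)%:R.
Hypothesis betaG : forall i y x, (beta i y x)^-1 <= (2 ^ G)%:R.

(** As x ≥ 2^-G, the scaled weight 2^m x is at least 2^(m-G), which exceeds [thr]. *)
Lemma approx_precise (f : nat -> int) (x : R) : approximates f x -> 0 < x ->
  x^-1 <= (2 ^ G)%:R -> (thr O n c <= `|f m|)%N.
Proof.
move=> fx x0 xG; have f0 := approx_ge0 m fx x0.
have /andP[h _] := approx_upper fx f0.
have G0 : 0 < (2 ^ G)%:R :> R by rewrite ltr0n expn_gt0.
rewrite -ltnS -(ler_nat R); apply: le_trans h.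
apply: le_trans (_ : (2 ^ (m - G))%:R <= _); first by rewrite ler_nat; have := thr_le; rewrite addn1.
have Gm : (G <= m)%N by move: c_large; lia.
have -> : 2 ^+ m = (2 ^ (m - G))%:R * (2 ^ G)%:R :> R.
  by rewrite -natrM -expnD subnK // natrX.
rewrite -mulrA; apply: ler_peMr => //.
by rewrite -[leLHS](mulVf (lt0r_neq0 x0)); apply: ler_wpM2r => //; exact: ltW.
Qed.

Lemma precise_at : precise supp O n c.
Proof.
apply/andP; split.
  apply/forallP => x; exact: approx_precise (gammaA x) (gamma_gt0 x) _.
apply/forallP => i; apply/forallP => y; apply/forallP => x; apply/implyP => s.
apply: (approx_precise (betaA i y x)) => //; by rewrite suppE.
Qed.

Hypotheses (C0 : 0 < C) (alpha0 : 0 < alpha).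
Hypothesis CC : C <= (2 ^ C')%:R.
Hypothesis J2 : (k0 + C' + coefN + 3)%:R <= alpha * J%:R.
Hypothesis ssm : forall (V : {fset 'rV[int]_d}) (u : 'rV[int]_d) (T : {fset 'rV[int]_d})
    (VT : boundary V `<=` T) (x : cfg A [fset u]) (y z : cfg A T),
  u \in V -> T `<=` V `|` boundary V ->
  let delta := restr VT y in let eta := restr VT z in
  admissible gamma beta delta -> admissible gamma beta eta ->
  0 < spec_pr gamma beta delta y -> 0 < spec_pr gamma beta eta z ->
  (`|spec_cond_pr gamma beta delta x y - spec_cond_pr gamma beta eta x z|%:E <=
      C%:E * expeR (- (alpha%:E * set_dist R u (diff_set y z))))%E.

(** [c - n] exceeds [J] times [n ^ d.-1 + 1], and [C], the number of sites and [4 * N] are each at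
    most 2 to a multiple of [n ^ d.-1 + 1]; by [J2] the decay beats their product. *)
Lemma mixing_small : (#|` K|.+1)%:R * (C * expR (- (alpha * (c - n)%N%:R))) <=
  (4 * bigN O n c)%:R^-1.
Proof.
have N0 : (0 < bigN O n c)%N by rewrite expn_gt0 card_gt0.
rewrite -[leRHS]mul1r ler_pdivlMr ?ltr0n ?muln_gt0 ?N0 // expRN.
have -> : (#|` K|.+1)%:R * (C * (expR (alpha * (c - n)%N%:R))^-1) * (4 * bigN O n c)%:R =
    C * (#|` K|.+1 * (4 * bigN O n c))%:R / expR (alpha * (c - n)%N%:R).
  by rewrite [in RHS]natrM; ring.
rewrite ler_pdivrMr ?expR_gt0 // mul1r.
have h : (#|` K|.+1 * (4 * bigN O n c) <= 2 ^ ((k0 + 1) * tt) * (2 ^ 2 * 2 ^ (coefN * tt)))%N.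
  apply: leq_mul; last by apply: leq_mul => //; exact: bigN_le.
  apply: leq_trans (leq_self_expn2 _); rewrite mulnDl mul1n.
  by rewrite -addn1 leq_add // addn1.
apply: (@le_trans _ _ ((2 ^ C')%:R * (2 ^ ((k0 + 1) * tt) * (2 ^ 2 * 2 ^ (coefN * tt)))%:R)).
  by apply: ler_pM => //; rewrite ?ler_nat // ltW.
rewrite -natrM -!expnD; apply: le_trans (expR_ge_exp2 R _) _; rewrite ler_expR.
apply: (@le_trans _ _ (((k0 + C' + coefN + 3) * tt)%:R)).
  rewrite ler_nat addn1; move: (n ^ d.-1)%N coefN; clear => x y; nia.
rewrite natrM; apply: le_trans (_ : alpha * J%:R * tt%:R <= _).
  by rewrite ler_wpM2r.
rewrite -mulrA ler_pM2l // -natrM ler_nat /center; lia.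
Qed.

Lemma stops_at : stops supp O n J.
Proof.
rewrite /stops precise_at /= /all_good big_andE; apply/forallP => W /=.
rewrite big_andE; apply/forallP => a /=; rewrite -[X in good _ _ _ _ _ X](letterK (ltn_ord a)).
apply: (good_close d0 nc gamma_gt0 beta_ge0 suppE gammaA betaA Kbox precise_at).
move=> delta eta ad ae; apply: le_trans mixing_small.
pose s := enum_fset (0 |` K).
have ms : matches (mem (0 |` K)) (tau O n c W (letter a)) =
    matches (mem s) (tau O n c W (letter a)) :> (cfg A (inner d c) -> bool) by [].
rewrite ms.
have sz : (size s <= #|` K|.+1)%N.
  by rewrite /s -/(#|` 0 |` K|) cardfsU1; case: (_ \notin _).
apply: le_trans (ssm_masses gamma_gt0 beta_ge0 C0 alpha0 (@ssm (inner d c))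
   (r := (c - n)%N) _ ad ae _ _) _.
- move=> v; rewrite /s in_fset1U => /orP[/eqP ->|/(K_inner nc Kbox)/andP[]//].
  exact: zero_inner.
- move=> u v us vB; apply: inner_dist vB => //.
  move: us; rewrite in_fset1U => /orP[/eqP ->|/Kbox/andP[]//].
  by apply/forallP => i; rewrite mxE.
rewrite ler_wpM2r ?ler_nat // mulr_ge0 ?expR_ge0 //; exact: ltW.
Qed.

End Stopping.

(** [cc] is chosen before [n] and the approximations, so the exponent is uniform in both. The size
    of [K n] is bounded for one [n] at a time, which lets [k0] be adapted at the finitely many small
    [n]. *)
Lemma program_correct (R : realType) (d : nat) (A : alphabetType)
    (supp : 'I_d -> rel A) (gamma : A -> R) (beta : 'I_d -> A -> A -> R)
    (mu : probability (borel_fullshift d A) R) (K : nat -> {fset 'rV[int]_d}) :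
  (2 <= d)%N -> (2 <= #|A|)%N ->
  (forall a, 0 < gamma a) -> (forall i a b, 0 <= beta i a b) ->
  (forall i a b, (0 < beta i a b) = supp i a b) ->
  gibbs_measure gamma beta mu -> strong_spatial_mixing gamma beta ->
  (forall n v, v \in K n -> in_box n v && (v != 0)) ->
  forall k0 : nat, exists cc : nat, forall n,
  (#|` K n| <= k0 * (n ^ d.-1 + 1))%N ->
  forall (gamma_q : A -> nat -> int) (beta_q : 'I_d -> A -> A -> nat -> int),
    (forall a, approximates (gamma_q a) (gamma a)) ->
    (forall i a b, approximates (beta_q i a b) (beta i a b)) ->
  exists (t : nat) (s : memory),
    [/\ exec (Oracle gamma_q beta_q K) (input n) (program supp) t s,
        t%:R <= expR ((cc * (n ^ d.-1 + 1) ^ d.-1)%N%:R) :> R,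
        (s 2 != 0),
        output_low R s <= cond_entropy mu [fset 0] (K n) <= output_high R s &
        output_high R s - output_low R s <= expR (- (n ^ d.-1)%N%:R)].
Proof.
move=> d2 A2 gamma_gt0 beta_ge0 suppE gibbs [C [alpha [C0 alpha0 ssm]]] Kbox k0.
have [g1 hg1] := exp2_bound_fin (fun x => gamma x + 2).
have [g2 hg2] := exp2_bound_fin (fun x => (gamma x)^-1).
have [g3 hg3] := exp2_bound_fin (fun iyx : 'I_d * A * A => beta iyx.1.1 iyx.1.2 iyx.2 + 2).
have [g4 hg4] := exp2_bound_fin (fun iyx : 'I_d * A * A => (beta iyx.1.1 iyx.1.2 iyx.2)^-1).
have [C' hC'] := exp2_bound C.
pose G := (g1 + g2 + g3 + g4)%N.
have up k (x : R) : (k <= G)%N -> x <= (2 ^ k)%:R -> x <= (2 ^ G)%:R.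
  by move=> kG h; apply: le_trans h _; rewrite ler_nat leq_exp2l.
have gamma2 x : gamma x + 2 <= (2 ^ G)%:R by apply: up (hg1 x); lia.
have gammaV x : (gamma x)^-1 <= (2 ^ G)%:R by apply: up (hg2 x); lia.
have beta2 i y x : beta i y x + 2 <= (2 ^ G)%:R by apply: up (hg3 (i, y, x)); lia.
have betaV i y x : (beta i y x)^-1 <= (2 ^ G)%:R by apply: up (hg4 (i, y, x)); lia.
have [j2 hj2] := exp2_bound ((k0 + C' + coefN A k0 + 3)%:R / alpha).
(* The first three summands make the weights precise; the last, through which the mixing constants
   enter, makes the mixing bound small. *)
pose J := (coefP d + coefN A k0 + G + 2 ^ j2)%N.
have J0 : (0 < J)%N by rewrite addn_gt0 expn_gt0 orbT.
exists (time_coef d A k0 G J (csize (program supp))) => n Kn gamma_q beta_q gA bA.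
pose O := Oracle gamma_q beta_q K.
have Kb : forall v, v \in oracle_set O n -> in_box n v && (v != 0) := Kbox n.
have nc j : (n < center d n j)%N by rewrite /center addnA addn1 ltnS leq_addr.
have weight_b c (f : nat -> int) (x : R) : approximates f x -> 0 <= f c.*2.+1 ->
    x + 2 <= (2 ^ G)%:R -> (`|f c.*2.+1|.+1 <= 2 ^ (c.*2.+1 + G))%N.
  move=> fx f0 xG; have /andP[_ h] := approx_upper fx f0.
  rewrite -(ler_nat R); apply: le_trans h _.
  rewrite expnD natrM natrX; apply: le_trans (_ : 2 ^+ c.*2.+1 * (x + 2) <= _).
    rewrite mulrDr lerD2l ler_peMl // -natrX ler1n expn_gt0 //.
  by rewrite ler_wpM2l // exprn_ge0.
have gam0 c x : 0 <= gamma_approx O x c.*2.+1 by apply: approx_ge0 (gA x) _.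
have bet0 c i y x : supp i y x -> 0 <= beta_approx O i y x c.*2.+1.
  by rewrite -suppE; apply: approx_ge0.
have gam_b c x : (gam O c x <= 2 ^ (c.*2.+1 + G))%N.
  exact: weight_b (gA x) (gam0 _ _) _.
have bet_b c i y x : (bet supp O c i y x <= 2 ^ (c.*2.+1 + G))%N.
  by rewrite /bet; case: ifP => // s; apply: weight_b (bA i y x) (bet0 _ _ _ _ s) _.
have kapE j : (kap O n (center d n j) <= k0 * (n ^ d.-1 + 1))%N.
  by rewrite (kap_card Kb (nc j)).
have st : stops supp O n J.
  apply: (@stops_at R d A supp gamma beta O n k0 G C' J C alpha) => //.
    by rewrite leq_addr.
  rewrite mulrC -ler_pdivrMr //; apply: le_trans hj2 _.
  by rewrite ler_nat leq_addl.
have fitJ j : (0 < j <= J)%N -> fits supp O (memB d A n k0 G J) n (center d n j).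
  move=> /andP[_ jJ]; apply: (fits_center d2 A2 jJ (kapE j)) => [x|i y x|x|i y x s].
  - exact: gam_b.
  - exact: bet_b.
  - exact: gam0.
  exact: bet0 s.
have kJ j : (0 < j <= J)%N ->
    (kbody O n (center d n j) <= (2 ^ logY d A n k0 G J) ^ 7)%N.
  by move=> /andP[_ jJ]; exact: (kbody_le G d2 A2 jJ (kapE j)).
have nB : (n < 2 ^ memB d A n k0 G J)%N.
  exact: (n_lt_B G d2 A2 (leqnn J) (kapE J)).
have [t [s [ex tle _ [j [jJ sj [h0 h1 h2]]]]]] :=
  runs_program (memB_gt0 d A n k0 G J) nB J0 fitJ kJ st.
exists t, s; move: sj => /andP[pc ag].
have [||||e1 e2 e3] := @outputs_correct R d A supp gamma beta O n (center d n j)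
  _ (nc j) A2 gamma_gt0 beta_ge0 suppE gA bA Kb mu gibbs pc ag s.
- by lia.
- by rewrite h0.
- by rewrite h1.
- by rewrite h2.
split => //; apply: le_trans (expR_ge_exp2 R _); rewrite ler_nat.
exact: leq_trans tle (time_le n k0 G J d2 A2 _).
Qed.

(* The program may depend on d, on the alphabet and on which pair interactions
   vanish, but not on the numerical values of the interactions (available only
   through approximations), nor on the mixing constants C and alpha. *)
Theorem theorem4p5 (R : realType) (d : nat) (hd : (2 <= d)%N)
    (A : alphabetType) (hA : (2 <= #|A|)%N) (supp : 'I_d -> rel A) :
  exists M : cmd d A,
  forall (gamma : A -> R) (beta : 'I_d -> A -> A -> R)
         (mu : probability (borel_fullshift d A) R)
         (K : nat -> {fset 'rV[int]_d}),
    (forall a, 0 < gamma a) ->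
    (forall i a b, 0 <= beta i a b) ->
    (forall i a b, (0 < beta i a b) = supp i a b) ->
    gibbs_measure gamma beta mu ->
    strong_spatial_mixing gamma beta ->
    (forall n v, v \in K n -> in_box n v && (v != 0)) ->
    bigOh (fun n => (#|` K n|)%:R : R) (fun n => (n ^ d.-1)%N%:R) ->
  exists f : nat -> R,
    bigOh f (fun n => (n ^ (d.-1 ^ 2))%N%:R) /\
    forall (gamma_q : A -> nat -> int) (beta_q : 'I_d -> A -> A -> nat -> int),
      (forall a, approximates (gamma_q a) (gamma a)) ->
      (forall i a b, approximates (beta_q i a b) (beta i a b)) ->
    forall n : nat,
    exists (t : nat) (s : memory),
      [/\ exec (Oracle gamma_q beta_q K) (input n) M t s,
          t%:R <= expR (f n),
          (s 2 != 0),
          output_low R s <= cond_entropy mu [fset 0] (K n) <= output_high R s &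
          output_high R s - output_low R s <= expR (- (n ^ d.-1)%N%:R)].
Proof.
exists (program supp) => gamma beta mu K gamma_gt0 beta_ge0 suppE gibbs ssm Kbox.
move=> [c1 c1_gt0 [n1 Kbig]].
have [F HF] := choice (program_correct hd hA gamma_gt0 beta_ge0 suppE gibbs ssm Kbox).
have [k1 hk1] := exp2_bound c1.
(* The growth hypothesis is silent below [n1], but the output must be correct for every [n]; there
   the size of [K n] itself serves as the constant. *)
pose k0 n := if (n1 <= n)%N then (2 ^ k1)%N else #|` K n|.
exists (fun n => (F (k0 n) * (n ^ d.-1 + 1) ^ d.-1)%N%:R); split; last first.
  move=> gq bq gA bA n; apply: HF => //; rewrite /k0; case: (leqP n1 n) => [n1n|_].
    rewrite -(ler_nat R); have := Kbig _ n1n; rewrite ger0_norm // => h.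
    apply: le_trans h _; rewrite natrM; apply: ler_pM => //; first exact: ltW.
    by rewrite ler_nat leq_addr.
  by rewrite addn1 leq_pmulr.
(* For [n >= 1], [n ^ d.-1 + 1 <= 2 * n ^ d.-1] yields the factor [2 ^ d.-1]; the successor makes
   the constant positive. *)
exists (F (2 ^ k1)%N * 2 ^ d.-1)%N.+1%:R; first by rewrite ltr0n.
exists (maxn n1 1) => n; rewrite geq_max => /andP[n1n n0].
rewrite ger0_norm // /k0 n1n -natrM ler_nat.
apply: leq_trans (_ : F (2 ^ k1) * (2 * n ^ d.-1) ^ d.-1 <= _)%N.
  rewrite leq_mul2l; apply/orP; right; apply: leq_expb.
  by rewrite mul2n -addnn leq_add2l expn_gt0 n0.
by rewrite expnMn -expnM mulnn mulnA leq_mul2r leqnSn orbT.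
Qed.
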